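(* Let $r\ge 1$, $k\ge 0$, let $W\subset T_\circ^kE$ be open, and let $\theta$ be a smooth $r$-form on $W$ with $S\theta=0$ (i.e. $\theta\in\Psi^r$) and $\delta\theta=0$. Then locally there is an $(r-1)$-form $$\psi\in\begin{cases}\Psi^{r-1} & (r\ge 2)\\ \overline{\Omega}{}^0 & (r=1)\end{cases}$$ satisfying $\delta\psi=\theta$. Explicitly: every point of $W$ has an open neighbourhood $U\subset W$ such that, for some $l\ge k$, there is such a $\psi$ of order $l$ defined on the preimage of $U$ in $T_\circ^lE$ (for $r\ge 2$ a form with $S\psi=0$; for $r=1$ a function taken modulo constants), with $\delta\psi=\theta$ modulo pull-back.
   Context: Let $E$ be a smooth manifold of dimension $n+1$. For $k\ge 0$, $T_\circ^kE$ is the $k$-th order non-degenerate tangent bundle: the manifold of $k$-jets at $0$ of smooth curves $\gamma:\mathbb{R}\to E$ with, for $k\ge1$, $\dot\gamma(0)\neq 0$ ($T_\circ^0E=E$). Local coordinates $q^i$ on $E$ induce coordinates $q^i_{(p)}$, $0\le p\le k$, on $T_\circ^kE$ ($q^i_{(p)}$ is the $p$-th derivative coordinate). $\Omega^r_k$ denotes the smooth $r$-forms on $T_\circ^kE$, $\Omega^r$ the $r$-forms of unspecified (finite) order, and $\overline{\Omega}{}^0=\Omega^0/\mathbb{R}$ (functions modulo constants). Equality ''modulo a pull-back'' means that two forms, possibly of different orders, become equal when both are pulled back to some common $T_\circ^lE$ along the natural projections $T_\circ^lE\to T_\circ^kE$, $l\ge k$. All identities between forms of unspecified order are understood in this sense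 (equivalently, a form is identified with its pull-backs, so $\Omega^r=\bigcup_k\Omega^r_k$). The operators below are also defined on forms on open subsets of $T_\circ^kE$, the results being defined on preimages of those open subsets in higher-order manifolds. Total time derivative: $d_{\mathrm T}=\sum_{p=0}^k q^i_{(p+1)}\frac{\partial}{\partial q^i_{(p)}}$, a vector field along $T_\circ^{k+1}E\to T_\circ^kE$; it acts on forms as the degree $0$ derivation $d_{\mathrm T}:\Omega^r_k\to\Omega^r_{k+1}$ that commutes with the exterior derivative $d$ and acts on functions in the obvious way (so $d_{\mathrm T}(dq^i_{(p)})=dq^i_{(p+1)}$). Vertical endomorphism: $S=\sum_{p=0}^{k-1}(p+1)\,dq^i_{(p)}\otimes\frac{\partial}{\partial q^i_{(p+1)}}$, a type $(1,1)$ tensor field on $T_\circ^kE$; it acts on forms as the degree $0$ algebraic derivation that vanishes on functions and satisfies $S(dq^i_{(p+1)})=(p+1)dq^i_{(p)}$, $S(dq^i_{(0)})=0$. $S^p$ is the $p$-fold composition of this operator. For $r\ge 1$ the operator $P:\Omega^r\to\Omega^r$ is $$P=\sum_{p\ge 0}\frac{(-1)^p}{r^{p+1}(p+1)!}\,d_{\mathrm T}^{\,p}S^{p+1},$$ a finite sum on each form (on $\Omega^r_k$ it suffices to sum to $p=rk-1$); $P$ may increase the order. For $r\ge 1$, $\Psi^r=\{\theta\in\Omega^r: S\theta=0\}$. The variational derivative is $\delta:\Omega^r\to\Omega^{r+1}$, $\delta\theta=d\theta-d_{\mathrm T}P\,d\theta$ (here $P$ acts on $(r+1)$-forms), for $r\ge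 0$; it takes values in $\Psi^{r+1}$ and for $r=0$ it is well defined on $\overline{\Omega}{}^0$. *)

(* Defs.v *)
From HB Require Import structures.
From mathcomp Require Import all_boot all_order all_algebra.
From mathcomp Require Import all_classical all_reals all_analysis.

Set Implicit Arguments.
Unset Strict Implicit.
Unset Printing Implicit Defensive.

Import Order.TTheory GRing.Theory Num.Theory.
Import numFieldNormedType.Exports.

Local Open Scope classical_set_scope.
Local Open Scope ring_scope.

(** ** Smooth maps and smooth manifolds *)

(* [f] is of class C^p on the open set [A].  In finite dimension, asking for
   continuous iterated derivatives in all fixed directions is the same as asking
   for continuous iterated partial derivatives. *)
Fixpoint class_C (R : realType) (V W : normedModType R) (p : nat)
    (A : set V) (f : V -> W) : Prop :=
  (forall x, A x -> {for x, continuous f}) /\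
  match p with
  | 0 => True
  | q.+1 => forall v : V,
      (forall x, A x -> derivable f x v) /\ class_C q A ('D_v f)
  end.

Definition smooth_on (R : realType) (V W : normedModType R)
    (A : set V) (f : V -> W) : Prop := forall p, class_C p A f.

Record manifold (R : realType) (m : nat) := Manifold {
  carrier :> topologicalType;
  manifold_hausdorff : hausdorff_space carrier;
  manifold_second_countable : @second_countable carrier;
  chart : Type;
  dom : chart -> set carrier;
  crd : chart -> carrier -> 'rV[R]_m;
  inv_crd : chart -> 'rV[R]_m -> carrier;
  dom_open : forall a, open (dom a);
  dom_cover : forall x, exists a, dom a x;
  crd_open : forall a, open (crd a @` dom a);
  crdK : forall a x, dom a x -> inv_crd a (crd a x) = x;
  crd_continuous : forall a x, dom a x -> {for x, continuous (crd a)};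
  inv_crd_continuous : forall a y, (crd a @` dom a) y ->
    {for y, continuous (inv_crd a)};
  crd_smooth : forall a b,
    smooth_on (crd a @` (dom a `&` dom b)) (crd b \o inv_crd a)
}.

(** ** The bundles of non-degenerate jets *)

(* Only the germ of a curve at 0 matters for its jets, so smoothness is required
   near 0 only and the values of the curve elsewhere are irrelevant. *)
Definition smooth_curve (R : realType) (m : nat) (E : manifold R m)
    (c : R -> E) : Prop :=
  forall a, dom a (c 0) -> exists2 e : R, 0 < e &
    ball (0 : R) e `<=` c @^-1` dom a /\ smooth_on (ball (0 : R) e) (crd a \o c).

Definition crd_der (R : realType) (m : nat) (E : manifold R m) (a : chart E)
    (c : R -> E) (p : nat) : 'rV[R]_m := derive1n p (crd a \o c) 0.

Definition nondegenerate (R : realType) (m : nat) (E : manifold R m) (k : nat)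
    (c : R -> E) : Prop :=
  (0 < k)%N -> forall a, dom a (c 0) -> crd_der a c 1 != 0.

Definition jet_curve (R : realType) (m : nat) (E : manifold R m) (k : nat)
    (c : R -> E) : Prop :=
  smooth_curve c /\ nondegenerate k c.

(* The class of all admissible curves having the same k-jet at 0 as [c]. *)
Definition jet_class (R : realType) (m : nat) (E : manifold R m) (k : nat)
    (c : R -> E) : set (R -> E) :=
  [set c' | [/\ jet_curve k c', c' 0 = c 0 &
     forall a, dom a (c 0) -> forall p, (p <= k)%N -> crd_der a c' p = crd_der a c p]].

(* Points of the bundle of order [k]: a k-jet is the class of its curves. *)
Definition jet (R : realType) (m : nat) (E : manifold R m) (k : nat) : Type :=
  {j : set (R -> E) | exists2 c, jet_curve k c & j = jet_class k c}.

Definition jet_rep (R : realType) (m : nat) (E : manifold R m) (k : nat)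
    (j : jet E k) : R -> E := s2val (cid2 (svalP j)).

Definition jet_base (R : realType) (m : nat) (E : manifold R m) (k : nat)
    (j : jet E k) : E := jet_rep j 0.

(* The natural projection sends [j] to [i] iff every curve of [j] is a curve of
   [i]; hence this is the preimage of [U] in the bundle of order [l], for
   [k <= l]. *)
Definition jet_preim (R : realType) (m : nat) (E : manifold R m) (k l : nat)
    (U : set (jet E k)) : set (jet E l) :=
  [set j | exists2 i, U i & sval j `<=` sval i].

Arguments jet_preim {R m E k} l U.

(* The induced coordinates: the entry [(p, i)] is q^i_(p). *)
Definition jet_crd (R : realType) (m : nat) (E : manifold R m) (k : nat)
    (a : chart E) (j : jet E k) : 'M[R]_(k.+1, m) :=
  \matrix_(p < k.+1, i < m) crd_der a (jet_rep j) p ord0 i.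

Definition jet_dom (R : realType) (m : nat) (E : manifold R m) (k : nat)
    (a : chart E) : set (jet E k) := [set j | dom a (jet_base j)].

Definition in_crd (R : realType) (m : nat) (E : manifold R m) (k : nat)
    (a : chart E) (U : set (jet E k)) : set 'M[R]_(k.+1, m) :=
  jet_crd a @` (U `&` jet_dom a).

Definition jet_open (R : realType) (m : nat) (E : manifold R m) (k : nat)
    (U : set (jet E k)) : Prop := forall a, open (in_crd a U).

Definition jet_transition (R : realType) (m : nat) (E : manifold R m) (k : nat)
    (a b : chart E) (x : 'M[R]_(k.+1, m)) : 'M[R]_(k.+1, m) :=
  get [set y | exists j : jet E k,
    [/\ jet_dom a j, jet_dom b j, jet_crd a j = x & jet_crd b j = y]].

(** ** Differential forms in coordinates *)

(* Value at a point and an r-tuple of tangent vectors, all given by their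
   coordinates q^i_(p), 0 <= p <= k. *)
Definition lform (R : realType) (m k r : nat) : Type :=
  'M[R]_(k.+1, m) -> ('I_r -> 'M[R]_(k.+1, m)) -> R.

Definition multilinear (R : realType) (m k r : nat)
    (w : ('I_r -> 'M[R]_(k.+1, m)) -> R) : Prop :=
  forall v i (c : R) x y,
    w [eta v with i |-> c *: x + y] =
      c * w [eta v with i |-> x] + w [eta v with i |-> y].

Definition alternating (R : realType) (m k r : nat)
    (w : ('I_r -> 'M[R]_(k.+1, m)) -> R) : Prop :=
  forall v i j, i != j -> v i = v j -> w v = 0.

(* Coordinates of the projection of order [l] to order [k], for [k <= l]. *)
Definition crd_proj (R : realType) (m l k : nat)
    (x : 'M[R]_(l.+1, m)) : 'M[R]_(k.+1, m) :=
  \matrix_(p < k.+1, i < m) x (inord p) i.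

Definition crd_shift (R : realType) (m k : nat)
    (x : 'M[R]_(k.+2, m)) : 'M[R]_(k.+1, m) :=
  \matrix_(p < k.+1, i < m) x (inord p.+1) i.

(* The vertical endomorphism on tangent vectors; row 0 vanishes because of the
   factor [p%:R]. *)
Definition vert_endo (R : realType) (m k : nat)
    (v : 'M[R]_(k.+1, m)) : 'M[R]_(k.+1, m) :=
  \matrix_(p < k.+1, i < m) (p%:R * v (inord p.-1) i).

Definition lpull (R : realType) (m k l r : nat)
    (t : lform R m k r) : lform R m l r :=
  fun x v => t (crd_proj k x) (fun i => crd_proj k (v i)).

(* For t = f dq_1 /\ ... /\ dq_r with constant f, only the terms of this
   algebraic derivation remain: the i-th one replaces dq_(p+1) by
   dq_(p+1) o vert_endo = (p+1) dq_(p) in the i-th argument. *)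
Definition lS (R : realType) (m k r : nat)
    (t : lform R m k r) : lform R m k r :=
  fun x v => \sum_(i < r) t x [eta v with i |-> vert_endo (v i)].

Definition ld (R : realType) (m k r : nat)
    (t : lform R m k r) : lform R m k r.+1 :=
  fun x v => \sum_(i < r.+1)
    (-1) ^+ i * 'D_(v i) (fun y => t y (fun j => v (lift i j))) x.

(* At the point [x] of order k+1 the total time derivative is the tangent vector
   [crd_shift x] at [crd_proj k x]: the first summand differentiates the
   coefficients of the form.  The remaining ones come from
   d_T (dq_(p)) = dq_(p+1) = dq_(p) o crd_shift. *)
Definition ldT (R : realType) (m k r : nat)
    (t : lform R m k r) : lform R m k.+1 r :=
  fun x v =>
    let y := crd_proj k x in
    let w := fun i => crd_proj k (v i) in
    'D_(crd_shift x) (t ^~ w) y +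
    \sum_(i < r) t y [eta w with i |-> crd_shift (v i)].

Fixpoint ldT_iter (R : realType) (m k r p : nat)
    (t : lform R m k r) : lform R m (p + k) r :=
  match p return lform R m (p + k) r with
  | 0 => t
  | q.+1 => ldT (@ldT_iter R m k r q t)
  end.

Arguments ldT_iter {R m k r} p t.

(* All terms of the sum are pulled back to the common order r * k + k. *)
Definition lP (R : realType) (m k r : nat)
    (t : lform R m k r) : lform R m (r * k + k) r :=
  fun x v => \sum_(p < r * k)
    (-1) ^+ p / (r%:R ^+ p.+1 * (p.+1)`!%:R) *
      lpull (ldT_iter p (iter p.+1 (@lS R m k r) t)) x v.

Definition delta_order (k r : nat) : nat := (r.+1 * k + k).+1.

Definition ldelta (R : realType) (m k r : nat)
    (t : lform R m k r) : lform R m (delta_order k r) r.+1 :=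
  fun x v => lpull (ld t) x v - ldT (lP (ld t)) x v.

(** ** Differential forms on open subsets of the jet bundles *)

(* A form on an open set of jets is a family of local representatives, one in
   each induced chart, agreeing on overlaps ([is_jet_form]).  Only the values on the
   coordinate image of that open set are meaningful. *)
Definition jet_form (R : realType) (m : nat) (E : manifold R m) (k r : nat) : Type :=
  chart E -> lform R m k r.

Definition is_jet_form (R : realType) (m : nat) (E : manifold R m) (k r : nat)
    (U : set (jet E k)) (t : jet_form E k r) : Prop :=
  [/\ forall a x, in_crd a U x -> multilinear (t a x) /\ alternating (t a x),
      forall a v, smooth_on (in_crd a U) ((t a) ^~ v)
    & forall a b j, U j -> jet_dom a j -> jet_dom b j -> forall v,
        t b (jet_crd b j)
          (fun i => 'D_(v i) (@jet_transition R m E k a b) (jet_crd a j)) =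
        t a (jet_crd a j) v].

Definition form_S (R : realType) (m : nat) (E : manifold R m) (k r : nat)
    (t : jet_form E k r) : jet_form E k r := fun a => lS (t a).

(* On functions ([r = 0]) this kills constants; an element of the space of
   functions modulo constants is given by a representative. *)
Definition form_delta (R : realType) (m : nat) (E : manifold R m) (k r : nat)
    (t : jet_form E k r) : jet_form E (delta_order k r) r.+1 := fun a => ldelta (t a).

Definition vanishes_on (R : realType) (m : nat) (E : manifold R m) (k r : nat)
    (U : set (jet E k)) (t : jet_form E k r) : Prop :=
  forall a x, in_crd a U x -> forall v, t a x v = 0.

(* Equality, modulo a pull-back, of two forms on the preimages of [U]. *)
Definition eq_pullback (R : realType) (m : nat) (E : manifold R m)
    (k k1 k2 r : nat) (U : set (jet E k)) (t1 : jet_form E k1 r) (t2 : jet_form E k2 r)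
    : Prop :=
  exists l, [/\ (k1 <= l)%N, (k2 <= l)%N &
    forall (a : chart E) (x : 'M[R]_(l.+1, m)), in_crd a (jet_preim l U) x ->
      forall v, lpull (t1 a) x v = lpull (t2 a) x v].

(* Main.v *)
Require Import Defs.
From HB Require Import structures.
From mathcomp Require Import all_boot all_order all_algebra.
From mathcomp Require Import all_classical all_reals all_analysis.
From mathcomp Require Import ring zify.

Set Implicit Arguments.
Unset Strict Implicit.
Unset Printing Implicit Defensive.

Import Order.TTheory GRing.Theory Num.Theory.
Import numFieldNormedType.Exports.

Local Open Scope classical_set_scope.
Local Open Scope ring_scope.

(** Write d_T for the total time derivative and S for the vertical endomorphism. In
    coordinates d_T is a Lie derivative along a linear vector field and S the algebraic
    derivation induced by a linear map; the commutator of the two linear maps is the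
    identity, hence [S, d_T] = r on r-forms ([crd_proj_comm], [lS_dT]). The coefficients
    of P are such that the sums telescope and give, as S is nilpotent, the two
    identities P d_T = 1 ([lP_trunc_dT_id]) and S (1 - d_T P) = 0 ([lS_dT_lP_trunc]).

    Let S theta = 0 and delta theta = 0, that is, d theta = d_T phi with phi = P d
    theta. Then d phi = P d_T d phi = P d d theta = 0, so that phi = d chi by the
    Poincare lemma; theta - d_T chi is closed, hence equals d psi0, again by the
    Poincare lemma. The form psi = psi0 - d_T P psi0 satisfies S psi = 0. From d psi =
    theta - d_T chi - d_T d P psi0 and P theta = 0 one reads off P d psi = - chi - d P
    psi0, whence delta psi = d psi - d_T P d psi = theta. This is [local_solution].

    The Poincare lemma is used on the jets over a coordinate ball, at a high order. When
    k >= 1 the ball consists of non-degenerate jets, the coordinates of order above k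
    are free, and the set is star-shaped. When k = 0 the fibres are not star-shaped,
    since the velocity has to avoid 0; but then P d theta = 0, so theta itself is closed
    on a ball in E and a primitive of it solves the equation ([local_solution_order0]).

    This produces psi in a single chart a, whereas a form on an open set of jets has a
    representative in every chart. In another chart b the representative is the
    pull-back of psi along the transition map. By the formula of Faa di Bruno the rows
    of that map are the iterated total derivatives of the change of coordinates
    ([prolong_curve]), so it is compatible with S and d_T ([prolonged_prolongation]) and
    the pull-back commutes with delta ([fpull_ldelta_trunc]).

    Each operator changes the order of a form. To compose them freely, all forms are
    pulled back to one order N; on forms of order below N, d_T is there the Lie
    derivative along the linear field [shift_field] ([lpull_dT]), and [pulled] keeps
    track of the actual order. *)

(** * Closure properties of smooth maps *)

Section ClassC.
Context {R : realType}.
Implicit Types V W : normedModType R.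

Lemma near_in V (A : set V) x : open A -> A x -> \forall y \near x, A y.
Proof. by move=> oA Ax; apply: open_nbhs_nbhs; split. Qed.

Lemma class_C_eq V W p (A : set V) (f g : V -> W) : open A ->
  (forall x, A x -> f x = g x) -> class_C p A f -> class_C p A g.
Proof.
move=> oA; elim: p f g => [|p IH] f g fg [cf Hf]; split.
- move=> x Ax; rewrite /prop_for /continuous_at -(fg x Ax).
  apply: cvg_trans (cf x Ax); apply: near_eq_cvg.
  by apply: filterS (near_in oA Ax) => y Ay; rewrite fg.
- by [].
- move=> x Ax; rewrite /prop_for /continuous_at -(fg x Ax).
  apply: cvg_trans (cf x Ax); apply: near_eq_cvg.
  by apply: filterS (near_in oA Ax) => y Ay; rewrite fg.
- move=> v; have [df Df] := Hf v; split.
    move=> x Ax; apply: near_eq_derivable (df x Ax).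
    by apply: filterS (near_in oA Ax) => y Ay; rewrite fg.
  apply: IH Df => x Ax; apply: near_eq_derive.
  by apply: filterS (near_in oA Ax) => y Ay; rewrite fg.
Qed.

Lemma class_CS V W p (A : set V) (f : V -> W) : class_C p.+1 A f -> class_C p A f.
Proof.
elim: p f => [|p IH] f [cf Hf]; split=> // v.
by have [df Df] := Hf v; split=> //; apply: IH.
Qed.

Lemma class_C_sub V W p (A B : set V) (f : V -> W) : A `<=` B ->
  class_C p B f -> class_C p A f.
Proof.
move=> AB; elim: p f => [|p IH] f [cf Hf]; split=> //.
- by move=> x /AB; apply: cf.
- by move=> x /AB; apply: cf.
- by move=> v; have [df Df] := Hf v; split; [move=> x /AB; apply: df|apply: IH].
Qed.

Lemma class_C_cst V W p (A : set V) (w : W) : class_C p A (fun _ => w).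
Proof.
elim: p w => [|p IH] w; split=> //; try by move=> x _; apply: cvg_cst.
move=> v; split; first by move=> x _; apply: derivable_cst.
have -> : 'D_v (fun _ : V => w) = fun _ => 0; last exact: IH.
by apply/funext => x; rewrite (derive_cst w).
Qed.

Lemma class_C_add V W p (A : set V) (f g : V -> W) : open A ->
  class_C p A f -> class_C p A g -> class_C p A (fun x => f x + g x).
Proof.
move=> oA; elim: p f g => [|p IH] f g [cf Hf] [cg Hg]; split=> //;
  try by move=> x Ax; apply: cvgD; [apply: cf|apply: cg].
move=> v; have [df Df] := Hf v; have [dg Dg] := Hg v; split.
  by move=> x Ax; apply: derivableD; [apply: df|apply: dg].
apply: class_C_eq (IH _ _ Df Dg) => // x Ax.
by rewrite deriveD; [|apply: df|apply: dg].
Qed.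

Lemma class_C_mul V p (A : set V) (f g : V -> R) : open A ->
  class_C p A f -> class_C p A g -> class_C p A (fun x => f x * g x).
Proof.
move=> oA; elim: p f g => [|p IH] f g fC gC; have [cf Hf] := fC; have [cg Hg] := gC; split=> //;
  try by move=> x Ax; apply: cvgM; [apply: cf|apply: cg].
move=> v; have [df Df] := Hf v; have [dg Dg] := Hg v; split.
  by move=> x Ax; apply: derivableM; [apply: df|apply: dg].
apply: (@class_C_eq _ _ _ _ (fun x => f x * 'D_v g x + g x * 'D_v f x)) => //.
  by move=> x Ax; rewrite deriveM; [|apply: df|apply: dg].
by apply: class_C_add => //; apply: IH => //; apply: class_CS.
Qed.

Lemma class_C_sum V W p (A : set V) (I : Type) (s : seq I) (P : pred I) (f : I -> V -> W) :
  open A -> (forall i, P i -> class_C p A (f i)) ->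
  class_C p A (fun x => \sum_(i <- s | P i) f i x).
Proof.
move=> oA Hf; elim: s => [|i s IH].
  by under eq_fun do rewrite big_nil; apply: class_C_cst.
under eq_fun do rewrite big_cons.
by case Pi: (P i) => //; apply: class_C_add => //; apply: Hf.
Qed.

Lemma mx_cvgP V a b (G : V -> 'M[R]_(a, b)) x :
  {for x, continuous G} <-> (forall i j, {for x, continuous (fun y => G y i j)}).
Proof.
split=> [cG i j|cG].
  by apply: (@continuous_comp _ _ _ G (fun M : 'M[R]_(a, b) => M i j)) => //; apply: coord_continuous.
apply/cvgrPdist_le => /= e e0; near=> y.
rewrite /Num.Def.normr/= mx_normrE (bigmax_le _ (ltW e0))//= => i _.
rewrite !mxE/=; move: i; near: y; apply: filter_forall => /= i.
exact: (((cvgrPdist_le _ _).1 (cG i.1 i.2)) e e0).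
Unshelve. all: by end_near. Qed.

Lemma class_C_mxP V p (A : set V) a b (G : V -> 'M[R]_(a, b)) : open A ->
  class_C p A G <-> (forall i j, class_C p A (fun y => G y i j)).
Proof.
move=> oA; elim: p G => [|p IH] G; split.
- by move=> [cG _] i j; split=> // x Ax; apply: (iffLR (mx_cvgP _ _) (cG x Ax)).
- by move=> H; split=> // x Ax; apply/mx_cvgP => i j; have [cH _] := H i j; apply: cH.
- move=> [cG HG] i j; split=> [x Ax|v]; first by apply: (iffLR (mx_cvgP _ _) (cG x Ax)).
  have [dG DG] := HG v; split=> [x Ax|]; first by apply: (iffLR (derivable_mxP _ _ _) (dG x Ax)).
  have /IH/(_ i j) := DG; apply: class_C_eq => // x Ax.
  by rewrite derive_mx ?mxE//; apply: dG.
- move=> H; split=> [x Ax|v]; first by apply/mx_cvgP => i j; have [cH _] := H i j; apply: cH.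
  have dG x : A x -> derivable G x v.
    by move=> Ax; apply/derivable_mxP => i j; have [_ /(_ v)[+ _]] := H i j; apply.
  split=> //; apply/IH => i j; have [_ /(_ v)[_]] := H i j.
  by apply: class_C_eq => // x Ax; rewrite derive_mx ?mxE//; apply: dG.
Qed.

Lemma is_derive_line V (f : V -> R) (x v : V) (t : R) :
  derivable f (t *: v + x) v ->
  is_derive t (1:R) (fun h : R => f (h *: v + x)) ('D_v f (t *: v + x)).
Proof.
move=> df.
have E : (fun h : R => h^-1 *: (((fun h0 : R => f (h0 *: v + x)) \o shift t) (h *: 1) - f (t *: v + x)))
  = (fun h => h^-1 *: ((f \o shift (t *: v + x)) (h *: v) - f (t *: v + x))).
  by apply/funext => h /=; rewrite scalerDl addrA [h *: (1:R)]mulr1.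
by apply: DeriveDef; rewrite /derivable /derive E.
Qed.

Lemma mvt_line V (f : V -> R) (x v : V) :
  (forall t : R, 0 <= t <= 1 -> derivable f (t *: v + x) v) ->
  exists2 t : R, 0 <= t <= 1 & f (v + x) - f x = 'D_v f (t *: v + x).
Proof.
move=> df; have := @MVT_segment R (fun t => f (t *: v + x)) (fun t => 'D_v f (t *: v + x)) 0 1 ler01.
case.
- by move=> t; rewrite in_itv/= => /andP[t0 t1]; apply: is_derive_line; apply: df; rewrite !ltW.
- apply/derivable_within_continuous => t; rewrite in_itv/= => tI.
  by have [] := @is_derive_line _ f x v t (df t tI).
- by move=> t; rewrite in_itv/= => tI /=; rewrite scale1r scale0r add0r subr0 mulr1; exists t.
Qed.

Lemma derivable_scale V W (f : V -> W) x v (c : R) : derivable f x v ->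
  is_derive x (c *: v) f (c *: 'D_v f x).
Proof.
have [->|c0] := eqVneq c 0.
  by move=> _; rewrite !scale0r; apply: is_derive0.
move=> df; have cvg : (fun h : R => h^-1 *: ((f \o shift x) (h *: (c *: v)) - f x)) @ 0^' --> c *: 'D_v f x.
  have -> : (fun h : R => h^-1 *: ((f \o shift x) (h *: (c *: v)) - f x)) =
     (fun h : R => c *: ((c * h)^-1 *: ((f \o shift x) ((c * h) *: v) - f x))).
    apply/funext => h /=; rewrite !scalerA (mulrC h c); congr (_ *: _).
    by rewrite invfM mulrA mulfV// mul1r.
  apply: cvgZ; first exact: cvg_cst.
  apply: (@cvg_comp _ _ _ ( *%R c) (fun h : R => h^-1 *: ((f \o shift x) (h *: v) - f x)) _ (0^')); last exact: df.
  move=> B [e /= e0 eB]; exists (e / `|c|); first by rewrite /= divr_gt0 // normr_gt0.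
  move=> h /=; rewrite sub0r normrN => hl hn0; apply: eB => /=.
    by rewrite sub0r normrN normrM mulrC -ltr_pdivlMr// normr_gt0.
  by rewrite mulf_neq0.
by apply: DeriveDef; [apply/cvg_ex; eexists; exact: cvg|apply: cvg_lim cvg].
Qed.

Lemma is_derive_affine V W (f : V -> W) x v w :
  (forall h : R, f (h *: v + x) - f x = h *: w) -> is_derive x v f w.
Proof.
move=> fE.
have H : (fun h : R => h^-1 *: ((f \o shift x) (h *: v) - f x)) @ 0^' --> w.
  apply: (@cvg_trans _ (cst w h @[h --> 0^'])); last exact: cvg_cst.
  apply: near_eq_cvg; near=> h.
  have hn0 : h != 0 by near: h; exact: nbhs_dnbhs_neq.
  by rewrite /= fE scalerA mulVf // scale1r.
by apply: DeriveDef; [apply/cvg_ex; eexists; exact: H|exact: cvg_lim H].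
Unshelve. all: by end_near. Qed.

Lemma smooth_continuous_linear V W (A : set V) (f : V -> W) : linear f -> continuous f -> smooth_on A f.
Proof.
move=> lf cf [|p]; first by split=> // x _; apply: cf.
split=> [x _|v]; first exact: cf.
have D x : is_derive x v f (f v).
  by apply: is_derive_affine => h; rewrite lf addrK.
split=> [x _|]; first by have [] := D x.
have -> : 'D_v f = fun _ => f v by apply/funext => x; have [] := D x.
exact: class_C_cst.
Qed.

Lemma derive_linear V W (f : V -> W) x v : linear f -> 'D_v f x = f v.
Proof.
move=> lf; have [_ ->] // : is_derive x v f (f v).
by apply: is_derive_affine => h; rewrite lf addrK.
Qed.

End ClassC.

(** * Directional derivatives: additivity in the direction and symmetry *)

Section Directions.
Context {R : realType}.
Implicit Types V W : normedModType R.

(** The mean value theorem below is applied to increments in two directions, of possibly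
    different sizes. *)
Lemma near_two_scales V (P : V -> Prop) (x u v : V) : (\forall y \near x, P y) ->
  exists2 e : R, 0 < e & forall a b : R, `|a| < e -> `|b| < e -> P (a *: u + (b *: v + x)).
Proof.
move=> /nbhs_ballP[e /= e0 eP].
have c0 : 0 < `|u| + `|v| + 1 by rewrite ltr_wpDl // addr_ge0.
exists (e / (`|u| + `|v| + 1)); first by rewrite divr_gt0.
move=> a b ha hb; apply: eP; rewrite -ball_normE /ball_ /= addrA opprD addrCA subrr addr0 normrN.
apply: (le_lt_trans (ler_normD _ _)); rewrite !normrZ.
have le1 : `|a| * `|u| <= e / (`|u| + `|v| + 1) * `|u| by rewrite ler_wpM2r // ltW.
have le2 : `|b| * `|v| <= e / (`|u| + `|v| + 1) * `|v| by rewrite ler_wpM2r // ltW.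
apply: (le_lt_trans (lerD le1 le2)).
rewrite -mulrDr -mulrA gtr_pMr // mulrC ltr_pdivrMr // mul1r.
by rewrite ltrDl.
Qed.

Lemma deriveZ_dir V W (f : V -> W) x (v : V) (c : R) : derivable f x v ->
  'D_(c *: v) f x = c *: 'D_v f x.
Proof. by move=> df; have [_ ->] := derivable_scale c df. Qed.

Lemma derivableZ_dir V W (f : V -> W) x (v : V) (c : R) : derivable f x v ->
  derivable f x (c *: v).
Proof. by move=> df; have [] := derivable_scale c df. Qed.

(** Differentiability is not known at this stage. The increment along u + v is the sum
    of one along v and one along u that starts from the displaced point; the mean value
    theorem and the continuity of 'D_u f bring the latter back to x. *)
Lemma deriveD_dir V (f : V -> R) (A : set V) x (u v : V) : open A -> A x ->
  class_C 1 A f -> 'D_(u + v) f x = 'D_u f x + 'D_v f x.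
Proof.
move=> oA Ax [cf Hf]; have [du Du] := Hf u; have [dv Dv] := Hf v.
have [cDu _] := Du.
apply: cvg_lim => //.
have E : (fun h : R => h^-1 *: ((f \o shift x) (h *: (u + v)) - f x)) =
  (fun h : R => h^-1 *: (f (h *: u + (h *: v + x)) - f (h *: v + x)) + h^-1 *: ((f \o shift x) (h *: v) - f x)).
  by apply/funext => h /=; rewrite -[RHS]scalerDr [X in _ = _ *: X]addrA subrK (scalerDr h) -addrA.
rewrite E; apply: cvgD; last exact: dv.
apply/cvgrPdist_le => e e0.
have cU : \forall y \near x, `|'D_u f x - 'D_u f y| <= e.
  by have /cvgrPdist_le/(_ e e0) := cDu x Ax.
have [d d0 dP] := near_two_scales u v (filterI (near_in oA Ax) cU).
near=> h.
have hn0 : h != 0 by near: h; exact: nbhs_dnbhs_neq.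
have hd : `|h| < d by near: h; exact: dnbhs0_lt.
have dU (t : R) : 0 <= t -> t <= 1 -> derivable f ((t * h) *: u + (h *: v + x)) u.
  by move=> t0 t1; apply: du; apply: (dP (t * h) h _ hd).1; rewrite normrM (le_lt_trans _ hd) // ler_piMl // ger0_norm //.
have [t|t /andP[t0 t1] ->] := @mvt_line _ _ f (h *: v + x) (h *: u).
  by move=> /andP[t0 t1]; rewrite scalerA; apply/derivableZ_dir/dU.
rewrite scalerA deriveZ_dir; last exact: dU.
rewrite scalerA mulVf // scale1r.
by apply: (dP (t * h) h _ hd).2; rewrite normrM (le_lt_trans _ hd) // ler_piMl // ger0_norm //.
Unshelve. all: by end_near. Qed.

Lemma derive_dir_linear V (f : V -> R) (A : set V) x (c : R) (u v : V) : open A -> A x ->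
  class_C 1 A f -> 'D_(c *: u + v) f x = c * 'D_u f x + 'D_v f x.
Proof.
move=> oA Ax fC; rewrite (deriveD_dir _ _ oA Ax fC) deriveZ_dir //.
by have [_ /(_ u)[du _]] := fC; apply: du.
Qed.

Lemma derive_dir_sum V (f : V -> R) (A : set V) x (I : Type) (s : seq I) (P : pred I) (c : I -> R) (u : I -> V) : open A -> A x ->
  class_C 1 A f -> 'D_(\sum_(i <- s | P i) c i *: u i) f x = \sum_(i <- s | P i) c i * 'D_(u i) f x.
Proof.
move=> oA Ax fC; elim/big_rec2: _ => [|i a b Pi IH]; first exact: derive0.
by rewrite (derive_dir_linear _ _ _ oA Ax fC) IH.
Qed.

(** Up to the factor h^2, the second difference of f along h u and h v is close to both
    mixed derivatives at x. *)
Lemma schwarz V (f : V -> R) (A : set V) x (u v : V) : open A -> A x ->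
  class_C 2 A f -> 'D_u ('D_v f) x = 'D_v ('D_u f) x.
Proof.
(* The mean value theorem, first along h a for the difference of f over h b, then along
   h b. *)
have key (a b : V) (e : R) : open A -> A x -> class_C 2 A f -> 0 < e ->
  exists2 d : R, 0 < d & forall h : R, 0 < h -> h < d ->
   exists2 z : R, `|z - 'D_b ('D_a f) x| <= e &
    f (h *: a + (h *: b + x)) - f (h *: a + x) - f (h *: b + x) + f x = h * h * z.
  move=> oA Ax fC e0; have [cf Hf] := fC; have [da Da] := Hf a.
  have [_ /(_ b)[dba Dba]] := Da; have [cDba _] := Dba.
  have cU : \forall y \near x, `|'D_b ('D_a f) x - 'D_b ('D_a f) y| <= e.
    by have /cvgrPdist_le/(_ e e0) := cDba x Ax.
  have [d d0 dP] := near_two_scales a b (filterI (near_in oA Ax) cU).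
  exists d => // h h0 hd.
  have hb (t : R) : 0 <= t <= 1 -> `|t * h| < d.
    by move=> /andP[t0 t1]; rewrite normrM (gtr0_norm h0) (le_lt_trans _ hd) // ler_piMl ?(ltW h0) // ger0_norm //.
  have hd' : `|h| < d by rewrite gtr0_norm.
  have z0 : `|0 : R| < d by rewrite normr0.
  pose g y := f (h *: b + y) - f y.
  have shiftD (y : V) : A (h *: b + y) -> is_derive y a (fun y => f (h *: b + y)) ('D_a f (h *: b + y)).
    move=> Ay; have E : (fun k : R => k^-1 *: (((fun y => f (h *: b + y)) \o shift y) (k *: a) - f (h *: b + y))) =
      (fun k : R => k^-1 *: ((f \o shift (h *: b + y)) (k *: a) - f (h *: b + y))).
      by apply/funext => k /=; rewrite addrCA.
    by apply: DeriveDef; rewrite /derivable /derive E //; exact: da.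
  have dg (t : R) : 0 <= t <= 1 -> is_derive ((t * h) *: a + x) a g
     ('D_a f (h *: b + ((t * h) *: a + x)) - 'D_a f ((t * h) *: a + x)).
    move=> tI; apply: is_deriveB.
      by apply: shiftD; rewrite addrCA; apply: (dP _ _ (hb t tI) hd').1.
    apply: derivableP; apply: da.
    by have := (dP _ _ (hb t tI) z0).1; rewrite scale0r add0r.
  have [t tI|t tI E1] := @mvt_line _ _ g x (h *: a).
    by rewrite scalerA; have [dd _] := dg t tI; apply: derivableZ_dir.
  have [s sI|s sI E2] := @mvt_line _ _ ('D_a f) ((t * h) *: a + x) (h *: b).
    rewrite scalerA; apply: derivableZ_dir.
    by apply: dba; rewrite addrCA; apply: (dP _ _ (hb t tI) (hb s sI)).1.
  exists ('D_b ('D_a f) ((t * h) *: a + ((s * h) *: b + x))).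
    by rewrite distrC; apply: (dP _ _ (hb t tI) (hb s sI)).2.
  have -> : f (h *: a + (h *: b + x)) - f (h *: a + x) - f (h *: b + x) + f x = g (h *: a + x) - g x.
    by rewrite /g (addrCA (h *: b)); ring.
  rewrite E1 !scalerA; have [dd Ed] := dg t tI; rewrite deriveZ_dir // Ed E2.
  rewrite scalerA deriveZ_dir; last first.
    by apply: dba; rewrite addrCA; apply: (dP _ _ (hb t tI) (hb s sI)).1.
  by rewrite addrCA /GRing.scale /= mulrA.
move=> oA Ax fC; apply/eqP; rewrite -subr_eq0 -normr_le0; apply/ler_addgt0Pr => e e0; rewrite add0r.
have e2 : 0 < e / 2 by rewrite divr_gt0.
have [d1 d10 H1] := key u v _ oA Ax fC e2.
have [d2 d20 H2] := key v u _ oA Ax fC e2.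
pose h := Num.min d1 d2 / 2.
have m0 : 0 < Num.min d1 d2 by rewrite lt_min d10.
have h0 : 0 < h by rewrite divr_gt0.
have hm : h < Num.min d1 d2 by rewrite ltr_pdivrMr // ltr_pMr // ltr1n.
move: (hm); rewrite lt_min => /andP[hd1 hd2].
have [z1 z1P E1] := H1 h h0 hd1.
have [z2 z2P E2] := H2 h h0 hd2.
have zz : z1 = z2.
  apply: (@mulfI _ (h * h)); first by rewrite mulf_neq0 // gt_eqF.
  by rewrite -E1 -E2 addrCA; congr (_ + _); rewrite addrAC.
have := ler_distD z1 ('D_u ('D_v f) x) ('D_v ('D_u f) x).
move=> /le_trans; apply; rewrite (splitr e); apply: lerD.
  by rewrite distrC zz.
exact: z1P.
Qed.

End Directions.

(** * The chain rule *)

Section ChainRule.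
Context {R : realType}.
Implicit Types V W : normedModType R.

Lemma mx_sum_delta a b (v : 'M[R]_(a, b)) : v = \sum_(i : 'I_a * 'I_b) v i.1 i.2 *: delta_mx i.1 i.2.
Proof. by rewrite [LHS]matrix_sum_delta pair_bigA. Qed.

Lemma derive_basis a b (f : 'M[R]_(a, b) -> R) (A : set 'M[R]_(a, b)) x v :
  open A -> A x -> class_C 1 A f ->
  'D_v f x = \sum_(i : 'I_a * 'I_b) v i.1 i.2 * 'D_(delta_mx i.1 i.2) f x.
Proof.
move=> oA Ax fC; rewrite {1}(mx_sum_delta v).
exact: (derive_dir_sum _ _ _ _ oA Ax fC).
Qed.

Lemma mx_entry_le a b (v : 'M[R]_(a, b)) i j : `|v i j| <= `|v|.
Proof.
rewrite {2}/Num.Def.normr/= mx_normrE.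
exact: (@le_bigmax _ _ _ 0 (fun i : 'I_a * 'I_b => `|v i.1 i.2|) (i, j)).
Qed.

(** The candidate differential is the directional derivative, which is linear by
    [derive_dir_linear]. Along the segment from x to x + h the mean value theorem bounds
    the remainder by the oscillation of the partial derivatives near x. *)
Lemma class_C1_differentiable a b (f : 'M[R]_(a, b) -> R) (A : set 'M[R]_(a, b)) x :
  open A -> A x -> class_C 1 A f -> differentiable f x.
Proof.
move=> oA Ax fC.
pose L v := 'D_v f x.
have linL : linear L by move=> c u v; rewrite /L (derive_dir_linear _ _ _ oA Ax fC).
pose LM := GRing.isLinear.Build _ _ _ _ _ linL.
pose LL : {linear 'M[R]_(a, b) -> R} := HB.pack L LM.
have cL : continuous LL.
  have -> : (LL : _ -> R) = fun v => \sum_(i : 'I_a * 'I_b) v i.1 i.2 * 'D_(delta_mx i.1 i.2) f x.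
    by apply/funext => v; rewrite /= /L (derive_basis _ oA Ax fC).
  suff [cS _] : class_C 0 setT (fun v : 'M[R]_(a, b) => \sum_(i : 'I_a * 'I_b) v i.1 i.2 * 'D_(delta_mx i.1 i.2) f x).
    by move=> v; exact: cS.
  apply: class_C_sum => [|i _]; first exact: openT.
  apply: class_C_mul; [exact: openT| |exact: class_C_cst].
  by split=> // v _; apply: coord_continuous.
have key : f \o shift x = cst (f x) + LL +o_ (0 : 'M[R]_(a, b)) id.
  apply/eqaddoP => e e0.
  (* An equal share for each entry of h. *)
  pose e' := e / (#|{: 'I_a * 'I_b}|%:R + 1).
  have c0 : 0 < #|{: 'I_a * 'I_b}|%:R + 1 :> R by rewrite ltr_wpDl.
  have e'0 : 0 < e' by rewrite divr_gt0.
  have cU : \forall y \near x, A y /\ forall i : 'I_a * 'I_b, `|'D_(delta_mx i.1 i.2) f x - 'D_(delta_mx i.1 i.2) f y| <= e'.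
    apply: (filterI (near_in oA Ax)).
    have H (i : 'I_a * 'I_b) : \forall y \near x, `|'D_(delta_mx i.1 i.2) f x - 'D_(delta_mx i.1 i.2) f y| <= e'.
      have [_ /(_ (delta_mx i.1 i.2))[_ [cD _]]] := fC.
      by have /cvgrPdist_le/(_ e' e'0) := cD x Ax.
    exact: filter_forall H.
  have [d /= d0 dP] := (iffLR (nbhs_ballP _ _) cU).
  apply/nbhs_ballP; exists d => //= h hd.
  have hb (t : R) : 0 <= t <= 1 -> ball x d (t *: h + x).
    move=> /andP[t0 t1]; move: hd; rewrite -!ball_normE /ball_ /= sub0r normrN => hd.
    by rewrite opprD addrCA subrr addr0 normrN normrZ (le_lt_trans _ hd) // ler_piMl // ger0_norm.
  have [t tI|t tI] := @mvt_line _ _ f x h.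
    by have [_ /(_ h)[dh _]] := fC; apply: dh; apply: (dP _ (hb t tI)).1.
  have At := (dP _ (hb t tI)).1; have Dt := (dP _ (hb t tI)).2.
  move=> E; rewrite -[X in `|X|]/(f (h + x) - (f x + 'D_h f x)) opprD addrA E.
  rewrite (derive_basis _ oA At fC) (derive_basis _ oA Ax fC) -sumrB.
  apply: (le_trans (ler_norm_sum _ _ _)).
  apply: (@le_trans _ _ (\sum_(i : 'I_a * 'I_b) (e' * `|h|))).
    apply: ler_sum => i _; rewrite -mulrBr normrM mulrC ler_pM //.
      by rewrite distrC.
    exact: mx_entry_le.
  rewrite sumr_const -mulr_natl mulrA ler_wpM2r //.
  by rewrite /e' mulrCA ger_pMr // ler_pdivrMr // mul1r lerDl.
apply/diff_locallyP; rewrite (diff_unique cL key); split => //.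
Qed.

Lemma is_derive_comp V a b (F : 'M[R]_(a, b) -> R) (G : V -> 'M[R]_(a, b)) x v :
  differentiable F (G x) -> derivable G x v ->
  is_derive x v (fun y => F (G y)) ('D_('D_v G x) F (G x)).
Proof.
move=> dF dG.
have dg := (iffLR (derivable1P _ _ _) dG); have {}dg := (iffLR (derivable1_diffP _ _) dg).
set g := (fun h : R => _) in dg.
have g0 : g 0 = G x by rewrite /g scale0r add0r.
have dFg : differentiable (F \o g) 0 by apply: differentiable_comp => //; rewrite g0.
apply: DeriveDef; first by apply/derivable1P/derivable1_diffP.
have E1 : 'D_v (fun y => F (G y)) x = 'D_1 (F \o g) 0.
  rewrite /derive; set u := (X in X @ _); set w := (X in _ = lim (X @ _)).
  suff -> : u = w by [].
  by apply/funext => h; rewrite /u /w /= /g addr0 scale0r add0r [h *: (1 : R)]mulr1.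
have E2 : 'D_v G x = 'D_1 g 0.
  rewrite /derive; set u := (X in X @ _); set w := (X in _ = lim (X @ _)).
  suff -> : u = w by [].
  by apply/funext => h; rewrite /u /w /= /g addr0 scale0r add0r [h *: (1 : R)]mulr1.
have dF' : differentiable F (g 0) by rewrite g0.
have E3 := congr1 (fun k => k 1) (diff_comp dg dF').
rewrite E1 E2 (deriveE _ dFg) (deriveE _ dg) (deriveE _ dF) -g0.
exact: E3.
Qed.

Lemma smooth_derivable V W (A : set V) (f : V -> W) x v :
  smooth_on A f -> A x -> derivable f x v.
Proof. by move=> sf Ax; have [_ /(_ v)[df _]] := sf 1%N; apply: df. Qed.

Lemma smooth_D V W (A : set V) (f : V -> W) v : smooth_on A f -> smooth_on A ('D_v f).
Proof. by move=> sf p; have [_ /(_ v)[]] := sf p.+1. Qed.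

(** Induction on the order: by the chain rule the derivative of the composite is a sum
    of products of derivatives of [G] with composites of the same kind, in which a
    partial derivative replaces [F]. *)
Lemma class_C_comp V p a b (F : 'M[R]_(a, b) -> R) (G : V -> 'M[R]_(a, b))
   (A : set V) (B : set 'M[R]_(a, b)) : open A -> open B ->
  (forall x, A x -> B (G x)) -> smooth_on B F -> smooth_on A G ->
  class_C p A (fun x => F (G x)).
Proof.
move=> oA oB AB + sG; elim: p F => [|p IH] F sF.
  split=> // x Ax; apply: (@continuous_comp _ _ _ G F).
    by have [cG _] := sG 0%N; exact: cG.
  by have [cF _] := sF 0%N; apply: cF; apply: AB.
split=> [x Ax|v].
  apply: (@continuous_comp _ _ _ G F).
    by have [cG _] := sG 0%N; exact: cG.
  by have [cF _] := sF 0%N; apply: cF; apply: AB.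
have D x : A x -> is_derive x v (fun y => F (G y)) ('D_('D_v G x) F (G x)).
  move=> Ax; apply: is_derive_comp.
    by apply: (class_C1_differentiable oB (AB _ Ax) (sF 1%N)).
  by have [_ /(_ v)[dG _]] := sG 1%N; apply: dG.
split=> [x Ax|]; first by have [] := D x Ax.
apply: (@class_C_eq _ _ _ _ _ (fun x => \sum_(i : 'I_a * 'I_b) 'D_v G x i.1 i.2 * 'D_(delta_mx i.1 i.2) F (G x))) => //.
  by move=> x Ax; have [_ ->] := D x Ax; rewrite (derive_basis _ oB (AB _ Ax) (sF 1%N)).
apply: class_C_sum => // i _; apply: class_C_mul => //.
  have [_ /(_ v)[_ DG]] := sG p.+1.
  by move: i => [i j] /=; apply: (iffLR (class_C_mxP _ _ oA) DG).
by apply: (IH ('D_(delta_mx i.1 i.2) F)); apply: smooth_D.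
Qed.

Lemma smooth_comp_mx V a b c d (F : 'M[R]_(a, b) -> 'M[R]_(c, d)) (G : V -> 'M[R]_(a, b))
   (A : set V) (B : set 'M[R]_(a, b)) : open A -> open B ->
  (forall x, A x -> B (G x)) -> smooth_on B F -> smooth_on A G ->
  smooth_on A (fun x => F (G x)).
Proof.
move=> oA oB AB sF sG p; apply/class_C_mxP => // i j.
apply: (class_C_comp _ oA oB AB (F := fun y => F y i j)) => // q.
exact: (iffLR (class_C_mxP _ _ oB) (sF q)).
Qed.

Lemma is_derive_comp_mx V a b c d (F : 'M[R]_(a, b) -> 'M[R]_(c, d)) (G : V -> 'M[R]_(a, b))
  (B : set 'M[R]_(a, b)) x v : open B -> B (G x) -> smooth_on B F ->
  derivable G x v ->
  is_derive x v (fun y => F (G y)) ('D_('D_v G x) F (G x)).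
Proof.
move=> oB BG sF dG.
have D i j : is_derive x v (fun y => F (G y) i j) ('D_('D_v G x) (fun y => F y i j) (G x)).
  apply: is_derive_comp => //; apply: (class_C1_differentiable oB BG).
  exact: (iffLR (class_C_mxP _ _ oB) (sF 1%N)).
have dFG : derivable (fun y => F (G y)) x v.
  by apply/derivable_mxP => i j; have [] := D i j.
apply: DeriveDef; first exact: dFG.
rewrite (derive_mx dFG) (derive_mx (smooth_derivable (v := 'D_v G x) sF BG)).
by apply/matrixP => i j; rewrite !mxE; have [_ ->] := D i j.
Qed.

Lemma smooth_linear a b c d (f : 'M[R]_(a, b) -> 'M[R]_(c, d)) (A : set 'M[R]_(a, b)) :
  linear f -> smooth_on A f.
Proof.
move=> lf; apply: smooth_continuous_linear => // x; apply/mx_cvgP => i j.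
have f0 : f 0 = 0 by have := lf (-1) 0 0; rewrite scaler0 addr0 scaleN1r addNr.
have -> : (fun y => f y i j) =
    fun y => \sum_(q : 'I_a * 'I_b) y q.1 q.2 * f (delta_mx q.1 q.2) i j.
  apply/funext => y; rewrite {1}(mx_sum_delta y).
  by elim/big_rec2: _ => [|q u z _ IH]; [rewrite f0 mxE|rewrite lf !mxE IH].
have oT : open [set: 'M[R]_(a, b)] := openT.
have [|c0 _] := @class_C_sum _ _ _ 0 setT _ (index_enum _) xpredT
    (fun q (y : 'M[R]_(a, b)) => y q.1 q.2 * f (delta_mx q.1 q.2) i j) oT; last exact: c0.
move=> q _; apply: class_C_mul => //; last exact: class_C_cst.
by split=> // y _; apply: coord_continuous.
Qed.

Section Pointwise.
Context {V : normedModType R} (x u : V).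
Implicit Types f g : V -> R.

Lemma derive_ptM f g : derivable f x u -> derivable g x u ->
  'D_u (fun y => f y * g y) x = 'D_u f x * g x + f x * 'D_u g x.
Proof.
move=> df dg; rewrite -[LHS]/('D_u (f * g) x) (deriveM df dg).
by rewrite addrC; congr (_ + _); rewrite /GRing.scale /= mulrC.
Qed.

Lemma derive_ptD f g : derivable f x u -> derivable g x u ->
  'D_u (fun y => f y + g y) x = 'D_u f x + 'D_u g x.
Proof. by move=> df dg; rewrite -[LHS]/('D_u (f + g) x) (deriveD df dg). Qed.

Lemma derive_ptZ c f : derivable f x u ->
  'D_u (fun y => c * f y) x = c * 'D_u f x.
Proof. by move=> df; rewrite -[LHS]/('D_u (c \*: f) x) (deriveZ c df). Qed.

Lemma derive_pt_sum (I : Type) (s : seq I) (P : pred I) (f : I -> V -> R) :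
  (forall i, P i -> derivable (f i) x u) ->
  derivable (fun y => \sum_(i <- s | P i) f i y) x u /\
  'D_u (fun y => \sum_(i <- s | P i) f i y) x = \sum_(i <- s | P i) 'D_u (f i) x.
Proof.
move=> df; elim: s => [|i s [IH1 IH2]].
  rewrite big_nil; under eq_fun do rewrite big_nil.
  by split; [exact: derivable_cst|exact: (derive_cst (0 : R))].
rewrite big_cons; under eq_fun do rewrite big_cons.
case Pi: (P i); last by split.
rewrite -IH2; have di := df _ Pi; split; last exact: derive_ptD.
exact: (derivableD di IH1).
Qed.

Lemma derive_lincomb (I : finType) (c : I -> R) (f : I -> V -> R) :
  (forall i, derivable (f i) x u) ->
  'D_u (fun y => \sum_i c i * f i y) x = \sum_i c i * 'D_u (f i) x.
Proof.
move=> df.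
have H i : xpredT i -> derivable (fun y => c i * f i y) x u.
  by move=> _; exact: (derivableZ (df i)).
rewrite (derive_pt_sum (index_enum I) H).2.
by apply: eq_bigr => i _; rewrite (derive_ptZ _ (df i)).
Qed.

End Pointwise.

End ChainRule.

(** * Multilinear forms with moving arguments *)

(** The function that [eta v with i |-> y] denotes, as a constant on which lemmas can be
    keyed. *)
Definition upd (T : Type) (r : nat) (v : 'I_r -> T) (i : 'I_r) (y : T) : 'I_r -> T :=
  fun j => if j == i then y else v j.

Section Updates.
Context {T : Type} {r : nat}.
Implicit Types (v : 'I_r -> T) (i j : 'I_r).

Lemma updE v i y : [eta v with i |-> y] = upd v i y :> ('I_r -> T).
Proof. by []. Qed.

Lemma upd_same v i y : upd v i y i = y.
Proof. by rewrite /upd eqxx. Qed.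

Lemma upd_neq v i j y : j != i -> upd v i y j = v j.
Proof. by rewrite /upd => /negPf ->. Qed.

Lemma upd_id v i : upd v i (v i) = v.
Proof. by apply/funext => j; rewrite /upd; case: eqP => [->|]. Qed.

Lemma upd_upd v i y z : upd (upd v i y) i z = upd v i z.
Proof. by apply/funext => j; rewrite /upd; case: eqP. Qed.

Lemma updC v i j y z : i != j -> upd (upd v i y) j z = upd (upd v j z) i y.
Proof.
move=> ij; apply/funext => l; rewrite /upd.
by case: (l =P i) => [->|//]; rewrite (negPf ij).
Qed.

End Updates.

Lemma upd_comp (T U : Type) r (f : T -> U) (v : 'I_r -> T) i y :
  (fun j => f (upd v i y j)) = upd (fun j => f (v j)) i (f y).
Proof. by apply/funext => j; rewrite /upd; case: eqP. Qed.

Section Multilinear.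
Context {R : realType} {m k r : nat}.
Local Notation V := 'M[R]_(k.+1, m).
Implicit Types (w : ('I_r -> V) -> R) (v : 'I_r -> V).

Lemma multilinearP w : multilinear w -> forall v i (c : R) x y,
    w (upd v i (c *: x + y)) = c * w (upd v i x) + w (upd v i y).
Proof. exact. Qed.

Lemma multilinear0 w v i : multilinear w -> w (upd v i 0) = 0.
Proof.
move=> ml; have := multilinearP ml v i 1 0 0.
by rewrite scale1r addr0 mul1r => /eqP; rewrite -subr_eq0 opprD addrA subrr sub0r oppr_eq0 => /eqP.
Qed.

Lemma multilinearD w v i x y : multilinear w -> w (upd v i (x + y)) = w (upd v i x) + w (upd v i y).
Proof. by move=> ml; have := multilinearP ml v i 1 x y; rewrite scale1r mul1r. Qed.

Lemma multilinearZ w v i c x : multilinear w -> w (upd v i (c *: x)) = c * w (upd v i x).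
Proof. by move=> ml; have := multilinearP ml v i c x 0; rewrite addr0 multilinear0 // addr0. Qed.

Lemma multilinearB w v i x y : multilinear w -> w (upd v i (x - y)) = w (upd v i x) - w (upd v i y).
Proof. by move=> ml; rewrite multilinearD // -scaleN1r multilinearZ // mulN1r. Qed.

Lemma multilinear_sum w v i (I : Type) (s : seq I) (P : pred I) (c : I -> R) (u : I -> V) : multilinear w ->
  w (upd v i (\sum_(j <- s | P j) c j *: u j)) = \sum_(j <- s | P j) c j * w (upd v i (u j)).
Proof.
move=> ml; elim/big_rec2: _ => [|j a b Pj IH]; first exact: multilinear0.
by rewrite multilinearP // IH.
Qed.

Lemma multilinear_expand w v i y : multilinear w ->
  w (upd v i y) = \sum_(b : 'I_k.+1 * 'I_m) y b.1 b.2 * w (upd v i (delta_mx b.1 b.2)).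
Proof. by move=> ml; rewrite {1}(mx_sum_delta y) multilinear_sum. Qed.

Lemma multilinear_expand_id w v i : multilinear w ->
  w v = \sum_(b : 'I_k.+1 * 'I_m) v i b.1 b.2 * w (upd v i (delta_mx b.1 b.2)).
Proof. by move=> ml; rewrite -multilinear_expand // upd_id. Qed.

Lemma alt_swap w v i j x y : multilinear w -> Defs.alternating w -> i != j ->
  w (upd (upd v i x) j y) = - w (upd (upd v i y) j x).
Proof.
move=> ml al ij.
have z u : w (upd (upd v i u) j u) = 0.
  by apply: (al _ i j ij); rewrite upd_same upd_neq // upd_same.
apply/eqP; rewrite -addr_eq0; apply/eqP.
have := z (x + y); rewrite multilinearD // !(updC _ (x + y) _ ij) !multilinearD // !(updC _ _ _ (i := j) (j := i)) 1?eq_sym //.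
by rewrite !z add0r addr0 addrC.
Qed.

End Multilinear.

Section MovingArguments.
Context {R : realType} {m k : nat}.
Local Notation V := 'M[R]_(k.+1, m).

Definition mform r (B : set V) (t : lform R m k r) : Prop :=
  (forall x, B x -> multilinear (t x)) /\ forall v, smooth_on B (t ^~ v).

Lemma mform_D r (B : set V) (t : lform R m k r) z : open B -> mform B t ->
  mform B (fun x v => 'D_z (t ^~ v) x).
Proof.
move=> oB [ml sm]; split=> [x Bx v i c a b|v]; last exact: smooth_D.
rewrite !updE.
have E : \near x, t x (upd v i (c *: a + b)) = ((c *: (t ^~ (upd v i a) : V -> R)) + (t ^~ (upd v i b))) x.
  by apply: filterS (near_in oB Bx) => y By; rewrite (multilinearP (ml _ By)).
have da := smooth_derivable (v := z) (sm (upd v i a)) Bx.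
have db := smooth_derivable (v := z) (sm (upd v i b)) Bx.
by rewrite (near_eq_derive _ E) (deriveD (derivableZ da) db) (deriveZ _ da).
Qed.

(** The chain rule combined with the product rule in each argument. Freeing one moving
    argument at a time, by expanding it in the basis, reduces to products of scalar
    functions, so that [t] need not be viewed as one map of the point and of all the
    arguments. *)
Lemma form_comp (W : normedModType R) r (A : set W) (B : set V) (t : lform R m k r)
   (g : W -> V) (w : 'I_r -> W -> V) :
  open A -> open B -> mform B t -> (forall x, A x -> B (g x)) -> smooth_on A g ->
  (forall i, smooth_on A (w i)) ->
  smooth_on A (fun x => t (g x) (w ^~ x)) /\
  forall x u, A x -> 'D_u (fun x => t (g x) (w ^~ x)) x =
    'D_('D_u g x) (t ^~ (w ^~ x)) (g x) + \sum_i t (g x) (upd (w ^~ x) i ('D_u (w i) x)).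
Proof.
move=> oA oB [ml sm] AB sg sw.
pose cfrom j (w : 'I_r -> W -> V) := forall i : 'I_r, (j <= i)%N -> exists c, w i = fun _ => c.
(* The arguments from j on are constant. *)
suff key : forall j (w : 'I_r -> W -> V), (j <= r)%N -> cfrom j w -> (forall i, smooth_on A (w i)) ->
  smooth_on A (fun x => t (g x) (w ^~ x)) /\
  forall x u, A x -> 'D_u (fun x => t (g x) (w ^~ x)) x =
    'D_('D_u g x) (t ^~ (w ^~ x)) (g x) + \sum_i t (g x) (upd (w ^~ x) i ('D_u (w i) x)).
  by apply: (key r w (leqnn r)) => // i; rewrite leqNgt ltn_ord.
elim=> [|j IH] {sw}w jr cw sw.
  have [c wE] : exists c, forall i, w i = fun _ => c i.
    have [f fP] := choice (fun i => cw i (leq0n i)); by exists f.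
  have -> : (fun x => t (g x) (w^~ x)) = (fun x => (t ^~ c) (g x)).
    by apply/funext => x; congr (t _ _); apply/funext => i; rewrite wE.
  split=> [p|x u Ax]; first exact: (class_C_comp (F := t ^~ c) p oA oB AB (sm c) sg).
  rewrite big1 => [|i _]; last by rewrite wE (derive_cst (c i)) multilinear0 //; apply/ml/AB.
  have -> : w ^~ x = c by apply/funext => i; rewrite wE.
  rewrite addr0; have [|_ -> //] := @is_derive_comp _ _ _ _ (t ^~ c) g x u _ (smooth_derivable (v := u) sg Ax).
  by apply: (class_C1_differentiable oB (AB _ Ax)); apply: sm.
pose J := Ordinal jr.
pose wb (b : 'I_k.+1 * 'I_m) i : W -> V := if i == J then fun _ => delta_mx b.1 b.2 else w i.
have cwb b : cfrom j (wb b).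
  move=> i; rewrite leq_eqVlt => /orP[/eqP ij|ji]; rewrite /wb.
    have -> : i == J by apply/eqP/val_inj.
    by eexists.
  case: eqP => _; [by eexists|exact: cw].
have swb b i : smooth_on A (wb b i).
  by rewrite /wb; case: eqP => // _ p; apply: class_C_cst.
have {}IH b := IH (wb b) (ltnW jr) (cwb b) (swb b).
have wbE b x : wb b ^~ x = upd (w ^~ x) J (delta_mx b.1 b.2).
  by apply/funext => i; rewrite /wb /upd; case: eqP.
have coordS b : smooth_on A (fun x => w J x b.1 b.2).
  by move=> p; apply: (iffLR (class_C_mxP _ _ oA)); exact: sw.
have expand x : A x -> t (g x) (w ^~ x) = \sum_b w J x b.1 b.2 * t (g x) (wb b ^~ x).
  move=> Ax; rewrite (multilinear_expand_id (w ^~ x) J (ml _ (AB _ Ax))).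
  by apply: eq_bigr => b _; rewrite wbE.
have dJ x u b : A x -> 'D_u (fun x => w J x b.1 b.2) x = 'D_u (w J) x b.1 b.2.
  by move=> Ax; rewrite derive_mx ?mxE //; exact: (smooth_derivable (sw J) Ax).
split=> [p|x u Ax].
  apply: (class_C_eq oA (fun x Ax => esym (expand x Ax))).
  by apply: class_C_sum => // b _; apply: class_C_mul => //; [apply: coordS|apply: (IH b).1].
have -> : 'D_u (fun x => t (g x) (w ^~ x)) x = \sum_b ('D_u (w J) x b.1 b.2 * t (g x) (wb b ^~ x) + w J x b.1 b.2 * 'D_u (fun x => t (g x) (wb b ^~ x)) x).
  rewrite (@near_eq_derive _ _ _ _ (fun x => \sum_b w J x b.1 b.2 * t (g x) (wb b ^~ x))); last first.
    by apply: filterS (near_in oA Ax) => y Ay; exact: expand.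
  have d1 b := smooth_derivable (v := u) (coordS b) Ax.
  have d2 b := smooth_derivable (v := u) (IH b).1 Ax.
  have [b _|_ ->] := (@derive_pt_sum _ _ x u _ (index_enum _) xpredT (fun b y => w J y b.1 b.2 * t (g y) (wb b ^~ y))).
    exact: (derivableM (d1 b) (d2 b)).
  by apply: eq_bigr => b _; rewrite (derive_ptM (d1 b) (d2 b)) dJ.
rewrite big_split /=.
have -> : \sum_b 'D_u (w J) x b.1 b.2 * t (g x) (wb b ^~ x) = t (g x) (upd (w ^~ x) J ('D_u (w J) x)).
  rewrite (multilinear_expand _ _ _ (ml _ (AB _ Ax))).
  by apply: eq_bigr => b _; rewrite wbE.
have mlD' := (mform_D ('D_u g x) oB (conj ml sm)).1 _ (AB _ Ax).
have -> : \sum_b w J x b.1 b.2 * 'D_u (fun x => t (g x) (wb b ^~ x)) x =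
   'D_('D_u g x) (t ^~ (w ^~ x)) (g x) + \sum_(i | i != J) t (g x) (upd (w ^~ x) i ('D_u (w i) x)).
  rewrite (multilinear_expand_id (w ^~ x) J mlD').
  under eq_bigr do rewrite (IH _).2 // mulrDr wbE.
  rewrite big_split /=; congr (_ + _).
  under eq_bigr do rewrite mulr_sumr.
  rewrite exchange_big /= [RHS]big_mkcond; apply: eq_bigr => i _ /=.
  case: eqP => [->|/eqP iJ] /=.
    apply: big1 => b _; have -> : wb b J = fun _ => delta_mx b.1 b.2 by rewrite /wb eqxx.
    by rewrite (derive_cst (delta_mx b.1 b.2)) multilinear0 ?mulr0 //; exact/ml/AB.
  rewrite (multilinear_expand_id _ J (ml _ (AB _ Ax))) upd_neq 1?eq_sym //.
  apply: eq_bigr => b _; have -> : wb b i = w i by rewrite /wb (negPf iJ).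
  by rewrite updC // eq_sym.
by rewrite addrCA; congr (_ + _); rewrite [RHS](bigD1 J).
Qed.
End MovingArguments.

(** * Removing two indices from a list of arguments *)

Section RemovedIndices.
Context {T : Type}.

Lemma unbump_bump_swap i j : unbump (bump i j) i = unbump j i.
Proof. by rewrite /unbump /bump; case: (leqP i j) => ij /=; lia. Qed.

(** A pair (i, j) stands for the removal of the entry i followed by that of the entry j
    of what is left. The same two entries can be removed in the opposite order. *)
Definition swap_idx r (p : 'I_r.+2 * 'I_r.+1) : 'I_r.+2 * 'I_r.+1 :=
  (lift p.1 p.2, odflt ord0 (unlift (lift p.1 p.2) p.1)).

Lemma swap_idx1 r (p : 'I_r.+2 * 'I_r.+1) : lift (swap_idx p).1 (swap_idx p).2 = p.1.
Proof.
case: p => i j /=; rewrite /swap_idx /=.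
have n : lift i j != i by rewrite eq_sym neq_lift.
by have [l El ->] := unlift_some n.
Qed.

Lemma swap_idx2 r (p : 'I_r.+2 * 'I_r.+1) : (swap_idx p).2 = unbump p.2 p.1 :> nat.
Proof.
case: p => i j; rewrite /swap_idx /=.
have n : lift i j != i by rewrite eq_sym neq_lift.
have [l El ->] /= := unlift_some n.
have E : i = bump (bump i j) l :> nat by rewrite {1}El.
by rewrite -unbump_bump_swap {2}E bumpK.
Qed.

Lemma swap_idxK r : involutive (@swap_idx r).
Proof.
move=> p; apply/eqP; rewrite -pair_eqE /= swap_idx1 eqxx /=.
apply/eqP/(@lift_inj _ p.1); rewrite -{1}(swap_idx1 p).
by have := swap_idx1 (swap_idx p); rewrite /= swap_idx1.
Qed.

(** The signs of the two orders of removal are opposite: this is the source of d o d = 0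
    and of the other cancellations in alternating sums. *)
Lemma swap_sign (R : pzRingType) r (p : 'I_r.+2 * 'I_r.+1) :
  (-1) ^+ ((swap_idx p).1 + (swap_idx p).2) = - (-1) ^+ (p.1 + p.2) :> R.
Proof.
rewrite swap_idx2; case: p => i j /=; rewrite /bump /unbump; case: (leqP i j) => ij.
  by rewrite add1n subn0 addSn exprS mulN1r addnC.
case: (nat_of_ord i) ij => // i' _.
by rewrite add0n subSS subn0 addSn exprS mulN1r opprK addnC.
Qed.

Lemma lift_lift_swap r (p : 'I_r.+2 * 'I_r.+1) k :
  lift (swap_idx p).1 (lift (swap_idx p).2 k) = lift p.1 (lift p.2 k).
Proof.
by apply/val_inj; rewrite /= swap_idx2 [RHS]bumpC.
Qed.

(** The involution [swap_idx] matches each term with its opposite. *)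
Lemma double_sum0 (R : numDomainType) r (G : 'I_r.+2 -> 'I_r.+2 -> ('I_r -> T) -> R) (v : 'I_r.+2 -> T) :
  (forall a b w, G a b w = G b a w) ->
  \sum_(i < r.+2) \sum_(j < r.+1) (-1) ^+ (i + j) * G i (lift i j) (fun k => v (lift i (lift j k))) = 0.
Proof.
move=> sG; rewrite pair_bigA /=; set S := \sum_p _.
suff E : S = - S.
  by have := mulrn_eq0 S 2; rewrite mulr2n {1}E addNr eqxx => /esym/eqP.
rewrite {1}/S (reindex_inj (can_inj (@swap_idxK r))) /= -sumrN; apply: eq_bigr => p _.
rewrite swap_sign mulNr; congr (- (_ * _)); rewrite swap_idx1 sG.
by congr (G _ _ _); apply/funext => k; rewrite lift_lift_swap.
Qed.

Definition fcons r (y : T) (u : 'I_r -> T) : 'I_r.+1 -> T :=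
  fun i => if unlift ord0 i is Some j then u j else y.

Lemma fcons0 r y (u : 'I_r -> T) : fcons y u ord0 = y.
Proof. by rewrite /fcons unlift_none. Qed.

Lemma fconsS r y (u : 'I_r -> T) j : fcons y u (lift ord0 j) = u j.
Proof. by rewrite /fcons liftK. Qed.

Lemma fcons_lift0 r y (u : 'I_r -> T) : (fun j => fcons y u (lift ord0 j)) = u.
Proof. by apply/funext => j; rewrite fconsS. Qed.

Lemma fcons_eta r (v : 'I_r.+1 -> T) : fcons (v ord0) (fun j => v (lift ord0 j)) = v.
Proof. by apply/funext => i; case: (unliftP ord0 i) => [j|] ->; rewrite ?fcons0 ?fconsS. Qed.

Lemma upd_lift_same r (v : 'I_r.+1 -> T) i y : (fun j => upd v i y (lift i j)) = fun j => v (lift i j).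
Proof. by apply/funext => j; rewrite upd_neq // eq_sym neq_lift. Qed.

Lemma upd_lift r (v : 'I_r.+1 -> T) i l y :
  (fun j => upd v (lift i l) y (lift i j)) = upd (fun j => v (lift i j)) l y.
Proof. by apply/funext => j; rewrite /upd (inj_eq lift_inj). Qed.

Lemma fcons_upd0 r x y (u : 'I_r -> T) : upd (fcons x u) ord0 y = fcons y u.
Proof.
apply/funext => i; case: (unliftP ord0 i) => [j|] ->; rewrite ?fcons0 ?fconsS.
  by rewrite upd_neq ?fconsS // eq_sym neq_lift.
by rewrite upd_same.
Qed.

Lemma fcons_updS r x y (u : 'I_r -> T) l : upd (fcons x u) (lift ord0 l) y = fcons x (upd u l y).
Proof.
apply/funext => i; case: (unliftP ord0 i) => [j|] ->; rewrite ?fcons0 ?fconsS.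
  by rewrite /upd (inj_eq lift_inj) fconsS.
by rewrite upd_neq ?fcons0 // neq_lift.
Qed.

End RemovedIndices.

Section MoveFront.
Context {R : realType} {m k r : nat}.
Local Notation V := 'M[R]_(k.+1, m).

(** Each of the transpositions of neighbours that bring the argument to the front
    changes the sign. *)
Lemma move_front (w : ('I_r.+1 -> V) -> R) (v : 'I_r.+1 -> V) (i : 'I_r.+1) :
  multilinear w -> Defs.alternating w ->
  w v = (-1) ^+ i * w (fcons (v i) (fun j => v (lift i j))).
Proof.
move=> ml al; case: i => i ir /=; elim: i ir v => [|i IH] ir v.
  have -> : Ordinal ir = ord0 by apply/val_inj.
  by rewrite fcons_eta mul1r.
have ir' : (i < r.+1)%N by exact: ltnW.
pose a := Ordinal ir'; pose b := Ordinal ir.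
have ab : a != b by apply/eqP => /(congr1 val) /= /eqP; rewrite -[X in X == _]addn0 -addn1 eqn_add2l.
have -> : w v = - w (upd (upd v a (v b)) b (v a)).
  by rewrite -alt_swap // upd_id -{1}(upd_id v b) -[in LHS](upd_id (upd v b (v b)) a) upd_id.
rewrite (IH ir') -/a -/b exprS mulN1r mulNr; congr (- (_ * w _)).
rewrite upd_neq // upd_same; congr fcons; apply/funext => j.
have [ja|ja|ja] := ltngtP j i.
- have -> : lift a j = lift b j by apply/val_inj; rewrite /= /bump; lia.
  by rewrite !upd_neq // -val_eqE /= /bump; lia.
- have -> : lift a j = lift b j by apply/val_inj; rewrite /= /bump; lia.
  by rewrite !upd_neq // -val_eqE /= /bump; lia.
- have -> : lift a j = b by apply/val_inj; rewrite /= /bump; lia.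
  have -> : lift b j = a by apply/val_inj; rewrite /= /bump; lia.
  by rewrite upd_same.
Qed.

End MoveFront.

(** * Exterior derivative and Lie derivatives along linear vector fields *)

Section Forms.
(* Derivatives are handled through lemmas; unification must not unfold them into limits. *)
#[local] Opaque derive.
Context {R : realType} {m k : nat}.
Local Notation V := 'M[R]_(k.+1, m).
Local Notation form := (lform R m k).

Definition is_form r (B : set V) (t : form r) : Prop :=
  mform B t /\ forall x, B x -> Defs.alternating (t x).

(** The representative of a form carries information on the coordinate image of its
    domain only. *)
Definition eqon r (B : set V) (t u : form r) : Prop :=
  forall x, B x -> forall v, t x v = u x v.

(** The algebraic derivation induced by a tensor field of type (1,1) with constant
    coefficients; [lS] is an instance. *)
Definition lmap r (f : V -> V) (t : form r) : form r :=
  fun x v => \sum_(i < r) t x (upd v i (f (v i))).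

(** The vector field x |-> f x, being linear, acts on tangent vectors by f as well;
    hence the second summand. *)
Definition lie r (f : V -> V) (t : form r) : form r :=
  fun x v => 'D_(f x) (t ^~ v) x + lmap f t x v.

Definition fadd r (t u : form r) : form r := fun x v => t x v + u x v.
Definition fscale r c (t : form r) : form r := fun x v => c * t x v.

Section OnOpenSet.
Variables (B : set V) (oB : open B).

Lemma eqon_refl r (t : form r) : eqon B t t. Proof. by []. Qed.
Lemma eqon_sym r (t u : form r) : eqon B t u -> eqon B u t.
Proof. by move=> tu x Bx v; rewrite tu. Qed.
Lemma eqon_trans r (t u w : form r) : eqon B t u -> eqon B u w -> eqon B t w.
Proof. by move=> tu uw x Bx v; rewrite tu // uw. Qed.

Lemma eqon_derive r (t u : form r) x z v w : eqon B t u -> B x -> v = w -> 'D_z (t ^~ v) x = 'D_z (u ^~ w) x.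
Proof.
move=> tu Bx <-; apply: near_eq_derive.
by apply: filterS (near_in oB Bx) => y By; apply: tu.
Qed.

Lemma eqon_lmap r f (t u : form r) : eqon B t u -> eqon B (lmap f t) (lmap f u).
Proof. by move=> tu x Bx v; apply: eq_bigr => i _; apply: tu. Qed.

Lemma eqon_lie r f (t u : form r) : eqon B t u -> eqon B (lie f t) (lie f u).
Proof.
move=> tu x Bx v; rewrite /lie; congr (_ + _); last exact: eqon_lmap.
exact: eqon_derive tu Bx _.
Qed.

Lemma eqon_ld r (t u : form r) : eqon B t u -> eqon B (ld t) (ld u).
Proof.
move=> tu x Bx v; apply: eq_bigr => i _; congr (_ * _).
exact: (eqon_derive _ tu Bx erefl).
Qed.

Lemma eqon_add r (t u t' u' : form r) : eqon B t t' -> eqon B u u' -> eqon B (fadd t u) (fadd t' u').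
Proof. by move=> tt uu x Bx v; rewrite /fadd tt // uu. Qed.

Lemma eqon_scale r c (t u : form r) : eqon B t u -> eqon B (fscale c t) (fscale c u).
Proof. by move=> tt x Bx v; rewrite /fscale tt. Qed.

Lemma form_derivable r (t : form r) v x z : mform B t -> B x -> derivable (t ^~ v) x z.
Proof. by move=> [_ sm] Bx; apply: (smooth_derivable (sm v) Bx). Qed.

Lemma is_form_add r (t u : form r) : is_form B t -> is_form B u -> is_form B (fadd t u).
Proof.
move=> [[mt st] at_] [[mu su] au]; split; first split.
- move=> x Bx v i c a b; rewrite /fadd !updE (multilinearP (mt x Bx)) (multilinearP (mu x Bx)); ring.
- by move=> v p; apply: class_C_add => //; [apply: st|apply: su].
- by move=> x Bx v i j ij vij; rewrite /fadd (at_ x Bx v i j) // (au x Bx v i j) // addr0.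
Qed.

Lemma is_form_scale r c (t : form r) : is_form B t -> is_form B (fscale c t).
Proof.
move=> [[mt st] at_]; split; first split.
- move=> x Bx v i d a b; rewrite /fscale !updE (multilinearP (mt x Bx)); ring.
- by move=> v p; apply: class_C_mul => //; [apply: class_C_cst|apply: st].
- by move=> x Bx v i j ij vij; rewrite /fscale (at_ x Bx v i j) // mulr0.
Qed.

Lemma is_form_lmap r f (t : form r) : linear f -> is_form B t -> is_form B (lmap f t).
Proof.
move=> lf [[mt st] at_]; split; first split.
- move=> x Bx v l c a b; rewrite !updE /lmap mulr_sumr -big_split /=; apply: eq_bigr => i _.
  have [->|il] := eqVneq i l; first by rewrite !upd_same !upd_upd lf multilinearP //; apply: mt.
  by rewrite !upd_neq // ![upd (upd v l _) i _]updC 1?eq_sym // multilinearP //; apply: mt.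
- by move=> v p; apply: class_C_sum => // i _; apply: st.
- move=> x Bx v a b ab vab; rewrite /lmap (bigD1 a) //= (bigD1 b) 1?eq_sym //= big1 ?addr0.
    have -> : upd v a (f (v a)) = upd (upd v a (f (v a))) b (v b).
      by rewrite -[LHS](upd_id _ b) upd_neq // eq_sym.
    have -> : upd v b (f (v b)) = upd (upd v a (v b)) b (f (v b)) by rewrite -{2}vab upd_id.
    by rewrite (alt_swap _ _ _ (mt x Bx) (at_ x Bx) ab) vab addNr.
  move=> i /andP[ia ib]; apply: (at_ x Bx _ a b ab).
  by rewrite !upd_neq // eq_sym.
Qed.

Lemma is_form_D r (t : form r) z : is_form B t -> is_form B (fun x v => 'D_z (t ^~ v) x).
Proof.
move=> [mt at_]; split; first exact: mform_D.
move=> x Bx v i j ij vij.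
rewrite (@near_eq_derive _ _ _ _ (fun _ => 0)); first exact: (derive_cst (0 : R)).
by apply: filterS (near_in oB Bx) => y By; apply: (at_ y By v i j).
Qed.

(** The last term is the bracket of the constant field u with the linear field x |-> f
    x. *)
Lemma derive_along (f : V -> V) (g : V -> R) : linear f -> smooth_on B g ->
  smooth_on B (fun y => 'D_(f y) g y) /\
  forall x u, B x -> 'D_u (fun y => 'D_(f y) g y) x = 'D_(f x) ('D_u g) x + 'D_(f u) g x.
Proof.
move=> lf sg.
pose q : form 1 := fun y z => 'D_(z ord0) g y.
have mq : mform B q.
  split=> [x Bx v i c a b|v]; last exact: smooth_D.
  by rewrite /q !updE !ord1 !upd_same (derive_dir_linear _ _ _ oB Bx (sg 1%N)).
have sid : smooth_on B (@idfun V) by apply: smooth_linear.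
have [sq Dq] := form_comp (w := fun (_ : 'I_1) => f) oB oB mq (fun x Bx => Bx) sid (fun _ => smooth_linear B lf).
split; [exact: sq|move=> x u Bx].
have := Dq x u Bx; rewrite big_ord1 derive_id (derive_linear _ _ lf) /q upd_same => E.
move: E; rewrite (schwarz u (f x) oB Bx (sg 2%N)); exact.
Qed.

Lemma is_form_lie r f (t : form r) : linear f -> is_form B t -> is_form B (lie f t).
Proof.
move=> lf ft; have [[mt st] at_] := ft.
suff H : is_form B (fun x v => 'D_(f x) (t ^~ v) x).
  exact: is_form_add H (is_form_lmap lf ft).
split; first split.
- by move=> x Bx; apply: (is_form_D (f x) ft).1.1.
- by move=> v; apply: (derive_along lf (st v)).1.
- by move=> x Bx; apply: (is_form_D (f x) ft).2.
Qed.

(** If v a = v b, the terms that keep both arguments vanish, and the two others cancel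
    by [swap_sign]. *)
Lemma is_form_ld r (t : form r) : is_form B t -> is_form B (ld t).
Proof.
move=> ft; have [[mt st] at_] := ft.
split; first split.
- move=> x Bx v l c a b; rewrite !updE /ld mulr_sumr -big_split /=; apply: eq_bigr => i _.
  case: (unliftP i l) => [l'|] ->.
    rewrite !upd_lift !upd_neq ?neq_lift //.
    by rewrite (multilinearP ((mform_D (v i) oB (conj mt st)).1 x Bx)) mulrDr mulrCA.
  rewrite !upd_lift_same !upd_same (derive_dir_linear _ _ _ oB Bx (st _ 1%N)); ring.
- move=> v p; apply: class_C_sum => // i _; apply: class_C_mul => //; first exact: class_C_cst.
  exact: smooth_D.
move=> x Bx v a b ab vab.
case: r t ft mt st at_ v a b ab vab => [|r] t ft mt st at_ v a b ab vab.
  by move: ab; rewrite !ord1 eqxx.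
rewrite /ld (bigD1 a) //= (bigD1 b) 1?eq_sym //= big1 ?addr0 => [|i /andP[ia ib]]; last first.
  rewrite (@near_eq_derive _ _ _ _ (fun _ => 0)); first by rewrite (derive_cst (0 : R)) mulr0.
  apply: filterS (near_in oB Bx) => y By.
  have [a' Ea _] := unlift_some ia; have [b' Eb _] := unlift_some ib.
  apply: (at_ y By _ a' b'); last by rewrite -Ea -Eb.
  by apply: contra ab => /eqP E; rewrite Ea Eb E.
have [b' Eb _] := unlift_some ab.
pose p := (a, b').
have p1 : (swap_idx p).1 = b by rewrite /swap_idx /= -Eb.
have p2 : lift b (swap_idx p).2 = a by rewrite -p1 swap_idx1.
have -> : 'D_(v a) (fun y => t y (fun j => v (lift a j))) x =
  'D_(v a) (fun y => (-1) ^+ b' * t y (fcons (v a) (fun j => v (lift a (lift b' j))))) x.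
  apply: near_eq_derive; apply: filterS (near_in oB Bx) => y By.
  by rewrite (move_front _ b' (mt _ By) (at_ _ By)) -Eb vab.
have -> : 'D_(v b) (fun y => t y (fun j => v (lift b j))) x =
  'D_(v a) (fun y => (-1) ^+ (swap_idx p).2 * t y (fcons (v a) (fun j => v (lift a (lift b' j))))) x.
  rewrite -vab; apply: near_eq_derive; apply: filterS (near_in oB Bx) => y By.
  rewrite (move_front _ (swap_idx p).2 (mt _ By) (at_ _ By)) p2; congr (_ * t y (fcons _ _)).
  by apply/funext => j; rewrite -{1}p1 lift_lift_swap.
rewrite !derive_ptZ; [|exact: (smooth_derivable (st _) Bx)..].
rewrite !mulrA -!exprD -p1 swap_sign mulNr; exact: subrr.
Qed.

(** Second derivatives are symmetric in the two arguments taken out, and the signs are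
    antisymmetric. *)
Lemma ld_ld r (t : form r) : is_form B t -> eqon B (ld (ld t)) (fun _ _ => 0).
Proof.
move=> [[mt st] at_] x Bx v; rewrite /ld.
have E (i : 'I_r.+2) : 'D_(v i) (fun y => \sum_(j < r.+1) (-1) ^+ j * 'D_(v (lift i j)) (fun y => t y (fun l => v (lift i (lift j l)))) y) x
   = \sum_(j < r.+1) (-1) ^+ j * 'D_(v i) ('D_(v (lift i j)) (fun y => t y (fun l => v (lift i (lift j l))))) x.
  have d (j : 'I_r.+1) : derivable ('D_(v (lift i j)) (fun y => t y (fun l => v (lift i (lift j l))))) x (v i).
    exact: (smooth_derivable (smooth_D _ (st _)) Bx).
  exact: (derive_lincomb (fun j : 'I_r.+1 => (-1) ^+ j) d).
under eq_bigr => i _ do rewrite E mulr_sumr.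
under eq_bigr => i _ do under eq_bigr => j _ do rewrite mulrA -exprD.
apply: (double_sum0 (G := fun a b w => 'D_(v a) ('D_(v b) (t ^~ w)) x)) => a b w.
exact: (schwarz _ _ oB Bx (st _ 2%N)).
Qed.

End OnOpenSet.
End Forms.

(** * All operators at one common order *)

Section Pulling.
Context {R : realType}.

(** The difference quotients agree, so no regularity of [g] is involved. Pull-backs
    along projections therefore commute with the operators without any hypothesis on the
    form. *)
Lemma derive_comp_linear (V W U : normedModType R) (f : V -> W) (g : W -> U) x v :
  linear f -> 'D_v (fun y => g (f y)) x = 'D_(f v) g (f x).
Proof.
move=> lf; rewrite /derive; set u := (X in X @ _); set w := (X in _ = lim (X @ _)).
suff -> : u = w by [].
by apply/funext => h; rewrite /u /w /= lf.
Qed.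

Lemma crd_proj_linear m l k : linear (@crd_proj R m l k).
Proof. by move=> c x y; apply/matrixP => p i; rewrite !mxE. Qed.

Lemma vert_linear m k : linear (@vert_endo R m k).
Proof. by move=> c x y; apply/matrixP => p i; rewrite !mxE; ring. Qed.

(** The total time derivative as a linear vector field on the coordinates of one fixed
    order. The top row, for which the true value is lacking, is invisible to forms of
    lower order. *)
Definition shift_field m N (x : 'M[R]_(N.+1, m)) : 'M[R]_(N.+1, m) :=
  \matrix_(p < N.+1, i < m) (if (p < N)%N then x (inord p.+1) i else 0).

Lemma shift_field_linear m N : linear (@shift_field m N).
Proof. by move=> c x y; apply/matrixP => p i; rewrite !mxE; case: ifP => _; rewrite ?mxE ?mulr0 ?addr0. Qed.

Lemma crd_proj_proj m L N k (x : 'M[R]_(L.+1, m)) : (k <= N)%N ->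
  crd_proj k (crd_proj N x) = crd_proj k x.
Proof.
move=> kN; apply/matrixP => p i; rewrite !mxE inordK //.
by rewrite (leq_trans (ltn_ord p)).
Qed.

Lemma crd_proj_id m k (x : 'M[R]_(k.+1, m)) : crd_proj k x = x.
Proof. by apply/matrixP => p i; rewrite !mxE inord_val. Qed.

Lemma crd_proj_vert m N k (x : 'M[R]_(N.+1, m)) : (k <= N)%N ->
  crd_proj k (vert_endo x) = vert_endo (crd_proj k x).
Proof.
move=> kN; apply/matrixP => p i; rewrite !mxE.
have pk := ltn_ord p.
by rewrite !inordK //; lia.
Qed.

Lemma crd_proj_shift_field m N k (x : 'M[R]_(N.+1, m)) : (k < N)%N ->
  crd_proj k (shift_field x) = crd_shift (crd_proj k.+1 x).
Proof.
move=> kN; apply/matrixP => p i; rewrite !mxE.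
have pk := ltn_ord p.
have pN : (p < N)%N by lia.
by rewrite !inordK ?pN //; lia.
Qed.

(** Below the top row the bracket of the two linear fields is the identity; on forms
    this becomes [S, d_T] = r. *)
Lemma crd_proj_comm m N k (x : 'M[R]_(N.+1, m)) : (k < N)%N ->
  crd_proj k (shift_field (vert_endo x) - vert_endo (shift_field x)) = crd_proj k x.
Proof.
move=> kN; apply/matrixP => p i; rewrite !mxE.
have pk := ltn_ord p.
have pN : (p < N)%N by rewrite (leq_ltn_trans _ kN).
have e1 : (inord p : 'I_N.+1) = p :> nat by rewrite inordK //; lia.
have e2 : (inord p.+1 : 'I_N.+1) = p.+1 :> nat by rewrite inordK //; lia.
have e3 : (inord p.-1 : 'I_N.+1) = p.-1 :> nat by rewrite inordK //; lia.
have pN' : (p.-1 < N)%N by lia.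
rewrite e1 pN e2 /= e3 pN'.
case E : (nat_of_ord p) => [|q] /=; first by rewrite mul0r subr0 mul1r.
by rewrite -mulrBl -natrB // subSnn mul1r.
Qed.

Lemma lpull_lpull m k N L r (t : lform R m k r) : (k <= N)%N ->
  lpull (l := L) (lpull (l := N) t) = lpull t.
Proof.
move=> kN; apply/funext => x; apply/funext => v; rewrite /lpull crd_proj_proj //.
by congr (t _ _); apply/funext => i; rewrite crd_proj_proj.
Qed.

Lemma lpull_id m k r (t : lform R m k r) : lpull (l := k) t = t.
Proof.
apply/funext => x; apply/funext => v; rewrite /lpull crd_proj_id.
by congr (t _ _); apply/funext => i; rewrite crd_proj_id.
Qed.

Lemma lpull_ld m k N r (t : lform R m k r) : lpull (l := N) (ld t) = ld (lpull (l := N) t).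
Proof.
apply/funext => x; apply/funext => v; rewrite /lpull /ld; apply: eq_bigr => i _; congr (_ * _).
exact/esym/(derive_comp_linear (fun y => t y (fun j => crd_proj k (v (lift i j)))) _ _ (@crd_proj_linear m N k)).
Qed.

Lemma lpull_lS m k N r (t : lform R m k r) : (k <= N)%N ->
  lpull (l := N) (lS t) = lS (lpull (l := N) t).
Proof.
move=> kN; apply/funext => x; apply/funext => v; rewrite /lpull /lS; apply: eq_bigr => i _.
by rewrite !updE (upd_comp (@crd_proj R m N k)) crd_proj_vert.
Qed.

Lemma lpull_dT m k N r (t : lform R m k r) : (k < N)%N ->
  lpull (l := N) (ldT t) = lie (@shift_field m N) (lpull (l := N) t).
Proof.
move=> kN; apply/funext => x; apply/funext => v; rewrite /lpull /ldT /lie /lmap.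
have E (u : 'M[R]_(N.+1, m)) : crd_proj k (crd_proj k.+1 u) = crd_proj k u by apply: crd_proj_proj.
have Ev : (fun i => crd_proj k (crd_proj k.+1 (v i))) = fun i => crd_proj k (v i) by apply/funext => i.
rewrite Ev E; congr (_ + _).
  by rewrite (derive_comp_linear (fun y => t y (fun j => crd_proj k (v j))) x (shift_field x) (@crd_proj_linear m N k)) crd_proj_shift_field.
by apply: eq_bigr => i _; rewrite !updE (upd_comp (@crd_proj R m N k)) crd_proj_shift_field.
Qed.

Lemma lpull_ldT_iter m k N r p (t : lform R m k r) : (p + k <= N)%N ->
  lpull (l := N) (ldT_iter p t) = iter p (lie (@shift_field m N)) (lpull (l := N) t).
Proof.
elim: p => [|p IH] // pN.
by rewrite iterS -IH ?(ltnW pN) // -lpull_dT.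
Qed.

Lemma lpull_lS_iter m k N r p (t : lform R m k r) : (k <= N)%N ->
  lpull (l := N) (iter p (@lS R m k r) t) = iter p (@lS R m N r) (lpull (l := N) t).
Proof. by move=> kN; elim: p => // p IH; rewrite !iterS -IH lpull_lS. Qed.

Definition pcoef (r p : nat) : R := (-1) ^+ p / (r%:R ^+ p.+1 * (p.+1)`!%:R).

(** The operator P with [M] terms; raising [M] beyond the bound of nilpotency of S has
    no effect. *)
Definition lP_trunc m N r M (t : lform R m N r) : lform R m N r :=
  fun x v => \sum_(p < M) pcoef r p * iter p (lie (@shift_field m N)) (iter p.+1 (@lS R m N r) t) x v.

Lemma lpull_lP m k N r (t : lform R m k r) : (r * k + k <= N)%N ->
  lpull (l := N) (lP t) = lP_trunc (r * k) (lpull (l := N) t).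
Proof.
move=> kN; have kN' : (k <= N)%N by apply: leq_trans kN; apply: leq_addl.
apply/funext => x; apply/funext => v; rewrite {1}/lpull /lP; apply: eq_bigr => p _; congr (_ * _).
have pk : (p + k <= r * k + k)%N by rewrite leq_add2r ltnW.
rewrite -[LHS]/(lpull (l := N) (lpull (ldT_iter p (iter p.+1 (@lS R m k r) t))) x v) lpull_lpull //.
by rewrite lpull_ldT_iter ?lpull_lS_iter // (leq_trans pk).
Qed.

Lemma lpull_ldelta m k N r (t : lform R m k r) : (delta_order k r <= N)%N ->
  lpull (l := N) (ldelta t) = fun x v => ld (lpull (l := N) t) x v - lie (@shift_field m N) (lP_trunc (r.+1 * k) (ld (lpull (l := N) t))) x v.
Proof.
move=> kN; have kN1 : (k <= delta_order k r)%N by rewrite /delta_order ltnW // ltnS leq_addl.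
apply/funext => x; apply/funext => v; rewrite {1}/lpull /ldelta; congr (_ - _).
  by rewrite -lpull_ld -[LHS]/(lpull (l := N) (lpull (l := delta_order k r) (ld t)) x v) lpull_lpull.
rewrite -[LHS]/(lpull (l := N) (ldT (lP (ld t))) x v) lpull_dT // lpull_lP ?lpull_ld //.
exact: ltnW.
Qed.

End Pulling.


Section Algebra.
#[local] Opaque derive.
Context {R : realType} {m N : nat}.
Local Notation V := 'M[R]_(N.+1, m).
Local Notation form := (lform R m N).
Variables (B : set V) (oB : open B).

(** By [derive_along], differentiating along the argument v i contributes a derivative
    along f (v i), which is the term of [lmap f (ld t)] where f acts on the argument
    used for differentiation. *)
Lemma ld_lie r (f : V -> V) (t : form r) : linear f -> is_form B t ->
  eqon B (ld (lie f t)) (lie f (ld t)).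
Proof.
move=> lf [[mt st] at_] x Bx v.
pose u i := fun j => v (lift i j).
have dt w y z : B y -> derivable (t ^~ w) y z by move=> By; exact: (smooth_derivable (st w) By).
have E1 (i : 'I_r.+1) : 'D_(v i) (fun y => lie f t y (u i)) x =
   'D_(f x) ('D_(v i) (t ^~ (u i))) x + 'D_(f (v i)) (t ^~ (u i)) x +
   \sum_j 'D_(v i) (t ^~ (upd (u i) j (f (u i j)))) x.
  have [s1 D1] := derive_along oB lf (st (u i)).
  have H (j : 'I_r) : xpredT j -> derivable (t ^~ (upd (u i) j (f (u i j)))) x (v i).
    by move=> _; exact: dt.
  rewrite /lie /lmap (derive_ptD (smooth_derivable s1 Bx) (derive_pt_sum (index_enum _) H).1).
  by rewrite D1 // (derive_pt_sum (index_enum _) H).2.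
rewrite {1}/ld; under eq_bigr => i _ do rewrite E1 -addrA mulrDr.
rewrite big_split /= {1}/lie; congr (_ + _).
  rewrite [in RHS]/ld (derive_lincomb (fun i : 'I_r.+1 => (-1) ^+ i)) // => i.
  exact: (smooth_derivable (smooth_D _ (st _)) Bx).
rewrite /lmap /ld exchange_big /=; apply: eq_bigr => i _.
rewrite -mulr_sumr; congr (_ * _); rewrite (bigD1_ord i) //=; congr (_ + _).
  by rewrite upd_same; congr ('D_ _ (fun y => t y _) x); rewrite upd_lift_same.
apply: eq_bigr => j _; rewrite upd_neq ?neq_lift //.
by congr ('D_ _ (fun y => t y _) x); rewrite upd_lift.
Qed.

(** The terms in which [f] and [g] act on different arguments are the same on both
    sides. *)
Lemma lmap_comm r (f g : V -> V) (t : form r) x v : multilinear (t x) ->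
  lmap f (lmap g t) x v = lmap g (lmap f t) x v + lmap (fun u => g (f u) - f (g u)) t x v.
Proof.
move=> mt.
have E (f1 g1 : V -> V) : lmap f1 (lmap g1 t) x v =
   \sum_i t x (upd v i (g1 (f1 (v i)))) + \sum_i \sum_(j | j != i) t x (upd (upd v i (f1 (v i))) j (g1 (v j))).
  rewrite {1}/lmap -big_split /=; apply: eq_bigr => i _; rewrite /lmap (bigD1 i) //= upd_same upd_upd.
  by congr (_ + _); apply: eq_bigr => j ji; rewrite upd_neq.
have X : \sum_i \sum_(j | j != i) t x (upd (upd v i (g (v i))) j (f (v j))) =
   \sum_i \sum_(j | j != i) t x (upd (upd v i (f (v i))) j (g (v j))).
  rewrite (exchange_big_dep xpredT) //=; apply: eq_bigr => i _.
  rewrite (eq_bigl (fun j => j != i)) => [|j]; last by rewrite eq_sym.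
  by apply: eq_bigr => j ji; rewrite updC.
rewrite !E X.
rewrite addrAC; congr (_ + _); rewrite /lmap -big_split /=; apply: eq_bigr => i _.
by rewrite multilinearB // addrC subrK.
Qed.

Lemma lmap_lie r (f g : V -> V) (t : form r) : mform B t ->
  eqon B (lmap f (lie g t)) (fadd (lie g (lmap f t)) (lmap (fun u => g (f u) - f (g u)) t)).
Proof.
move=> [mt st] x Bx v; rewrite /fadd /lie {1}/lmap big_split /=.
have H (i : 'I_r) : xpredT i -> derivable (t ^~ (upd v i (f (v i)))) x (g x).
  by move=> _; exact: (smooth_derivable (st _) Bx).
have -> : 'D_(g x) ((lmap f t) ^~ v) x = \sum_i 'D_(g x) (t ^~ (upd v i (f (v i)))) x.
  exact: (derive_pt_sum (index_enum _) H).2.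
by rewrite -addrA; congr (_ + _); apply: lmap_comm; apply: mt.
Qed.

Lemma lie_add r f (t u : form r) : mform B t -> mform B u ->
  eqon B (lie f (fadd t u)) (fadd (lie f t) (lie f u)).
Proof.
move=> mt mu x Bx v; rewrite /lie /fadd (derive_ptD (form_derivable mt Bx) (form_derivable mu Bx)).
by rewrite /lmap big_split /= addrACA.
Qed.

Lemma lie_scale r f c (t : form r) : mform B t ->
  eqon B (lie f (fscale c t)) (fscale c (lie f t)).
Proof.
move=> mt x Bx v; rewrite /lie /fscale (derive_ptZ c (form_derivable mt Bx)).
by rewrite /lmap mulrDr mulr_sumr.
Qed.

Lemma lmap_add r f (t u : form r) : eqon B (lmap f (fadd t u)) (fadd (lmap f t) (lmap f u)).
Proof. by move=> x Bx v; rewrite /lmap /fadd big_split. Qed.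

Lemma lmap_scale r f c (t : form r) : eqon B (lmap f (fscale c t)) (fscale c (lmap f t)).
Proof. by move=> x Bx v; rewrite /lmap /fscale mulr_sumr. Qed.

Lemma ld_add r (t u : form r) : mform B t -> mform B u ->
  eqon B (ld (fadd t u)) (fadd (ld t) (ld u)).
Proof.
move=> mt mu x Bx v; rewrite /ld /fadd -big_split /=; apply: eq_bigr => i _.
by rewrite (derive_ptD (form_derivable mt Bx) (form_derivable mu Bx)) mulrDr.
Qed.

Lemma ld_scale r c (t : form r) : mform B t ->
  eqon B (ld (fscale c t)) (fscale c (ld t)).
Proof.
move=> mt x Bx v; rewrite /ld /fscale mulr_sumr; apply: eq_bigr => i _.
by rewrite (derive_ptZ c (form_derivable mt Bx)) mulrCA.
Qed.

End Algebra.

(** * The operator P inverts the total time derivative *)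

Section PIdentities.
#[local] Opaque derive.
Context {R : realType} {m N : nat}.
Local Notation V := 'M[R]_(N.+1, m).
Local Notation form := (lform R m N).
Variables (B : set V) (oB : open B).
Local Notation X := (lie (@shift_field R m N)).
Local Notation S := (@lS R m N _).
Local Notation "t =B u" := (eqon B t u) (at level 70).

(** Records the order actually reached: every application of d_T uses up one of the
    orders available below the common one. *)
Definition pulled r e (t : form r) : Prop := exists t0 : lform R m e r, t = lpull t0.

Lemma is_form_lS r (t : form r) : is_form B t -> is_form B (lS t).
Proof. exact/is_form_lmap/vert_linear. Qed.

Lemma is_form_dT r (t : form r) : is_form B t -> is_form B (X t).
Proof. exact/is_form_lie/shift_field_linear. Qed.

Lemma is_form_lS_iter r p (t : form r) : is_form B t -> is_form B (iter p S t).
Proof. by move=> ft; elim: p => //= p; apply: is_form_lS. Qed.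

Lemma is_form_dT_iter r p (t : form r) : is_form B t -> is_form B (iter p X t).
Proof. by move=> ft; elim: p => //= p; apply: is_form_dT. Qed.

Lemma lP_trunc_S r M (t : form r) : lP_trunc M.+1 t = fadd (lP_trunc M t) (fscale (pcoef r M) (iter M X (iter M.+1 S t))).
Proof. by apply/funext => x; apply/funext => v; rewrite /lP_trunc big_ord_recr. Qed.

Lemma is_form_0 r : is_form B ((fun _ _ => 0) : form r).
Proof.
split; first split.
- by move=> x Bx v i c a b; rewrite mulr0 addr0.
- by move=> v p; apply: class_C_cst.
- by move=> x Bx v i j.
Qed.

Lemma is_form_lP_trunc r M (t : form r) : is_form B t -> is_form B (lP_trunc M t).
Proof.
move=> ft; elim: M => [|M IH].
  have -> : lP_trunc 0 t = fun _ _ => 0 by apply/funext => x; apply/funext => v; rewrite /lP_trunc big_ord0.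
  exact: is_form_0.
rewrite lP_trunc_S; apply: is_form_add => //; apply: is_form_scale => //.
exact/is_form_dT_iter/is_form_lS_iter.
Qed.

Lemma eqon_dT_iter r p (t u : form r) : t =B u -> iter p X t =B iter p X u.
Proof. by move=> tu; elim: p => //= p IH; apply: eqon_lie. Qed.

Lemma eqon_lS_iter r p (t u : form r) : t =B u -> iter p S t =B iter p S u.
Proof. by move=> tu; elim: p => //= p IH; apply: eqon_lmap. Qed.

Lemma eqon_lP_trunc r M (t u : form r) : t =B u -> lP_trunc M t =B lP_trunc M u.
Proof.
move=> tu x Bx v; apply: eq_bigr => p _; congr (_ * _).
exact: (eqon_dT_iter _ (eqon_lS_iter _ tu)).
Qed.

Lemma dT_iter_add r p (t u : form r) : is_form B t -> is_form B u ->
  iter p X (fadd t u) =B fadd (iter p X t) (iter p X u).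
Proof.
move=> ft fu; elim: p => //= p IH.
apply: eqon_trans (eqon_lie oB _ IH) _.
by apply: lie_add; apply: (is_form_dT_iter _ _).1.
Qed.

Lemma dT_iter_scale r p c (t : form r) : is_form B t ->
  iter p X (fscale c t) =B fscale c (iter p X t).
Proof.
move=> ft; elim: p => //= p IH.
apply: eqon_trans (eqon_lie oB _ IH) _.
by apply: lie_scale; apply: (is_form_dT_iter _ _).1.
Qed.

Lemma lS_add r (t u : form r) : lS (fadd t u) =B fadd (lS t) (lS u).
Proof. exact: lmap_add. Qed.

Lemma lS_scale r c (t : form r) : lS (fscale c t) =B fscale c (lS t).
Proof. exact: lmap_scale. Qed.

Lemma eqon_lS r (t u : form r) : t =B u -> lS t =B lS u.
Proof. exact: eqon_lmap. Qed.

Lemma lS_iter_add r p (t u : form r) :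
  iter p S (fadd t u) =B fadd (iter p S t) (iter p S u).
Proof.
elim: p => //= p IH; apply: eqon_trans (eqon_lS IH) _; exact: lS_add.
Qed.

Lemma lS_iter_scale r p c (t : form r) :
  iter p S (fscale c t) =B fscale c (iter p S t).
Proof.
elim: p => //= p IH; apply: eqon_trans (eqon_lS IH) _; exact: lS_scale.
Qed.

Lemma lP_trunc_add r M (t u : form r) : is_form B t -> is_form B u ->
  lP_trunc M (fadd t u) =B fadd (lP_trunc M t) (lP_trunc M u).
Proof.
move=> ft fu x Bx v; rewrite /lP_trunc /fadd -big_split /=; apply: eq_bigr => p _.
have fSt : is_form B (iter p.+1 S t) by apply: is_form_lS_iter.
have fSu : is_form B (iter p.+1 S u) by apply: is_form_lS_iter.
by rewrite (eqon_dT_iter p (@lS_iter_add _ p.+1 t u) Bx) (dT_iter_add p fSt fSu Bx) /fadd mulrDr.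
Qed.

Lemma lP_trunc_scale r M c (t : form r) : is_form B t ->
  lP_trunc M (fscale c t) =B fscale c (lP_trunc M t).
Proof.
move=> ft x Bx v; rewrite /lP_trunc /fscale mulr_sumr; apply: eq_bigr => p _.
have fSt : is_form B (iter p.+1 S t) by apply: is_form_lS_iter.
by rewrite (eqon_dT_iter p (@lS_iter_scale _ p.+1 c t) Bx) (dT_iter_scale p c fSt Bx) /fscale mulrCA.
Qed.

Lemma pulledS r e (t : form r) : (e <= N)%N -> pulled e t -> pulled e (lS t).
Proof. by move=> eN [t0 ->]; exists (lS t0); rewrite lpull_lS. Qed.

Lemma pulledS_iter r e p (t : form r) : (e <= N)%N -> pulled e t -> pulled e (iter p S t).
Proof. by move=> eN pt; elim: p => //= p; apply: pulledS. Qed.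

Lemma pulledX r e (t : form r) : (e < N)%N -> pulled e t -> pulled e.+1 (X t).
Proof. by move=> eN [t0 ->]; exists (ldT t0); rewrite lpull_dT. Qed.

Lemma pulledX_iter r e p (t : form r) : (p + e <= N)%N -> pulled e t -> pulled (p + e) (iter p X t).
Proof. by move=> pN pt; elim: p pN => //= p IH pN; apply: pulledX => //; apply: IH; apply: ltnW. Qed.

Lemma pulled_le r e e' (t : form r) : (e <= e')%N -> pulled e t -> pulled e' t.
Proof. by move=> le [t0 ->]; exists (lpull t0); rewrite lpull_lpull. Qed.

Lemma pulled_add r e (t u : form r) : pulled e t -> pulled e u -> pulled e (fadd t u).
Proof. by move=> [t0 ->] [u0 ->]; exists (fadd t0 u0). Qed.

Lemma pulled_scale r e c (t : form r) : pulled e t -> pulled e (fscale c t).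
Proof. by move=> [t0 ->]; exists (fscale c t0). Qed.

Lemma pulled_ld r e (t : form r) : pulled e t -> pulled e (ld t).
Proof. by move=> [t0 ->]; exists (ld t0); rewrite lpull_ld. Qed.

Lemma pulled_lP_trunc r e M (t : form r) : (M + e <= N)%N -> pulled e t -> pulled (M + e) (lP_trunc M t).
Proof.
move=> MN pt; elim: M MN => [|M IH] MN.
  by exists (fun _ _ => 0); apply/funext => x; apply/funext => v; rewrite /lP_trunc big_ord0.
rewrite lP_trunc_S; apply: pulled_add; first by apply: (@pulled_le _ (M + e)); [lia|apply: IH; lia].
apply/pulled_scale/(@pulled_le _ (M + e)); first by lia.
by apply: pulledX_iter; [lia|apply: pulledS_iter => //; lia].
Qed.

(** Each of the r arguments contributes the bracket of the two fields, which is the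
    identity. *)
Lemma lS_dT r e (t : form r) : (e < N)%N -> pulled e t -> mform B t ->
  lS (X t) =B fadd (X (lS t)) (fscale r%:R t).
Proof.
move=> eN [t0 E] mt; apply: eqon_trans (lmap_lie (B := B) _ _ mt) _; apply: eqon_add => //.
move=> x Bx v; rewrite /fscale mulr_natl -[in RHS](card_ord r) -sumr_const; apply: eq_bigr => i _.
by rewrite E /lpull (upd_comp (@crd_proj R m N e)) crd_proj_comm // -(upd_comp (@crd_proj R m N e)) upd_id.
Qed.

Lemma lS_iter_dT r e p (t : form r) : (e < N)%N -> pulled e t -> is_form B t ->
  iter p S (X t) =B fadd (X (iter p S t)) (fscale (p%:R * r%:R) (iter p.-1 S t)).
Proof.
move=> eN pt ft; elim: p => [|p IH]; first by move=> x Bx v; rewrite /fadd /fscale !mul0r addr0.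
rewrite iterS; apply: eqon_trans (eqon_lS IH) _; apply: eqon_trans (lS_add _ _) _.
move=> x Bx v; rewrite {1}/fadd (lS_scale _ _ Bx).
rewrite (lS_dT eN (pulledS_iter p (ltnW eN) pt) (is_form_lS_iter _ ft).1 Bx) /fadd /fscale /=.
case: p {IH} => [|p] /=; first by rewrite mul0r mul0r addr0 mul1r.
by rewrite -addrA; congr (_ + _); rewrite -mulrDl -(addn1 p.+1) natrD; ring.
Qed.

Lemma lS_dT_iter r e q (t : form r) : (e + q <= N)%N -> pulled e t -> is_form B t ->
  lS (iter q X t) =B fadd (iter q X (lS t)) (fscale (q%:R * r%:R) (iter q.-1 X t)).
Proof.
move=> eN pt ft; elim: q eN => [|q IH] eN; first by move=> x Bx v; rewrite /fadd /fscale !mul0r addr0.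
rewrite iterS.
apply: eqon_trans (lS_dT (e := q + e) _ (pulledX_iter _ pt) (is_form_dT_iter _ ft).1) _; try by lia.
have {}IH := IH (ltnW (leq_trans (eq_leq (esym (addnS e q))) eN)).
apply: (eqon_trans (eqon_add (eqon_lie oB _ IH) (@eqon_refl _ _ _ B _ _))).
move=> x Bx v; rewrite {1}/fadd (lie_add _ (is_form_dT_iter _ (is_form_lS ft)).1 (is_form_scale oB _ (is_form_dT_iter _ ft)).1 Bx).
rewrite {1}/fadd (lie_scale _ _ (is_form_dT_iter _ ft).1 Bx) /fscale /fadd /=.
case: q {IH eN} => [|q] /=; first by rewrite mul0r mul0r addr0 mul1r.
by rewrite -addrA; congr (_ + _); rewrite -mulrDl -(addn1 q.+1) natrD; ring.
Qed.

(** By the two lemmas below, passing the factor p r of the commutator to the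
    coefficients of P leaves differences of consecutive [dcoef]; this is why the sums
    defining P telescope. *)
Definition dcoef (r p : nat) : R := (-1) ^+ p / (r%:R ^+ p * p`!%:R).

Lemma pcoef_dcoef r p : pcoef r p = - dcoef r p.+1.
Proof. by rewrite /pcoef /dcoef [(-1) ^+ p.+1]exprS mulN1r mulNr opprK. Qed.

Lemma pcoef_mul r p : (0 < r)%N -> pcoef r p * (p.+1%:R * r%:R) = dcoef r p.
Proof.
move=> r0; rewrite /pcoef /dcoef factS natrM exprS.
have r1 : (r%:R : R) != 0 by rewrite pnatr_eq0 -lt0n.
have p1 : (p.+1%:R : R) != 0 by rewrite pnatr_eq0.
have f1 : (p`!%:R : R) != 0 by rewrite pnatr_eq0 -lt0n fact_gt0.
have e1 : (r%:R ^+ p : R) != 0 by rewrite expf_neq0.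
move: e1 f1 p1 r1; move: (r%:R ^+ p : R) (p`!%:R : R) (p.+1%:R : R) (r%:R : R) => a b c d a0 b0 c0 d0.
by field; rewrite a0 b0 c0 d0.
Qed.

(** P d_T = 1 up to a remainder. The commutation rule splits each d_T^p S^(p+1) d_T into
    two terms, and consecutive terms cancel. *)
Lemma lP_trunc_dT r e M (t : form r) : (0 < r)%N -> (e < N)%N -> pulled e t -> is_form B t ->
  lP_trunc M (X t) =B fadd t (fscale (- dcoef r M) (iter M X (iter M S t))).
Proof.
move=> r0 eN pt ft; elim: M => [|M IH].
  by move=> x Bx v; rewrite /lP_trunc big_ord0 /fadd /fscale /dcoef !expr0 fact0 mulr1 divr1 mulN1r subrr.
move=> x Bx v; have fS q := is_form_lS_iter q ft.
have E2 : iter M X (iter M.+1 S (X t)) x v =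
   iter M.+1 X (iter M.+1 S t) x v + (M.+1%:R * r%:R) * iter M X (iter M S t) x v.
  rewrite (eqon_dT_iter M (lS_iter_dT M.+1 eN pt ft) Bx).
  have f1 := is_form_dT (fS M.+1); have f2 := is_form_scale oB (M.+1%:R * r%:R) (fS M).
  by rewrite (dT_iter_add M f1 f2 Bx) /fadd (dT_iter_scale M _ (fS M) Bx) (iterSr M X).
have E1 := IH x Bx v.
rewrite lP_trunc_S -[LHS]/(lP_trunc M (X t) x v + pcoef r M * iter M X (iter M.+1 S (X t)) x v) E1 E2 /fadd /fscale.
rewrite mulrDr (mulrA (pcoef r M)) pcoef_mul // pcoef_dcoef; ring.
Qed.

(** S (1 - d_T P) = 0 up to a remainder, by the same telescoping with the rule [S,
    d_T^q] = q r d_T^(q-1). *)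
Lemma lS_dT_lP_trunc r e M (t : form r) : (0 < r)%N -> (e + M <= N)%N -> pulled e t -> is_form B t ->
  lS (X (lP_trunc M t)) =B fadd (lS t) (fscale (- dcoef r M) (iter M X (iter M.+1 S t))).
Proof.
move=> r0 + pt ft; have fS q := is_form_lS_iter q ft; elim: M => [|M IH] eN.
  move=> x Bx v; rewrite (eqon_lS (eqon_lie oB _ (_ : _ =B fscale 0 t)) Bx); last first.
    by move=> y By w; rewrite /lP_trunc big_ord0 /fscale mul0r.
  rewrite (eqon_lS (lie_scale _ _ ft.1) Bx) lS_scale // {1}/fscale mul0r.
  by rewrite /fadd /fscale /dcoef !expr0 fact0 mulr1 divr1 mulN1r subrr.
move=> x Bx v.
have f1 := is_form_lP_trunc M ft.
have f2 : is_form B (iter M X (iter M.+1 S t)) by apply: is_form_dT_iter; apply: (fS M.+1).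
have f3 := is_form_scale oB (pcoef r M) f2.
have eN' : (e + M.+1 <= N)%N by lia.
have eN0 : (e <= N)%N by lia.
have eN1 : (e + M <= N)%N by lia.
have E1 := IH eN1 x Bx v.
have E2 := lS_dT_iter (q := M.+1) eN' (pulledS_iter M.+1 eN0 pt) (fS M.+1) Bx v.
have -> : lS (X (lP_trunc M.+1 t)) x v = lS (X (lP_trunc M t)) x v + pcoef r M * lS (iter M.+1 X (iter M.+1 S t)) x v.
  rewrite lP_trunc_S (eqon_lS (lie_add _ f1.1 f3.1) Bx) (lS_add _ _ Bx) {1}/fadd.
  by rewrite (eqon_lS (lie_scale _ _ f2.1) Bx) (lS_scale _ _ Bx).
rewrite E1 E2 /fadd /fscale mulrDr (mulrA (pcoef r M)) pcoef_mul // pcoef_dcoef /=; ring.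
Qed.

Lemma iter_vert0 q (v : V) (p : 'I_N.+1) i : (p < q)%N -> iter q (@vert_endo R m N) v p i = 0.
Proof.
elim: q p => // q IH p pq; rewrite iterS mxE.
case E : (nat_of_ord p) => [|p']; first by rewrite mul0r.
rewrite IH ?mulr0 // -E inordK; have := ltn_ord p; lia.
Qed.

(** Every application of S moves one argument down by one order, and an argument moved
    down more than [e] times has projection 0. *)
Lemma lS_nilp r e p (t : form r) : (e <= N)%N -> pulled e t -> is_form B t -> (r * e < p)%N ->
  iter p S t =B fun _ _ => 0.
Proof.
move=> eN pt ft rp x Bx v.
(* The argument i can be moved down at most b i times before its projection vanishes;
   each application of S uses up one unit of the total. *)
suff key : forall p (b : 'I_r -> nat) (v : 'I_r -> V),
  (forall i, crd_proj e (iter (b i).+1 (@vert_endo R m N) (v i)) = 0) -> (\sum_i b i < p)%N -> iter p S t x v = 0.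
  apply: (key p (fun _ => e)) => [i|]; last by rewrite sum_nat_const card_ord.
  apply/matrixP => q j; rewrite [LHS]mxE [RHS]mxE iter_vert0 // inordK; have := ltn_ord q; lia.
have z q (w : 'I_r -> V) i : crd_proj e (w i) = 0 -> iter q S t x w = 0.
  move=> wi; have [t0 E] := pulledS_iter q eN pt.
  have mS := (is_form_lS_iter q ft).1.1 x Bx.
  rewrite -(multilinear0 w i mS) E /lpull; congr (t0 _ _); apply/funext => j; rewrite /upd.
  case: eqP => // ->; rewrite wi; apply/matrixP => a b; by rewrite !mxE.
elim=> // {rp v}q IH b v Hb sb; rewrite iterS /lS big1 // => i _; rewrite !updE.
case E : (b i) => [|b'].
  by apply: (z q _ i); rewrite upd_same; have := Hb i; rewrite E.
apply: (IH (upd b i b')) => [j|].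
  have [->|ji] := eqVneq j i; last by rewrite !upd_neq.
  by rewrite !upd_same -iterSr -E.
rewrite (bigD1 i) //= upd_same (eq_bigr b) => [|j ji]; last by rewrite upd_neq.
by move: sb; rewrite (bigD1 i) //= E addSn ltnS.
Qed.

End PIdentities.

(** * Integrals over the unit interval depending on a parameter *)

Section Integral01.
Context {R : realType}.
Notation mu := (@lebesgue_measure R).

Definition I01 (g : R -> R) : R := \int[mu]_(t in `[0%R, 1%R]) g t.

Definition cont01 (g : R -> R) : Prop := forall t : R, 0 <= t <= 1 -> {for t, continuous g}.

Lemma cont01_within (g : R -> R) : cont01 g -> {within `[0%R, 1%R], continuous g}.
Proof.
by move=> cg; apply: continuous_in_subspaceT => t; rewrite inE /= in_itv /= => tI; apply: cg.
Qed.

Lemma cont01_integrable (g : R -> R) : cont01 g -> mu.-integrable `[0%R, 1%R] (EFin \o g).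
Proof.
move=> cg; apply: continuous_compact_integrable; first exact: segment_compact.
exact: cont01_within.
Qed.

Lemma cont01_add f g : cont01 f -> cont01 g -> cont01 (fun t => f t + g t).
Proof. by move=> cf cg t tI; apply: cvgD; [apply: cf|apply: cg]. Qed.

Lemma cont01_scale c f : cont01 f -> cont01 (fun t => c * f t).
Proof. by move=> cf t tI; apply: cvgM; [apply: cvg_cst|apply: cf]. Qed.

Lemma I01_add f g : cont01 f -> cont01 g -> I01 (fun t => f t + g t) = I01 f + I01 g.
Proof. by move=> cf cg; apply: RintegralD => //; apply: cont01_integrable. Qed.

Lemma I01_scale c f : cont01 f -> I01 (fun t => c * f t) = c * I01 f.
Proof. by move=> cf; apply: RintegralZl => //; apply: cont01_integrable. Qed.

Lemma I01_eq f g : (forall t : R, 0 <= t <= 1 -> f t = g t) -> I01 f = I01 g.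
Proof. by move=> fg; apply: eq_Rintegral => t; rewrite inE /= in_itv /=; apply: fg. Qed.

Lemma I01_0 : I01 (fun _ => 0) = 0.
Proof. by rewrite /I01 Rintegral_cst // mul0r. Qed.

Lemma cont01_sum (J : Type) (s : seq J) (P : pred J) (c : J -> R) (f : J -> R -> R) : (forall j, cont01 (f j)) ->
  cont01 (fun t => \sum_(j <- s | P j) c j * f j t) /\
  I01 (fun t => \sum_(j <- s | P j) c j * f j t) = \sum_(j <- s | P j) c j * I01 (f j).
Proof.
move=> cf; elim: s => [|j s [IH1 IH2]].
  under eq_fun do rewrite big_nil; rewrite big_nil; split; last exact: I01_0.
  by move=> t _; apply: cvg_cst.
under eq_fun do rewrite big_cons; rewrite big_cons.
case: (P j) => //; split; first by apply: cont01_add => //; apply: cont01_scale.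
by rewrite I01_add ?I01_scale ?IH2 //; apply: cont01_scale.
Qed.

Lemma I01_bound g e : cont01 g -> (forall t : R, 0 <= t <= 1 -> `|g t| <= e) -> `|I01 g| <= e.
Proof.
move=> cg ge; have ig := cont01_integrable cg.
apply: le_trans (le_normr_Rintegral _ ig) _ => //.
have cn : cont01 (fun t => `|g t|) by move=> t tI; apply: cvg_norm; apply: cg.
apply: (@le_trans _ _ (\int[mu]_(t in `[0%R, 1%R]) e)).
  have ce : cont01 (fun _ => e) by move=> t _; apply: cvg_cst.
  apply: (le_Rintegral _ (cont01_integrable cn) (cont01_integrable ce)) => //.
have m1 : lebesgue_measure (`[0%R, 1%R] : set R) = 1%E.
  by rewrite lebesgue_measure_itv /= lte_fin ltr01 sube0.
rewrite Rintegral_cst //; set z := fine _; have -> : z = 1 by rewrite /z; move: m1 => /= ->.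
by rewrite mulr1.
Qed.

Lemma I01_FTC (g dg : R -> R) : (forall t : R, 0 <= t <= 1 -> is_derive t (1 : R) g (dg t)) ->
  cont01 dg -> I01 dg = g 1 - g 0.
Proof.
move=> D cd; rewrite /I01 /Rintegral (@continuous_FTC2 _ dg g 0 1) //.
- exact: cont01_within.
- have dc (t : R) : 0 <= t <= 1 -> {for t, continuous g}.
    by move=> /D[dt _]; apply/differentiable_continuous/derivable1_diffP.
  split.
  + by move=> t; rewrite in_itv /= => /andP[t0 t1]; have [|//] := D t; rewrite !ltW.
  + by apply: cvg_at_right_filter; apply: dc; rewrite lexx ler01.
  + by apply: cvg_at_left_filter; apply: dc; rewrite lexx ler01.
- move=> t; rewrite in_itv /= => /andP[t0 t1]; rewrite derive1E.
  by have [|//] := D t; rewrite !ltW.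
Qed.

End Integral01.

Section Param.
Context {R : realType} {V : normedModType R}.
Implicit Types (f : (R * V)%type -> R) (A : set V) (B : set (R * V)%type).

Lemma param_cont f x : (forall t : R, 0 <= t <= 1 -> {for (t, x), continuous f}) ->
  cont01 (fun t => f (t, x)).
Proof.
move=> cf t tI; apply: (@continuous_comp _ _ _ (fun t => (t, x)) f); last exact: cf.
have c1 : (fun s : R => s) @ t --> t by exact: cvg_id.
have c2 : (fun _ : R => x) @ t --> x by exact: cvg_cst.
exact: (cvg_pair c1 c2).
Qed.

(** Compactness of the interval. *)
Lemma param_uniform f x e : 0 < e -> (forall t : R, 0 <= t <= 1 -> {for (t, x), continuous f}) ->
  \forall y \near x, forall t : R, 0 <= t <= 1 -> `|f (t, y) - f (t, x)| <= e.
Proof.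
move=> e0 cf.
have /compact_near_coveringP/(_ _ (nbhs x) (fun y t => `|f (t, y) - f (t, x)| <= e)) := @segment_compact R 0 1.
move=> H; have {}H : \forall y \near x, `[0, 1] `<=` (fun t => `|f (t, y) - f (t, x)| <= e).
  apply: H => t /=; rewrite in_itv /= => tI.
  have e2 : 0 < e / 2 by rewrite divr_gt0.
  have /cvgrPdist_le/(_ _ e2)[[U W] /= [Ut Wx] UW] := cf t tI.
  exists (U, W) => //= -[t' y] /= [Ut' Wy].
  have h1 := UW (t', y) (conj Ut' Wy).
  have h2 := UW (t', x) (conj Ut' (nbhs_singleton Wx)).
  rewrite (le_trans (ler_distD (f (t, x)) _ _)) // (splitr e) lerD //.
  by rewrite distrC.
by apply: filterS H => y H t tI; apply: H; rewrite /= in_itv.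
Qed.

(** By the mean value theorem the difference quotient of the integrand is a value of the
    derivative at a nearby point, and [param_uniform] makes the closeness uniform over
    the interval. *)
Lemma param_derive f A B x v : open A -> open B -> A x ->
  (forall (t : R) y, 0 <= t <= 1 -> A y -> B (t, y)) -> smooth_on B f ->
  is_derive x v (fun y => I01 (fun t => f (t, y))) (I01 (fun t => 'D_((0 : R), v) f (t, x))).
Proof.
move=> oA oB Ax AB sf.
have sD := smooth_D ((0 : R), v) sf.
have cf y : A y -> forall t : R, 0 <= t <= 1 -> {for (t, y), continuous f}.
  by move=> Ay t tI; have [c _] := sf 0%N; apply: c; apply: AB.
have cD : forall t : R, 0 <= t <= 1 -> {for (t, x), continuous ('D_((0 : R), v) f)}.
  by move=> t tI; have [c _] := sD 0%N; apply: c; apply: AB.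
suff H : (fun h : R => h^-1 *: (((fun y => I01 (fun t => f (t, y))) \o shift x) (h *: v) - I01 (fun t => f (t, x)))) @ 0^' --> I01 (fun t => 'D_((0 : R), v) f (t, x)).
  by apply: DeriveDef; [apply/cvg_ex; eexists; exact: H|exact: cvg_lim H].
apply/cvgrPdist_le => e e0.
have [d d0 dP] := near_two_scales v v (filterI (near_in oA Ax) (param_uniform e0 cD)).
near=> h.
have hn0 : h != 0 by near: h; exact: nbhs_dnbhs_neq.
have hd : `|h| < d by near: h; exact: dnbhs0_lt.
have z0 : `|0 : R| < d by rewrite normr0.
have dP' (s : R) : 0 <= s <= 1 -> (A `&` (fun y => forall t : R, 0 <= t <= 1 -> `|'D_((0 : R), v) f (t, y) - 'D_((0 : R), v) f (t, x)| <= e)) ((s * h) *: v + x).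
  move=> /andP[s0 s1]; have := dP (s * h) 0; rewrite scale0r add0r; apply => //.
  by rewrite normrM (le_lt_trans _ hd) // ler_piMl // ger0_norm.
have Ah : A (h *: v + x) by have := (dP' 1 _).1; rewrite mul1r; apply; rewrite ler01 lexx.
have c1 := param_cont (cf _ Ah). have c2 := param_cont (cf _ Ax). have c3 := param_cont cD.
have E : I01 (fun t => 'D_((0 : R), v) f (t, x)) - h^-1 *: (I01 (fun t => f (t, h *: v + x)) - I01 (fun t => f (t, x))) =
  I01 (fun t => 'D_((0 : R), v) f (t, x) + (- h^-1 * f (t, h *: v + x) + h^-1 * f (t, x))).
  rewrite I01_add //; last by apply: cont01_add; apply: cont01_scale.
  rewrite I01_add ?I01_scale //; try exact: cont01_scale.
  by rewrite /GRing.scale /=; ring.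
rewrite /= E; apply: I01_bound.
  by apply: cont01_add => //; apply: cont01_add; apply: cont01_scale.
move=> t tI.
have lin (c s : R) : c *: (s *: ((0 : R), v)) + (t, x) = (t, (c * s) *: v + x).
  by congr pair; rewrite /= ?scaler0 ?add0r // scalerA.
have lin1 : h *: ((0 : R), v) + (t, x) = (t, h *: v + x).
  by congr pair; rewrite /= ?scaler0 ?add0r // scalerA.
have [s sI|s sI] := @mvt_line _ _ f (t, x) (h *: ((0 : R), v)).
  rewrite lin; apply: derivableZ_dir; apply: (smooth_derivable sf).
  by apply: AB => //; apply: (dP' s sI).1.
rewrite lin1 lin deriveZ_dir; last first.
  by apply: (smooth_derivable sf); apply: AB => //; apply: (dP' s sI).1.
move=> Es; have -> : - h^-1 * f (t, h *: v + x) + h^-1 * f (t, x) = - 'D_((0 : R), v) f (t, (s * h) *: v + x).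
  move/eqP: Es; rewrite subr_eq => /eqP ->.
  by rewrite mulNr mulrDr [_ *: _]/(h * _) mulKf // opprD subrK.
by rewrite distrC; apply: (dP' s sI).2.
Unshelve. all: by end_near. Qed.

Lemma param_smooth f A B : open A -> open B ->
  (forall (t : R) y, 0 <= t <= 1 -> A y -> B (t, y)) -> smooth_on B f ->
  smooth_on A (fun y => I01 (fun t => f (t, y))).
Proof.
move=> oA oB AB + p; elim: p f => [|p IH] f sf.
  split=> // x Ax; have [cf _] := sf 0%N; apply/cvgrPdist_le => e e0.
  have cx y : A y -> forall t : R, 0 <= t <= 1 -> {for (t, y), continuous f}.
    by move=> Ay t tI; apply: cf; apply: AB.
  apply: filterS2 (near_in oA Ax) (param_uniform e0 (cx _ Ax)) => y Ay H.
  have -> : I01 (fun t => f (t, x)) - I01 (fun t => f (t, y)) = I01 (fun t => f (t, x) + (-1) * f (t, y)).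
    rewrite I01_add ?I01_scale ?mulN1r //; try exact/param_cont/cx.
    by apply: cont01_scale; exact/param_cont/cx.
  apply: I01_bound.
    by apply: cont01_add; [|apply: cont01_scale]; exact/param_cont/cx.
  by move=> t tI; rewrite mulN1r distrC; apply: H.
split=> [x Ax|v]; first by case: p IH => [|p] IH; have [c _] := IH f sf; apply: c.
have D x : A x -> _ := fun Ax => param_derive v oA oB Ax AB sf.
split=> [x Ax|]; first by have [] := D x Ax.
apply: (class_C_eq oA (f := fun x => I01 (fun t => 'D_((0 : R), v) f (t, x)))).
  by move=> x Ax; have [_ ->] := D x Ax.
by apply: (IH ('D_((0 : R), v) f)); apply: smooth_D.
Qed.

End Param.

(** * The Poincare lemma on star-shaped sets *)

Section Poincare.
#[local] Opaque derive.
Context {R : realType} {m k : nat}.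
Local Notation V := 'M[R]_(k.+1, m).
Local Notation form := (lform R m k).

(** The contraction with the radial field, integrated along the ray from [x0] to x; the
    weight s^r comes from the differential s of the dilation in each of the r arguments. *)
Definition homotopy_op (x0 : V) r (t : form r.+1) : form r :=
  fun x v => I01 (fun s => s ^+ r * t (x0 + s *: (x - x0)) (fcons (x - x0) v)).

Variables (B : set V) (x0 : V).
Hypotheses (oB : open B)
  (star : forall (s : R) x, 0 <= s <= 1 -> B x -> B (x0 + s *: (x - x0))).

Let ray (p : R * V) : V := x0 + p.1 *: (p.2 - x0).
(** An open neighbourhood of the product of the unit interval and [B]: the parameter has
    to move freely around the end points 0 and 1 as well. *)
Let B2 : set (R * V) := [set p | B (ray p)].

Lemma smooth_fst (A : set (R * V)) : smooth_on A (fun p => p.1).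
Proof. by apply: smooth_continuous_linear => // p; apply: cvg_fst. Qed.

Lemma smooth_snd (A : set (R * V)) : smooth_on A (fun p => p.2).
Proof. by apply: smooth_continuous_linear => // p; apply: cvg_snd. Qed.

Lemma smooth_sub (A : set (R * V)) : open A -> smooth_on A (fun p => p.2 - x0).
Proof. by move=> oA p; apply: class_C_add => //; [apply: smooth_snd|apply: class_C_cst]. Qed.

Lemma smooth_ray (A : set (R * V)) : open A -> smooth_on A ray.
Proof.
move=> oA p; apply/class_C_mxP => // i j.
apply: (class_C_eq oA (f := fun q : R * V => x0 i j + q.1 * ((q.2 - x0) i j))).
  by move=> q _; rewrite /ray !mxE.
apply: class_C_add => //; first exact: class_C_cst.
apply: class_C_mul => //; first exact: smooth_fst.
by apply: (iffLR (class_C_mxP _ _ oA)); apply: smooth_sub.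
Qed.

Lemma open_B2 : open B2.
Proof.
apply: (open_comp _ oB) => p _.
have [c _] := smooth_ray (openT : open [set: R * V]) 0%N; exact: c.
Qed.

Let fam r (t : form r.+1) v (p : R * V) : R := p.1 ^+ r * t (ray p) (fcons (p.2 - x0) v).

Lemma fam_smooth r (t : form r.+1) v : mform B t ->
  smooth_on B2 (fam t v) /\
  forall s x u, B2 (s, x) -> 'D_((0 : R), u) (fam t v) (s, x) =
    s ^+ r * (s * 'D_u (t ^~ (fcons (x - x0) v)) (ray (s, x)) + t (ray (s, x)) (fcons u v)).
Proof.
move=> mt; have o2 := open_B2.
pose w (i : 'I_r.+1) (p : R * V) := fcons (p.2 - x0) v i.
have sw i : smooth_on B2 (w i).
  rewrite /w; case: (unliftP ord0 i) => [j|] -> p.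
    by apply: class_C_eq o2 (fun x _ => esym (fconsS _ _ _)) (class_C_cst _ _ _).
  by apply: class_C_eq o2 (fun x _ => esym (fcons0 _ _)) (smooth_sub o2 p).
have [s1 D1] := form_comp o2 oB mt (fun p H => H) (smooth_ray o2) sw.
have s2 : smooth_on B2 (fun p : R * V => p.1 ^+ r).
  elim: r {t v mt w sw s1 D1} => [|r IH] p; first exact: class_C_cst.
  apply: (class_C_eq o2 (f := fun q : R * V => q.1 * q.1 ^+ r)) => [q _|]; first by rewrite exprS.
  by apply: class_C_mul => //; apply: smooth_fst.
split=> [p|s x u B2x]; first exact: class_C_mul.
rewrite (derive_ptM (smooth_derivable s2 B2x) (smooth_derivable s1 B2x)).
have [_ ->] : is_derive (s, x) ((0 : R), u) (fun p : R * V => p.1 ^+ r) 0.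
  by apply: is_derive_affine => h; rewrite /= scaler0 add0r subrr.
rewrite mul0r add0r; congr (_ * _); rewrite (D1 _ _ B2x).
have [_ ->] : is_derive (s, x) ((0 : R), u) ray (s *: u).
  apply: is_derive_affine => h; rewrite /ray /= scaler0 add0r opprD addrACA subrr add0r.
  by rewrite -scalerBr opprB addrA subrK addrK scalerA mulrC -scalerA.
rewrite deriveZ_dir; last by exact: (form_derivable mt B2x).
congr (_ + _); rewrite big_ord_recl [X in _ + X]big1 ?addr0 => [|i _].
  have [_ ->] : is_derive (s, x) ((0 : R), u) (w ord0) u.
    by apply: is_derive_affine => h; rewrite /w !fcons0 /= opprB addrA subrK addrK.
  by rewrite fcons_upd0.
have [_ ->] : is_derive (s, x) ((0 : R), u) (w (lift ord0 i)) 0.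
  by apply: is_derive_affine => h; rewrite /w !fconsS subrr scaler0.
by rewrite multilinear0 //; apply: mt.1.
Qed.

Lemma star2 (s : R) x : 0 <= s <= 1 -> B x -> B2 (s, x).
Proof. exact: star. Qed.

Lemma fam_cont r (t : form r.+1) v x : mform B t -> B x -> cont01 (fun s => fam t v (s, x)).
Proof.
move=> mt Bx; apply: param_cont => s sI; have [/(_ 0%N)[c _] _] := fam_smooth v mt.
by apply: c; apply: star2.
Qed.

Lemma is_form_homotopy_op r (t : form r.+1) : is_form B t -> is_form B (homotopy_op x0 t).
Proof.
move=> [mt at_]; split; first split.
- move=> x Bx v i c a b; rewrite !updE /homotopy_op.
  have E y : I01 (fun s => s ^+ r * t (x0 + s *: (x - x0)) (fcons (x - x0) (upd v i y))) = I01 (fun s => fam t (upd v i y) (s, x)) by [].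
  rewrite !E -I01_scale; last exact: fam_cont.
  rewrite -I01_add; [|by apply: cont01_scale; exact: fam_cont|exact: fam_cont].
  apply: I01_eq => s sI; rewrite /fam -!fcons_updS (multilinearP (mt.1 _ (star2 sI Bx))) /=; ring.
- by move=> v; apply: (param_smooth oB open_B2 star2 (fam_smooth v mt).1).
- move=> x Bx v i j ij vij; rewrite /homotopy_op -[RHS]I01_0; apply: I01_eq => s sI.
  rewrite (at_ _ (star2 sI Bx) _ (lift ord0 i) (lift ord0 j)) ?mulr0 //; by rewrite !fconsS.
Qed.

Lemma fcons_lift r (y : V) (v : 'I_r.+1 -> V) i :
  (fun j => fcons y v (lift (lift ord0 i) j)) = fcons y (fun j => v (lift i j)).
Proof.
apply/funext => j; case: (unliftP ord0 j) => [l|] ->; last first.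
  have -> : lift (lift ord0 i) ord0 = ord0 by apply/val_inj.
  by rewrite !fcons0.
have -> : lift (lift ord0 i) (lift ord0 l) = lift ord0 (lift i l).
  by apply/val_inj; rewrite /= /bump; lia.
by rewrite !fconsS.
Qed.

Lemma cont01_eq x (f g : R -> R) : B x -> (forall s, B2 (s, x) -> f s = g s) -> cont01 f -> cont01 g.
Proof.
move=> Bx fg cf s sI.
have near2 : \forall u \near s, B2 (u, x).
  have c1 : (fun u : R => u) @ s --> s by exact: cvg_id.
  have c2 : (fun _ : R => x) @ s --> x by exact: cvg_cst.
  exact: (cvg_pair c1 c2 (near_in open_B2 (star2 sI Bx))).
rewrite /prop_for /continuous_at -(fg s (star2 sI Bx)).
apply: cvg_trans (cf s sI); apply: near_eq_cvg.
by apply: filterS near2 => u Bu; rewrite fg.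
Qed.

(** In the sum of the two integrands, the terms that differentiate [t] along a
    non-radial argument cancel. What is left is the derivative of s^(r+1) t along the
    ray, to be integrated from 0 to 1. *)
Lemma homotopy r (t : form r.+1) : is_form B t ->
  forall x, B x -> forall v, ld (homotopy_op x0 t) x v + homotopy_op x0 (ld t) x v = t x v.
Proof.
move=> ft x Bx v; have [mt at_] := ft.
pose X := x - x0.
pose g i s := s ^+ r * (s * 'D_(v i) (t ^~ (fcons X (fun j => v (lift i j)))) (ray (s, x)) + t (ray (s, x)) (fcons (v i) (fun j => v (lift i j)))).
have E1 (i : 'I_r.+1) : 'D_(v i) (fun y => homotopy_op x0 t y (fun j => v (lift i j))) x = I01 (g i).
  have [_ ->] := param_derive (v i) oB open_B2 Bx star2 (fam_smooth (fun j => v (lift i j)) mt).1.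
  by apply: I01_eq => s sI; rewrite (fam_smooth _ mt).2 //; apply: star2.
have cg (i : 'I_r.+1) : cont01 (g i).
  have [sf Df] := fam_smooth (fun j => v (lift i j)) mt.
  have sD := smooth_D ((0 : R), v i) sf.
  have : cont01 (fun s => 'D_((0 : R), v i) (fam t (fun j => v (lift i j))) (s, x)).
    apply: (param_cont (f := 'D_((0 : R), v i) (fam t (fun j => v (lift i j))))) => s sI.
    by have [c _] := sD 0%N; apply: c; apply: star2.
  by apply: (cont01_eq Bx) => s Bs; exact: Df.
have cK : cont01 (fun s => fam (ld t) v (s, x)) by apply: fam_cont => //; exact: (is_form_ld oB ft).1.
have [cs Is] := cont01_sum (index_enum _) xpredT (fun i : 'I_r.+1 => (-1) ^+ i) cg.
rewrite /ld; under eq_bigr => i _ do rewrite E1.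
rewrite -Is -[homotopy_op x0 _ x v]/(I01 (fun s => fam (ld t) v (s, x))) -I01_add //.
pose G s := s ^+ r.+1 * t (ray (s, x)) v.
have -> : t x v = G 1 - G 0.
  by rewrite /G expr1n exprS !mul0r subr0 mul1r /ray /= scale1r addrC subrK.
pose dG s := r.+1%:R * s ^+ r * t (ray (s, x)) v + s ^+ r.+1 * 'D_X (t ^~ v) (ray (s, x)).
have E2 (s : R) : B2 (s, x) -> \sum_(i < r.+1) (-1) ^+ i * g i s + fam (ld t) v (s, x) = dG s.
  move=> Br.
  pose D i := 'D_(v i) (t ^~ (fcons X (fun j => v (lift i j)))) (ray (s, x)).
  have -> : \sum_(i < r.+1) (-1) ^+ i * g i s = s ^+ r.+1 * (\sum_(i < r.+1) (-1) ^+ i * D i) + s ^+ r * (r.+1%:R * t (ray (s, x)) v).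
    rewrite -[in r.+1%:R](card_ord r.+1) mulr_natl -sumr_const !mulr_sumr -big_split /=; apply: eq_bigr => i _.
    rewrite (move_front v i (mt.1 _ Br) (at_ _ Br)) /g -/(D i) exprS; ring.
  have -> : fam (ld t) v (s, x) = s ^+ r.+1 * ('D_X (t ^~ v) (ray (s, x)) - \sum_(i < r.+1) (-1) ^+ i * D i).
    rewrite /fam /ld big_ord_recl /= mul1r fcons0 fcons_lift0 -/X; congr (_ * (_ + _)).
    by rewrite -sumrN; apply: eq_bigr => i _; rewrite fconsS fcons_lift exprS mulN1r mulNr.
  rewrite /dG; ring.
rewrite (I01_eq (fun s sI => E2 s (star2 sI Bx))); apply: I01_FTC; last first.
  by apply: cont01_eq Bx E2 _; apply: cont01_add.
move=> s sI; have Br := star2 sI Bx.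
have Dr : is_derive s (1 : R) (fun u => ray (u, x)) X.
  by apply: is_derive_affine => h; rewrite /ray /= opprD addrACA subrr add0r -scalerBl addrK [h *: (1 : R)]mulr1.
have [dr Er] := Dr.
have dF : differentiable (t ^~ v) (ray (s, x)).
  exact: (class_C1_differentiable (f := t ^~ v) oB (Br : B (ray (s, x))) (mt.2 v 1%N)).
have [d2 D2] := is_derive_comp (F := t ^~ v) (G := fun u => ray (u, x)) dF dr.
have d1 : derivable (fun u : R => u ^+ r.+1) s 1 by exact: exprn_derivable.
apply: DeriveDef; first exact: (derivableM d1 d2).
rewrite (derive_ptM d1 d2) D2 Er; congr (_ * _ + _).
by rewrite (exp_derive r.+1 s (1 : R)) /= [_ *: (1 : R)]mulr1.
Qed.

Lemma Poincare_lemma r (t : form r.+1) : is_form B t -> eqon B (ld t) (fun _ _ => 0) ->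
  eqon B (ld (homotopy_op x0 t)) t.
Proof.
move=> ft dt x Bx v; rewrite -(homotopy ft Bx v) -[LHS]addr0; congr (_ + _).
by rewrite /homotopy_op -[LHS]I01_0; apply: I01_eq => s sI; rewrite dt ?mulr0 //; apply: star.
Qed.

End Poincare.

Lemma lpull_homotopy_op (R : realType) m e N (x0 : 'M[R]_(N.+1, m)) r (t : lform R m e r.+1) :
  homotopy_op x0 (lpull t) = lpull (homotopy_op (crd_proj e x0) t).
Proof.
apply/funext => x; apply/funext => v; rewrite /homotopy_op /lpull; congr I01; apply/funext => s.
have lp := @crd_proj_linear R m N e.
have E2 : crd_proj e (x - x0) = crd_proj e x - crd_proj e x0.
  by rewrite -scaleN1r addrC lp scaleN1r addrC.
have E1 : crd_proj e (x0 + s *: (x - x0)) = crd_proj e x0 + s *: (crd_proj e x - crd_proj e x0).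
  by rewrite addrC lp E2 addrC.
rewrite E1; congr (_ * t _ _); apply/funext => i.
by case: (unliftP ord0 i) => [j|] ->; rewrite ?fconsS ?fcons0.
Qed.

(** * Solution in one chart *)

Section Differences.
#[local] Opaque derive.
Context {R : realType} {m N : nat}.
Local Notation form := (lform R m N).
Variables (B : set 'M[R]_(N.+1, m)) (oB : open B).

Definition fsub r (t u : form r) : form r := fadd t (fscale (-1) u).

Lemma fsubE r (t u : form r) x v : fsub t u x v = t x v - u x v.
Proof. by rewrite /fsub /fadd /fscale mulN1r. Qed.

Lemma is_form_sub r (t u : form r) : is_form B t -> is_form B u -> is_form B (fsub t u).
Proof. by move=> ft fu; apply: is_form_add => //; apply: is_form_scale. Qed.

Lemma eqon_sub r (t u t' u' : form r) : eqon B t t' -> eqon B u u' -> eqon B (fsub t u) (fsub t' u').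
Proof. by move=> tt uu; apply: eqon_add => //; apply: eqon_scale. Qed.

Lemma lie_sub r f (t u : form r) : is_form B t -> is_form B u ->
  eqon B (lie f (fsub t u)) (fsub (lie f t) (lie f u)).
Proof.
move=> ft fu; apply: eqon_trans (lie_add _ ft.1 (is_form_scale oB _ fu).1) _.
by apply: eqon_add => //; apply: lie_scale; exact: fu.1.
Qed.

Lemma ld_sub r (t u : form r) : is_form B t -> is_form B u ->
  eqon B (ld (fsub t u)) (fsub (ld t) (ld u)).
Proof.
move=> ft fu; apply: eqon_trans (ld_add ft.1 (is_form_scale oB _ fu).1) _.
by apply: eqon_add => //; apply: ld_scale; exact: fu.1.
Qed.

Lemma lP_trunc_sub r M (t u : form r) : is_form B t -> is_form B u ->
  eqon B (lP_trunc M (fsub t u)) (fsub (lP_trunc M t) (lP_trunc M u)).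
Proof.
move=> ft fu; apply: eqon_trans (lP_trunc_add oB _ ft (is_form_scale oB _ fu)) _.
by apply: eqon_add => //; apply: lP_trunc_scale.
Qed.

Lemma lS_sub r (t u : form r) : eqon B (lS (fsub t u)) (fsub (lS t) (lS u)).
Proof.
apply: eqon_trans (lS_add _ _) _.
by apply: eqon_add => //; apply: lS_scale.
Qed.

Lemma lie_zero r f (x : 'M[R]_(N.+1, m)) v : lie f ((fun _ _ => 0) : form r) x v = 0.
Proof.
rewrite /lie /lmap big1 // addr0; exact: (derive_cst (0 : R)).
Qed.

Lemma dT_iter_zero r p (t : form r) : eqon B t (fun _ _ => 0) ->
  eqon B (iter p (lie (@shift_field R m N)) t) (fun _ _ => 0).
Proof.
move=> t0; elim: p => //= p IH; apply: eqon_trans (eqon_lie oB _ IH) _ => x Bx v.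
exact: lie_zero.
Qed.

Lemma lS_zero r (t : form r) : eqon B t (fun _ _ => 0) -> eqon B (lS t) (fun _ _ => 0).
Proof. by move=> t0; apply: eqon_trans (eqon_lS t0) _ => x Bx v; rewrite /lS big1. Qed.

Lemma lP_trunc_S0 r M (t : form r) : eqon B (lS t) (fun _ _ => 0) -> eqon B (lP_trunc M t) (fun _ _ => 0).
Proof.
move=> t0 x Bx v; rewrite /lP_trunc big1 // => p _.
have H : eqon B (iter p.+1 (@lS R m N r) t) (fun _ _ => 0).
  by elim: (nat_of_ord p) => // q IH; rewrite iterS; apply: lS_zero.
by rewrite (dT_iter_zero p H) ?mulr0.
Qed.

(** Enough terms of P make the remainder of [lP_trunc_dT] vanish. *)
Lemma lP_trunc_dT_id r e M (t : form r) : (0 < r)%N -> (e < N)%N -> (r * e < M)%N -> pulled e t -> is_form B t ->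
  eqon B (lP_trunc M (lie (@shift_field R m N) t)) t.
Proof.
move=> r0 eN eM pt ft; apply: eqon_trans (lP_trunc_dT oB M r0 eN pt ft) _ => x Bx v.
have z := dT_iter_zero M (lS_nilp oB (ltnW eN) pt ft eM).
by rewrite /fadd /fscale z // mulr0 addr0.
Qed.

End Differences.

(** The coordinates of order above [k] are free. When k >= 1 and [A] consists of
    coordinates of non-degenerate jets, this is the coordinate image of the preimage of
    an open set; when k = 0 it also contains degenerate points. *)
Definition cylinder (R : realType) m k N (A : set 'M[R]_(k.+1, m)) : set 'M[R]_(N.+1, m) :=
  [set x | A (crd_proj k x)].

Section Cylinder.
#[local] Opaque derive.
Context {R : realType} {m k : nat} (A : set 'M[R]_(k.+1, m)) (oA : open A).

Lemma open_cylinder N : open (cylinder (N := N) A).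
Proof.
apply: (open_comp _ oA) => x _.
have [c _] := smooth_linear setT (@crd_proj_linear R m N k) 0%N; exact: c.
Qed.

Lemma is_form_lpull r N (t : lform R m k r) : is_form A t -> is_form (cylinder (N := N) A) (lpull t).
Proof.
move=> [[mt st] at_]; split; first split.
- move=> x Ax v i c a b; rewrite !updE /lpull !(upd_comp (@crd_proj R m N k)).
  by rewrite crd_proj_linear (multilinearP (mt _ Ax)).
- move=> v p; have sp := smooth_linear (cylinder A) (@crd_proj_linear R m N k).
  exact: (class_C_comp (F := t ^~ (fun i => crd_proj k (v i))) (G := @crd_proj R m N k) p (@open_cylinder N) oA (fun x Ax => Ax) (st _) sp).
- by move=> x Ax v i j ij vij; rewrite /lpull (at_ _ Ax _ i j) // vij.
Qed.

Lemma cylinder_proj N L x : (k <= N)%N -> cylinder (N := N) A (crd_proj N x) = cylinder (N := L) A x.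
Proof. by move=> kN; rewrite /cylinder /= crd_proj_proj. Qed.

Lemma eqon_lpull r N L (t u : lform R m N r) : (k <= N)%N -> eqon (cylinder A) t u ->
  eqon (cylinder (N := L) A) (lpull t) (lpull u).
Proof. by move=> kN tu x Ax v; rewrite /lpull tu // cylinder_proj. Qed.

(** Used upwards, [crd_proj] is a section of the projection: [inord] is 0 out of range,
    so that the new rows repeat the first one. *)
Lemma star_cylinder N x0 : (k <= N)%N ->
  (forall (s : R) x, 0 <= s <= 1 -> A x -> A (x0 + s *: (x - x0))) ->
  forall (s : R) x, 0 <= s <= 1 -> cylinder (N := N) A x ->
     cylinder A (crd_proj N x0 + s *: (x - crd_proj N x0)).
Proof.
move=> kN st s x sI Ax; rewrite /cylinder /=.
have lp := @crd_proj_linear R m N k.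
have E0 : crd_proj k (crd_proj N x0) = x0 by rewrite crd_proj_proj // crd_proj_id.
have -> : crd_proj k (crd_proj N x0 + s *: (x - crd_proj N x0)) = x0 + s *: (crd_proj k x - x0).
  rewrite addrC lp E0 addrC; congr (_ + s *: _).
  by rewrite -scaleN1r addrC lp E0 scaleN1r addrC.
exact: st.
Qed.

End Cylinder.

Section LocalSolution.
#[local] Opaque derive.
Context {R : realType} {m k r : nat} (A : set 'M[R]_(k.+1, m)) (oA : open A).
Variables (x0 : 'M[R]_(k.+1, m)) (theta : lform R m k r.+1).
Hypothesis (star : forall (s : R) x, 0 <= s <= 1 -> A x -> A (x0 + s *: (x - x0))).
Hypotheses (ftheta : is_form A theta) (Stheta : eqon A (lS theta) (fun _ _ => 0)).

Definition solution l (psi : lform R m l r) : Prop :=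
  [/\ (k <= l)%N, is_form (cylinder A) psi,
      (0 < r)%N -> eqon (cylinder A) (lS psi) (fun _ _ => 0) &
      forall L, (delta_order l r <= L)%N ->
        eqon (cylinder (N := L) A) (lpull (ldelta psi)) (lpull theta)].

Local Notation X := (lie (@shift_field R m _)).

(** With phi = P d theta, the hypothesis reads d theta = d_T phi. Then P d_T d phi = P d
    d theta = 0, so d phi = 0 and phi = d chi; now theta - d_T chi is closed and has the
    primitive psi0. *)
Lemma local_potentials :
  eqon (cylinder (N := delta_order k r.+1) A) (ldelta theta) (fun _ _ => 0) ->
  exists (e : nat) (N0 : nat) (chi : lform R m e r.+1) (psi0 : lform R m N0 r),
    [/\ (k <= e < N0)%N, is_form (cylinder (N := N0) A) (lpull chi), is_form (cylinder A) psi0 &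
        eqon (cylinder (N := N0) A) (ld psi0) (fsub (lpull theta) (X (lpull chi)))].
Proof.
set N0 := delta_order k r.+1 => dtheta.
pose e := (r.+2 * k + k)%N; pose M := (r.+2 * k)%N.
have eN : (e < N0)%N by [].
have ke : (k <= e)%N by rewrite /e; lia.
have kN : (k <= N0)%N by lia.
pose B := cylinder (N := N0) A; have oB : open B := @open_cylinder _ _ _ _ oA N0.
pose th : lform R m N0 r.+1 := lpull theta.
have fth : is_form B th by apply: is_form_lpull.
have fdth := is_form_ld oB fth.
pose phi := lP_trunc M (ld th).
have fphi : is_form B phi by apply: is_form_lP_trunc.
have pphi : pulled e phi.
  by apply: pulled_lP_trunc; [rewrite /M; lia|apply: pulled_ld; exists theta].
have dth : eqon B (ld th) (X phi).
  move=> x Bx v; have := dtheta x Bx v.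
  have := lpull_ldelta theta (leqnn N0); rewrite lpull_id => -> /eqP.
  by rewrite subr_eq0 => /eqP.
have dphi : eqon B (ld phi) (fun _ _ => 0).
  have fdphi := is_form_ld oB fphi.
  apply: eqon_trans (eqon_sym (lP_trunc_dT_id oB (M := (r.+3 * e).+1) _ eN _ (pulled_ld pphi) fdphi)) _ => //.
  have z : eqon B (X (ld phi)) (fun _ _ => 0).
    apply: eqon_trans (eqon_sym (ld_lie oB (@shift_field_linear R m N0) fphi)) _.
    apply: eqon_trans (eqon_ld oB (eqon_sym dth)) _; exact: ld_ld.
  by apply: lP_trunc_S0 => //; apply: lS_zero.
pose b0 : 'M[R]_(N0.+1, m) := crd_proj N0 x0.
have starB := star_cylinder (N := N0) kN star.
pose chi := homotopy_op b0 phi.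
have fchi : is_form B chi by apply: is_form_homotopy_op.
have dchi : eqon B (ld chi) phi by apply: Poincare_lemma.
have [phi0 Ephi] := pphi.
pose chi0 := homotopy_op (crd_proj e b0) phi0.
have Echi : chi = lpull chi0 by rewrite /chi Ephi lpull_homotopy_op.
pose eta := fsub th (X chi).
have fXchi : is_form B (X chi) by apply: is_form_dT.
have feta : is_form B eta by apply: is_form_sub.
have deta : eqon B (ld eta) (fun _ _ => 0).
  apply: eqon_trans (ld_sub oB fth fXchi) _.
  have E1 : eqon B (ld (X chi)) (X phi).
    apply: eqon_trans (ld_lie oB (@shift_field_linear R m N0) fchi) _; exact: eqon_lie.
  by move=> x Bx v; rewrite fsubE dth // E1 // subrr.
exists e, N0, chi0, (homotopy_op b0 eta); split; first by rewrite ke.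
- by rewrite -Echi.
- exact: is_form_homotopy_op.
- have -> : X (lpull chi0) = X chi by rewrite Echi.
  exact: Poincare_lemma.
Qed.

(** The solution is psi0 - d_T P psi0. It is annihilated by S because of
    [lS_dT_lP_trunc]; its differential is theta - d_T chi - d_T d P psi0, which P maps
    to - chi - d P psi0 since P theta = 0. *)
Lemma local_solution :
  eqon (cylinder (N := delta_order k r.+1) A) (ldelta theta) (fun _ _ => 0) ->
  exists l (psi : lform R m l r), solution psi.
Proof.
move=> /local_potentials[e [N0 [chi [psi0 [/andP[ke eN0] fchi fpsi0 dpsi0]]]]].
have kN0 : (k <= N0)%N by lia.
have lift_form N r' (t : lform R m N0 r') : (k <= N0)%N -> is_form (cylinder A) t -> is_form (cylinder (N := N) A) (lpull t).
  move=> kN ft.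
  have -> : cylinder (N := N) A = cylinder (cylinder (N := N0) A).
    by apply/funext => x; rewrite [RHS]cylinder_proj.
  by apply: is_form_lpull => //; exact: open_cylinder.
pose M := (r * N0)%N; pose l := (M + N0).+1.
pose low L : lform R m L r := lpull psi0.
pose sol L := fsub (low L) (X (lP_trunc M (low L))).
have flow L : is_form (cylinder (N := L) A) (low L) by apply: lift_form.
have fP L : is_form (cylinder (N := L) A) (lP_trunc M (low L)) by apply: is_form_lP_trunc => //; exact: open_cylinder.
have fXP L : is_form (cylinder (N := L) A) (X (lP_trunc M (low L))) by apply: is_form_dT => //; exact: open_cylinder.
have fsol L : is_form (cylinder (N := L) A) (sol L) by apply: is_form_sub => //; exact: open_cylinder.
pose psi : lform R m l r := fsub (lpull psi0) (ldT (lP psi0)).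
have Epsi L : (l <= L)%N -> lpull (l := L) psi = sol L.
  move=> lL; rewrite /sol /low.
  rewrite -[LHS]/(fsub (lpull (l := L) (lpull (l := l) psi0)) (lpull (l := L) (ldT (lP psi0)))).
  by rewrite lpull_lpull ?lpull_dT ?lpull_lP //; rewrite /l /M in lL *; lia.
have Epsil : psi = sol l by rewrite -(Epsi l (leqnn l)) lpull_id.
exists l, psi; split.
- by rewrite /l; lia.
- by rewrite Epsil.
- move=> r0; rewrite Epsil.
  apply: eqon_trans (lS_sub _ _) _ => x Bx v; rewrite fsubE.
  have plow : pulled N0 (low l) by exists psi0.
  have ol := @open_cylinder _ _ _ _ oA l.
  have Ml : (N0 + M <= l)%N by rewrite /l; lia.
  rewrite (lS_dT_lP_trunc ol r0 Ml plow (flow l) Bx).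
  have n0 : (N0 <= l)%N by rewrite /l; lia.
  have z := dT_iter_zero ol M (lS_nilp ol (p := M.+1) n0 plow (flow l) (ltnSn _)).
  by rewrite /fadd /fscale z // mulr0 addr0 subrr.
- move=> L lL.
  have l_lt : (l < L)%N by move: lL; rewrite /delta_order; lia.
  have oL := @open_cylinder _ _ _ _ oA L.
  rewrite (lpull_ldelta psi lL) (Epsi L (ltnW l_lt)).
  set B := cylinder A; pose M1 := (r.+1 * l)%N.
  pose thL : lform R m L r.+1 := lpull theta; pose chiL : lform R m L r.+1 := lpull chi.
  pose w := ld (lP_trunc M (low L)).
  have fw : is_form B w by apply: is_form_ld.
  have pw : pulled (M + N0) w.
    by apply/pulled_ld/pulled_lP_trunc; [rewrite /l in l_lt; lia|exists psi0].
  have fth : is_form B thL by apply: is_form_lpull.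
  have fchiL : is_form B chiL.
    have -> : chiL = lpull (l := L) (lpull (l := N0) chi) by rewrite lpull_lpull // ltnW.
    exact: lift_form.
  have dlow : eqon B (ld (low L)) (fsub thL (X chiL)).
    rewrite /low -lpull_ld.
    have -> : fsub thL (X chiL) = lpull (l := L) (fsub (lpull theta) (X (lpull (l := N0) chi))).
      rewrite -[RHS]/(fsub (lpull (l := L) (lpull (l := N0) theta)) (lpull (l := L) (X (lpull (l := N0) chi)))).
      rewrite lpull_lpull // -lpull_dT // lpull_lpull // lpull_dT //.
      by rewrite /l in l_lt; lia.
    exact: (eqon_lpull (A := A) kN0).
  have fXchi : is_form B (X chiL) by apply: is_form_dT.
  have fXw : is_form B (X w) by apply: is_form_dT.
  have dsol : eqon B (ld (sol L)) (fsub (fsub thL (X chiL)) (X w)).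
    apply: eqon_trans (ld_sub oL (flow L) (fXP L)) _; apply: (eqon_sub dlow).
    exact: (ld_lie oL (@shift_field_linear R m L)).
  have Pdsol : eqon B (lP_trunc M1 (ld (sol L))) (fsub (fsub (fun _ _ => 0) chiL) w).
    apply: eqon_trans (eqon_lP_trunc oL M1 dsol) _.
    apply: eqon_trans (lP_trunc_sub oL M1 (is_form_sub oL fth fXchi) fXw) _; apply: eqon_sub.
      apply: eqon_trans (lP_trunc_sub oL M1 fth fXchi) _; apply: eqon_sub.
        apply: lP_trunc_S0 => //; rewrite /thL -lpull_lS; last by lia.
        by move=> x Bx v; rewrite /lpull Stheta.
      apply: (lP_trunc_dT_id oL (e := e)) => //; [by lia| |by exists chi].
      by rewrite /M1 /l ltn_mul2l /=; lia.
    apply: (lP_trunc_dT_id oL (e := M + N0)) => //; first by rewrite /l in l_lt; lia.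
    by rewrite /M1 /l ltn_mul2l /=; lia.
  move=> x Bx v; rewrite -/M1 (eqon_lie oL _ Pdsol Bx) dsol //.
  have f0 := is_form_0 B r.+1.
  rewrite (lie_sub oL _ (is_form_sub oL f0 fchiL) fw Bx) !fsubE.
  rewrite (lie_sub oL _ f0 fchiL Bx) fsubE lie_zero -/thL; ring.
Qed.

(** In order 0 the operator P has no terms and S vanishes, so that a primitive of
    [theta] is a solution. *)
Lemma local_solution_order0 : k = 0%N -> eqon A (ld theta) (fun _ _ => 0) ->
  exists l (psi : lform R m l r), solution psi.
Proof.
move=> k0 dtheta; exists k, (homotopy_op x0 theta).
have over_id : cylinder (N := k) A = A by apply/funext => x; rewrite /cylinder /= crd_proj_id.
have fK : is_form A (homotopy_op x0 theta) by apply: is_form_homotopy_op.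
split=> //; first by rewrite over_id.
- move=> _ x Ax v; rewrite over_id in Ax; rewrite /lS big1 // => i _; rewrite updE.
  have -> : vert_endo (v i) = 0.
    apply/matrixP => p j; rewrite !mxE; have := ltn_ord p; rewrite {2}k0 ltnS leqn0 => /eqP ->.
    by rewrite mul0r.
  by apply: multilinear0; apply: fK.1.1.
- move=> L kL x Ax v; rewrite (lpull_ldelta _ kL) -lpull_ld.
  have -> : lP_trunc (r.+1 * k) (lpull (l := L) (ld (homotopy_op x0 theta))) = fun _ _ => 0.
    have -> : (r.+1 * k = 0)%N by rewrite k0 muln0.
    by apply/funext => y; apply/funext => u; rewrite /lP_trunc big_ord0.
  rewrite lie_zero subr0 /lpull.
  exact: (Poincare_lemma oA star ftheta dtheta Ax).
Qed.

End LocalSolution.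

(** * Naturality under prolonged changes of coordinates *)

Section MxDerive.
#[local] Opaque derive.
Context {R : realType} {V : normedModType R} {a b : nat}.
Variables (D : set V) (T : V -> 'M[R]_(a, b)).
Hypotheses (oD : open D) (sT : smooth_on D T).

Lemma smooth_entry i j : smooth_on D (fun y => T y i j).
Proof. by move=> p; apply: (iffLR (class_C_mxP _ _ oD)); exact: sT. Qed.

Lemma derive_entry v x i j : D x -> 'D_v T x i j = 'D_v (fun y => T y i j) x.
Proof. by move=> Dx; rewrite (derive_mx (smooth_derivable (v := v) sT Dx)) mxE. Qed.

Lemma derive_entry2 u v x i j : D x -> 'D_u ('D_v T) x i j = 'D_u ('D_v (fun y => T y i j)) x.
Proof.
move=> Dx; rewrite (derive_mx (smooth_derivable (v := u) (smooth_D v sT) Dx)) mxE.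
by apply: near_eq_derive; apply: filterS (near_in oD Dx) => y Dy; rewrite derive_entry.
Qed.

Lemma derive_dir_linear_mx x (c : R) u v : D x -> 'D_(c *: u + v) T x = c *: 'D_u T x + 'D_v T x.
Proof.
move=> Dx; apply/matrixP => i j; rewrite derive_entry // !mxE !derive_entry //.
exact: (derive_dir_linear _ _ _ oD Dx (smooth_entry i j 1%N)).
Qed.

Lemma schwarz_mx x u v : D x -> 'D_u ('D_v T) x = 'D_v ('D_u T) x.
Proof.
move=> Dx; apply/matrixP => i j.
have S : 'D_u ('D_v (fun y => T y i j)) x = 'D_v ('D_u (fun y => T y i j)) x.
  exact: (schwarz u v oD Dx (smooth_entry i j 2%N)).
exact: (etrans (derive_entry2 u v i j Dx) (etrans S (esym (derive_entry2 v u i j Dx)))).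
Qed.

End MxDerive.

Section Pull.
#[local] Opaque derive.
Context {R : realType} {m N : nat}.
Local Notation V := 'M[R]_(N.+1, m).
Local Notation form := (lform R m N).
Variables (D B : set V) (T : V -> V).

Definition fpull r (t : form r) : form r := fun x v => t (T x) (fun i => 'D_(v i) T x).

(** What makes a change of coordinates compatible with S and d_T. *)
Definition prolonged : Prop :=
  [/\ smooth_on D T,
      forall x v, D x -> 'D_(vert_endo v) T x = vert_endo ('D_v T x) &
      forall x (p : 'I_N.+1) j, D x -> (p < N)%N ->
        T x (inord p.+1) j = 'D_(shift_field x) (fun y => T y p j) x].

Hypotheses (oD : open D) (oB : open B) (DB : forall x, D x -> B (T x)) (pT : prolonged).
Let sT : smooth_on D T. Proof. by case: pT. Qed.
Local Notation X := (lie (@shift_field R m N)).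

Lemma fpull_upd r (t : form r) x v i y :
  fpull t x (upd v i y) = t (T x) (upd (fun j => 'D_(v j) T x) i ('D_y T x)).
Proof. by rewrite /fpull -(upd_comp (fun u => 'D_u T x)). Qed.

Lemma is_form_fpull r (t : form r) : is_form B t -> is_form D (fpull t).
Proof.
move=> [mt at_]; split; first split.
- move=> x Dx v i c a b; rewrite !updE !fpull_upd (derive_dir_linear_mx oD sT _ _ _ Dx).
  exact: (multilinearP (mt.1 _ (DB Dx))).
- move=> v; exact: (form_comp oD oB mt DB sT (fun i => smooth_D (v i) sT)).1.
- move=> x Dx v i j ij vij; rewrite /fpull; apply: (at_ _ (DB Dx) _ i j ij).
  by rewrite vij.
Qed.

Lemma fpull_derive r (t : form r) v u x : mform B t -> D x ->
  'D_u (fpull t ^~ v) x = 'D_('D_u T x) (t ^~ (fun i => 'D_(v i) T x)) (T x)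
     + \sum_i t (T x) (upd (fun i => 'D_(v i) T x) i ('D_u ('D_(v i) T) x)).
Proof.
move=> mt Dx; exact: ((form_comp oD oB mt DB sT (fun i => smooth_D (v i) sT)).2 x u Dx).
Qed.

(** The terms with second derivatives of [T] cancel by symmetry. *)
Lemma fpull_ld r (t : form r) : is_form B t -> eqon D (ld (fpull t)) (fpull (ld t)).
Proof.
move=> [mt at_] x Dx v; rewrite {1}/ld.
have E (i : 'I_r.+1) : 'D_(v i) (fun y => fpull t y (fun j => v (lift i j))) x = _ :=
  fpull_derive (fun j => v (lift i j)) (v i) mt Dx.
under eq_bigr => i _ do rewrite E mulrDr.
rewrite big_split /= -[RHS]addr0; congr (_ + _).
case: r t mt at_ v {E} => [|r] t mt at_ v.
  by rewrite big1 // => i _; rewrite big_ord0 mulr0.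
pose G a b w := t (T x) (fcons ('D_(v a) ('D_(v b) T) x) w).
have symG a b w : G a b w = G b a w by rewrite /G (schwarz_mx oD sT).
rewrite -[RHS](double_sum0 (fun i => 'D_(v i) T x) symG); apply: eq_bigr => i _.
rewrite mulr_sumr; apply: eq_bigr => j _.
rewrite (move_front _ j (mt.1 _ (DB Dx)) (at_ _ (DB Dx))) upd_same mulrA -exprD /G.
by rewrite upd_lift_same.
Qed.

Lemma fpull_lS r (t : form r) : eqon D (lS (fpull t)) (fpull (lS t)).
Proof.
move=> x Dx v; rewrite /lS {2}/fpull; apply: eq_bigr => i _; rewrite !updE fpull_upd.
by have [_ HS _] := pT; rewrite HS.
Qed.

(** The last condition of [prolonged], for points and, after differentiation, for
    tangent vectors, says that [T] maps the field [shift_field] to itself in all rows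
    below the top one. *)
Lemma fpull_dT r e (t : form r) : (e < N)%N -> pulled e t -> is_form B t ->
  eqon D (X (fpull t)) (fpull (X t)).
Proof.
move=> eN [t0 Et] [[mt st] _] x Dx v; rewrite {1}/lie (fpull_derive v (shift_field x) (conj mt st) Dx) [in RHS]/fpull [in RHS]/lie -addrA.
set w := fun i => 'D_(v i) T x.
have [_ _ HX] := pT.
have proj_eq (y z : V) : (forall (p : 'I_N.+1) j, (p < N)%N -> y p j = z p j) -> crd_proj e y = crd_proj e z.
  move=> yz; apply/matrixP => p j; rewrite !mxE; apply: yz; rewrite inordK; have := ltn_ord p; lia.
have E1 (y : V) : D y -> forall (p : 'I_N.+1) j, (p < N)%N -> shift_field (T y) p j = 'D_(shift_field y) (fun z => T z p j) y.
  by move=> Dy p j pN; rewrite mxE pN HX.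
congr (_ + _).
  rewrite Et.
  have E z : 'D_z (lpull t0 ^~ w) (T x) = 'D_(crd_proj e z) (t0 ^~ (fun i => crd_proj e (w i))) (crd_proj e (T x)).
    exact: (derive_comp_linear (fun y => t0 y (fun i => crd_proj e (w i))) (T x) z (@crd_proj_linear R m N e)).
  rewrite !E; congr ('D_ _ _ _); apply: proj_eq => p j pN.
  by rewrite (derive_entry sT _ _ _ Dx) E1.
rewrite /lmap -big_split /=; apply: eq_bigr => i _.
rewrite fpull_upd -/w -(multilinearD _ _ _ _ (mt _ (DB Dx))) Et /lpull.
rewrite !(upd_comp (@crd_proj R m N e)); congr (t0 _ (upd _ _ _)); apply: proj_eq => p j pN.
rewrite mxE (derive_entry2 oD sT (shift_field x) (v i) p j Dx) (derive_entry sT (shift_field (v i)) p j Dx).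
have [_ DA] := derive_along oD (@shift_field_linear R m N) (smooth_entry oD sT p j).
rewrite -(DA x (v i) Dx).
have -> : 'D_(v i) (fun y => 'D_(shift_field y) (fun y => T y p j) y) x = 'D_(v i) (fun y => T y (inord p.+1) j) x.
  by apply: near_eq_derive; apply: filterS (near_in oD Dx) => y Dy; rewrite HX.
by rewrite -(derive_entry sT (v i) _ _ Dx) mxE pN.
Qed.

Lemma fpull_dT_iter r e p (t : form r) : (p + e <= N)%N -> pulled e t -> is_form B t ->
  eqon D (iter p X (fpull t)) (fpull (iter p X t)).
Proof.
move=> + pt ft; elim: p => // p IH pN.
have pN' : (p + e <= N)%N by lia.
rewrite iterS; apply: eqon_trans (eqon_lie oD _ (IH pN')) _.
apply: (fpull_dT (e := p + e)) => //; [exact: pulledX_iter|exact: is_form_dT_iter].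
Qed.

Lemma fpull_lS_iter r p (t : form r) : eqon D (iter p (@lS R m N r) (fpull t)) (fpull (iter p (@lS R m N r) t)).
Proof.
elim: p => // p IH; rewrite iterS; apply: eqon_trans (eqon_lS IH) _; exact: fpull_lS.
Qed.

Lemma fpull_lP_trunc r e M (t : form r) : (M + e <= N)%N -> pulled e t -> is_form B t ->
  eqon D (lP_trunc M (fpull t)) (fpull (lP_trunc M t)).
Proof.
move=> MN pt ft x Dx v; rewrite /fpull /lP_trunc; apply: eq_bigr => p _; congr (_ * _).
have eN : (e <= N)%N by lia.
rewrite (eqon_dT_iter oD p (fpull_lS_iter p.+1 t) Dx).
have pN : (p + e <= N)%N by have := ltn_ord p; lia.
have fS : is_form B (iter p.+1 (@lS R m N r) t) by apply: is_form_lS_iter.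
have pS : pulled e (iter p.+1 (@lS R m N r) t) by apply: pulledS_iter.
exact: (fpull_dT_iter pN pS fS Dx v).
Qed.

(** The operator delta at a common order, with [M] terms in P. *)
Definition ldelta_trunc r M (t : form r) : form r.+1 := fsub (ld t) (X (lP_trunc M (ld t))).

Lemma fpull_ldelta_trunc r e M (t : form r) : (M + e < N)%N -> pulled e t -> is_form B t ->
  eqon D (ldelta_trunc M (fpull t)) (fpull (ldelta_trunc M t)).
Proof.
move=> MN pt ft.
have fdt := is_form_ld oB ft.
have pd := pulled_ld pt.
have E1 := fpull_ld ft.
have E2 : eqon D (X (lP_trunc M (ld (fpull t)))) (fpull (X (lP_trunc M (ld t)))).
  apply: eqon_trans (eqon_lie oD _ (eqon_lP_trunc oD M E1)) _.
  apply: eqon_trans (eqon_lie oD _ (fpull_lP_trunc (ltnW MN) pd fdt)) _.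
  apply: (fpull_dT MN); [exact: pulled_lP_trunc (ltnW MN) pd|exact: is_form_lP_trunc].
by move=> x Dx v; rewrite /ldelta_trunc fsubE E1 // E2 // /fpull fsubE.
Qed.

End Pull.

(** * Prolongation of a change of coordinates *)

Section Prolongation.
Context {R : realType} {m N : nat}.
Local Notation V := 'M[R]_(N.+1, m).
Variables (F : 'rV[R]_m -> 'rV[R]_m) (O : set 'rV[R]_m).
Hypotheses (oO : open O) (sF : smooth_on O F).

(** The iterated total time derivatives of [F]: the p-th one gives the p-th derivative
    of the image of a curve under [F]. *)
Fixpoint prolong (p : nat) : V -> 'rV[R]_m :=
  match p with
  | 0 => fun x => F (row ord0 x)
  | q.+1 => fun x => 'D_(shift_field x) (prolong q) x
  end.

Definition prolongation (x : V) : V := \matrix_(p < N.+1, i < m) prolong p x ord0 i.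

Lemma prolong_dep p (x y : V) : (forall (q : 'I_N.+1) j, (q <= p)%N -> x q j = y q j) -> prolong p x = prolong p y.
Proof.
elim: p x y => [|p IH] x y xy.
  by rewrite /=; congr F; apply/rowP => j; rewrite !mxE; apply: xy.
have sxy (q : 'I_N.+1) j : (q <= p)%N -> shift_field x q j = shift_field y q j.
  by move=> qp; rewrite !mxE; case: ifP => // qN; apply: xy; rewrite inordK.
have pxy : prolong p x = prolong p y by apply: IH => q j qp; apply: xy; apply: leq_trans qp _.
rewrite /= /derive; set u := (X in lim (X @ _)); set w := (X in _ = lim (X @ _)).
suff -> : u = w by [].
apply/funext => h; rewrite /u /w /= pxy; congr (_ *: (_ - _)).
apply: IH => q j qp; rewrite [LHS]mxE [RHS]mxE (xy q j (leqW qp)); congr (_ + _).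
by rewrite [LHS]mxE [RHS]mxE sxy.
Qed.

Lemma prolong_derive_dep p (x u w : V) : (forall (q : 'I_N.+1) j, (q <= p)%N -> u q j = w q j) ->
  'D_u (prolong p) x = 'D_w (prolong p) x.
Proof.
move=> uw; rewrite /derive; set f := (X in lim (X @ _)); set g := (X in _ = lim (X @ _)).
suff -> : f = g by [].
apply/funext => h; rewrite /f /g /=; congr (_ *: (_ - _)).
by apply: prolong_dep => q j qp; rewrite [LHS]mxE [RHS]mxE [(_ *: u) q j]mxE [(_ *: w) q j]mxE uw.
Qed.

Definition prolong_dom : set V := [set x | O (row ord0 x)].

Lemma row_linear q : linear (row q : V -> 'rV[R]_m).
Proof. by move=> c x y; apply/rowP => j; rewrite !mxE. Qed.

Lemma open_prolong_dom : open prolong_dom.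
Proof.
apply: (open_comp _ oO) => x _.
have [c _] := smooth_linear setT (row_linear ord0) 0%N; exact: c.
Qed.

Lemma prolong_smooth p : smooth_on prolong_dom (prolong p).
Proof.
have oD := open_prolong_dom.
elim: p => [|p IH].
  exact: (smooth_comp_mx oD oO (fun x Ox => Ox) sF (smooth_linear prolong_dom (row_linear ord0))).
move=> q; apply/class_C_mxP => // i j.
have [s _] := derive_along oD (@shift_field_linear R m N) (smooth_entry oD IH i j).
apply: (class_C_eq oD _ (s q)) => x Dx.
by rewrite /= -(derive_entry IH (shift_field x) i j Dx).
Qed.

Let G p j : V -> R := fun y => prolong p y ord0 j.

(** Differentiating the recursion that defines [prolong] brings in the bracket
    [crd_proj_comm] of the two fields, which accounts for the increase of the factor p
    by one. *)
Lemma prolong_vert p x v j : (p <= N)%N -> prolong_dom x ->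
  'D_(vert_endo v) (G p j) x = p%:R * 'D_v (G p.-1 j) x.
Proof.
have oD := open_prolong_dom.
have sG q : smooth_on prolong_dom (G q j) by exact: smooth_entry oD (prolong_smooth q) ord0 j.
have GS q y : prolong_dom y -> G q.+1 j y = 'D_(shift_field y) (G q j) y.
  by move=> Dy; rewrite /G /= (derive_entry (prolong_smooth q)).
have dep q y (u w : V) : prolong_dom y -> (forall (s : 'I_N.+1) j, (s <= q)%N -> u s j = w s j) -> 'D_u (G q j) y = 'D_w (G q j) y.
  move=> Dy uw; rewrite -!(derive_entry (prolong_smooth q) _ _ _ Dy).
  by rewrite (prolong_derive_dep _ uw).
have DS q y (u : V) : prolong_dom y -> 'D_u (G q.+1 j) y = 'D_(shift_field y) ('D_u (G q j)) y + 'D_(shift_field u) (G q j) y.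
  move=> Dy; have [_ <- //] := derive_along oD (@shift_field_linear R m N) (sG q).
  by apply: near_eq_derive; apply: filterS (near_in oD Dy) => z Dz; rewrite GS.
elim: p x v => [|p IH] x v pN Dx.
  rewrite mul0r -(derive0 (G 0 j) x); apply: dep => // s i.
  by rewrite leqn0 => /eqP s0; rewrite !mxE s0 mul0r.
have pN' : (p <= N)%N by exact: ltnW.
rewrite DS //=.
have -> : 'D_(shift_field x) ('D_(vert_endo v) (G p j)) x = p%:R * 'D_(shift_field x) ('D_v (G p.-1 j)) x.
  rewrite -derive_ptZ; last exact: (smooth_derivable (smooth_D v (sG _)) Dx).
  by apply: near_eq_derive; apply: filterS (near_in oD Dx) => y Dy; rewrite IH.
have -> : 'D_(shift_field (vert_endo v)) (G p j) x = p%:R * 'D_(shift_field v) (G p.-1 j) x + 'D_v (G p j) x.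
  rewrite -IH // -[X in X + _]mul1r -(derive_dir_linear _ _ _ oD Dx (sG p 1%N)) scale1r.
  apply: dep => // s i sp.
  have sN : (s < N)%N by lia.
  have := congr1 (fun z : 'M[R]_(s.+1, m) => z ord_max i) (crd_proj_comm v sN).
  by rewrite !mxE /= inord_val => /eqP; rewrite subr_eq addrC => /eqP.
case: p {IH} pN pN' => [|p] pN pN' /=; first by rewrite !mul0r !add0r mul1r.
rewrite addrA -mulrDr -DS // -(addn1 p.+1) natrD; ring.
Qed.

Lemma prolonged_prolongation : prolonged prolong_dom prolongation.
Proof.
have oD := open_prolong_dom.
have TE p i : (fun y => prolongation y p i) = G p i by apply/funext => y; rewrite mxE.
have sT : smooth_on prolong_dom prolongation.
  move=> q; apply/class_C_mxP => // p i; rewrite TE.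
  exact: (smooth_entry oD (prolong_smooth p) ord0 i).
split=> // [x v Dx|x p j Dx pN].
  apply/matrixP => p i; rewrite (derive_entry sT _ _ _ Dx) mxE (derive_entry sT _ _ _ Dx) !TE.
  rewrite prolong_vert //; last by have := ltn_ord p; rewrite ltnS.
  by rewrite inordK //; have := ltn_ord p; lia.
by rewrite mxE TE inordK //= (derive_entry (prolong_smooth p) _ _ _ Dx).
Qed.

(** The curve of all derivatives of g moves, up to its top row, along the field
    [shift_field]; so the chain rule turns a derivative in time into a total time
    derivative. *)
Lemma prolong_curve (e : R) (f g : R -> 'rV[R]_m) :
  smooth_on (ball (0 : R) e) g -> (forall t, ball (0 : R) e t -> O (g t) /\ f t = F (g t)) ->
  forall p, (p <= N)%N -> forall t, ball (0 : R) e t ->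
    derive1n p f t = prolong p (\matrix_(q < N.+1, i < m) derive1n q g t ord0 i).
Proof.
move=> sg fF; set U := ball _ _ in sg fF *.
have oU : open U by exact: ball_open.
have sgn q : smooth_on U (derive1n q g).
  elim: q => [|q IH]; first by rewrite derive1n0.
  rewrite derive1nS.
  have -> : (derive1n q g)^`()%classic = 'D_1 (derive1n q g) by apply/funext => t; rewrite derive1E.
  exact: smooth_D.
pose Gm t : V := \matrix_(q < N.+1, i < m) derive1n q g t ord0 i.
have sGm : smooth_on U Gm.
  move=> q; apply/class_C_mxP => // p i.
  have -> : (fun y => Gm y p i) = (fun t => derive1n p g t ord0 i) by apply/funext => t; rewrite mxE.
  exact: (smooth_entry oU (sgn p) ord0 i).
have rowGm t : row ord0 (Gm t) = g t by apply/rowP => i; rewrite !mxE derive1n0.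
elim=> [|p IH] pN t Ut.
  by rewrite derive1n0 /= rowGm (fF t Ut).2.
have pN' : (p <= N)%N by exact: ltnW.
rewrite derive1nS derive1E.
have -> : 'D_1 (derive1n p f) t = 'D_1 (fun s => prolong p (Gm s)) t.
  by apply: near_eq_derive; apply: filterS (near_in oU Ut) => s Us; rewrite IH.
have Dt : prolong_dom (Gm t) by rewrite /prolong_dom /= rowGm; exact: (fF t Ut).1.
have [_ ->] := is_derive_comp_mx (v := (1 : R)) open_prolong_dom Dt (prolong_smooth p) (smooth_derivable sGm Ut).
rewrite /=; apply: prolong_derive_dep => q i qp.
have qN : (q < N)%N by lia.
rewrite (derive_entry sGm _ _ _ Ut) [RHS]mxE qN mxE inordK //.
have -> : (fun y => Gm y q i) = (fun t => derive1n q g t ord0 i) by apply/funext => s; rewrite mxE.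
by rewrite -(derive_entry (sgn q) _ _ _ Ut) derive1nS derive1E.
Qed.

End Prolongation.

Section PolyCurve.
Context {R : realType} {m : nat}.

Definition polynomial_curve n (w : nat -> 'rV[R]_m) (t : R) : 'rV[R]_m :=
  \sum_(q < n) (t ^+ q / q`!%:R) *: w q.

Lemma polynomial_curve_smooth n w (A : set R) : open A -> smooth_on A (polynomial_curve n w).
Proof.
move=> oA p; apply/class_C_mxP => // i j.
apply: (class_C_eq oA (f := fun t : R => \sum_(q < n) (t ^+ q * (q`!%:R^-1 * w q i j)))).
  by move=> t _; rewrite summxE; apply: eq_bigr => q _; rewrite !mxE mulrA.
apply: class_C_sum => // q _; apply: class_C_mul => //; last exact: class_C_cst.
elim: (nat_of_ord q) => [|s IH]; first exact: class_C_cst.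
apply: (class_C_eq oA (f := fun t : R => t * t ^+ s)) => [t _|]; first by rewrite exprS.
apply: class_C_mul => //; apply: smooth_continuous_linear => // t; exact: cvg_id.
Qed.

Lemma polynomial_curve_derive n w : (polynomial_curve n w)^`()%classic = polynomial_curve n.-1 (fun q => w q.+1).
Proof.
apply/funext => t; rewrite derive1E; apply/matrixP => i j.
have s := polynomial_curve_smooth n w (openT : open [set: R]).
rewrite (derive_entry s) // /polynomial_curve.
have -> : (fun y : R => (\sum_(q < n) (y ^+ q / q`!%:R) *: w q) i j) = (fun y => \sum_(q < n) (q`!%:R^-1 * w q i j) * y ^+ q).
  by apply/funext => y; rewrite summxE; apply: eq_bigr => q _; rewrite mxE; ring.
rewrite derive_lincomb => [|q]; last exact: exprn_derivable.
rewrite summxE; case: n {s} => [|n] /=; first by rewrite !big_ord0.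
rewrite big_ord_recl [X in X + _](_ : _ = 0) ?add0r; last first.
  by rewrite exp_derive /= !scale0r mulr0.
apply: eq_bigr => q _; rewrite exp_derive lift0 /= !mxE /GRing.scale /= mulr1 factS natrM.
have q1 : (q.+1%:R : R) != 0 by rewrite pnatr_eq0.
have f1 : (q`!%:R : R) != 0 by rewrite pnatr_eq0 -lt0n fact_gt0.
move: q1 f1; move: (q.+1%:R : R) (q`!%:R : R) => a b a0 b0.
by field; rewrite a0 b0.
Qed.

Lemma polynomial_curve_derive1n n w p : derive1n p (polynomial_curve n w) = polynomial_curve (n - p) (fun q => w (q + p)%N).
Proof.
elim: p n w => [|p IH] n w; first by rewrite derive1n0 subn0; congr polynomial_curve; apply/funext => q; rewrite addn0.
rewrite derive1Sn polynomial_curve_derive IH -subn1 -subnDA add1n; congr polynomial_curve.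
by apply/funext => q; rewrite addnS.
Qed.

Lemma polynomial_curve_jet n w p : (p < n)%N -> derive1n p (polynomial_curve n w) 0 = w p.
Proof.
move=> pn; rewrite polynomial_curve_derive1n /polynomial_curve; have [k ->] : exists k, (n - p = k.+1)%N.
  by exists (n - p).-1; rewrite prednK // subn_gt0.
rewrite big_ord_recl big1 ?addr0 => [|q _]; last by rewrite lift0 expr0n /= mul0r scale0r.
by rewrite expr0 fact0 divr1 scale1r add0n.
Qed.

End PolyCurve.

(** * Jets and their coordinates *)

Section Jets.
Context {R : realType} {m : nat} {E : manifold R m}.
Implicit Types (a b d : chart E) (c : R -> E).

Definition overlap a b : set 'rV[R]_m := crd a @` (dom a `&` dom b).
Definition change a b : 'rV[R]_m -> 'rV[R]_m := crd b \o inv_crd a.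

Lemma change_smooth a b : smooth_on (overlap a b) (change a b).
Proof. exact: crd_smooth. Qed.

Lemma overlapP a b y : overlap a b y <-> (crd a @` dom a) y /\ dom b (inv_crd a y).
Proof.
split=> [[z [az bz] <-]|[[z az <-]]].
  by rewrite crdK //; split=> //; exists z.
by rewrite crdK // => bz; exists z.
Qed.

Lemma open_overlap a b : open (overlap a b).
Proof.
rewrite openE => y /overlapP[ay bz].
have nb : nbhs (inv_crd a y) (dom b) by apply: open_nbhs_nbhs; split=> //; exact: dom_open.
have H : nbhs y ((crd a @` dom a) `&` inv_crd a @^-1` dom b).
  exact: (filterI (near_in (@crd_open _ _ E a) ay) (inv_crd_continuous ay nb)).
by apply: filterS H => z [az bz']; apply/overlapP.
Qed.

Definition crd_jet N a c : 'M[R]_(N.+1, m) := \matrix_(q < N.+1, i < m) crd_der a c q ord0 i.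

Lemma crd_der0 a c : crd_der a c 0 = crd a (c 0).
Proof. by rewrite /crd_der derive1n0. Qed.

Lemma crd_jet_row0 N a c : row ord0 (crd_jet N a c) = crd a (c 0).
Proof. by apply/rowP => i; rewrite !mxE crd_der0. Qed.

Lemma crd_der_change N a b c p : smooth_curve c -> dom a (c 0) -> dom b (c 0) -> (p <= N)%N ->
  crd_der b c p = prolong (change a b) p (crd_jet N a c).
Proof.
move=> sc ac bc pN.
have [e1 e10 [in1 s1]] := sc a ac; have [e2 e20 [in2 _]] := sc b bc.
pose e := Num.min e1 e2.
have e0 : 0 < e by rewrite lt_min e10.
have sub1 : ball (0 : R) e `<=` ball (0 : R) e1 by apply: le_ball; rewrite ge_min lexx.
have sub2 : ball (0 : R) e `<=` ball (0 : R) e2 by apply: le_ball; rewrite ge_min lexx orbT.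
apply: (prolong_curve (@open_overlap a b) (change_smooth a b) (e := e) (f := crd b \o c) (g := crd a \o c)) => //.
- by move=> q; apply: class_C_sub sub1 _; exact: s1.
- move=> t Ut; have act : dom a (c t) by apply/in1/sub1.
  have bct : dom b (c t) by apply/in2/sub2.
  by split; [exists (c t)|rewrite /change /= crdK].
- exact: ballxx.
Qed.

Lemma jet_repP k (j : jet E k) : jet_curve k (jet_rep j) /\ sval j = jet_class k (jet_rep j).
Proof.
rewrite /jet_rep; case: (cid2 _) => c jc jE /=; by split.
Qed.

Lemma jet_rep_in k (j : jet E k) : sval j (jet_rep j).
Proof. by have [jc ->] := jet_repP j. Qed.

Lemma jet_crdE k a (j : jet E k) : jet_crd a j = crd_jet k a (jet_rep j).
Proof. by []. Qed.

Lemma jet_crd_change k a b (j : jet E k) : jet_dom a j -> jet_dom b j ->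
  jet_crd b j = prolongation (change a b) (jet_crd a j).
Proof.
move=> aj bj; have [[sc _] _] := jet_repP j.
apply/matrixP => p i; rewrite !mxE; congr (_ ord0 i).
have pk : (p <= k)%N by rewrite -ltnS.
by rewrite jet_crdE (crd_der_change sc aj bj pk).
Qed.

(** The value chosen by the definition is forced: the derivatives of a curve in the
    chart b are functions of those in the chart a. *)
Lemma jet_transitionE k a b (j : jet E k) : jet_dom a j -> jet_dom b j ->
  @jet_transition R m E k a b (jet_crd a j) = jet_crd b j.
Proof.
move=> aj bj; rewrite /jet_transition.
set P := (X in get X).
have : P (get P) by apply: getPex; exists (jet_crd b j), j.
case=> j' [aj' bj' E1 <-].
by rewrite (jet_crd_change aj bj) -E1 -jet_crd_change.
Qed.

Definition row_at k (x : 'M[R]_(k.+1, m)) (q : nat) : 'rV[R]_m := row (inord q) x.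

Lemma jet_nondeg k a (j : jet E k) : (0 < k)%N -> jet_dom a j -> row_at (jet_crd a j) 1 != 0.
Proof.
move=> k0 aj; have [[_ nd] _] := jet_repP j; have := nd k0 a aj.
apply: contra => /eqP r0; apply/eqP/rowP => i.
by have := congr1 (fun v : 'rV[R]_m => v ord0 i) r0; rewrite !mxE inordK.
Qed.

Lemma jet_row0 k a (j : jet E k) : row ord0 (jet_crd a j) = crd a (jet_base j).
Proof. exact: crd_jet_row0. Qed.

(** A polynomial in the chart with the prescribed derivatives is the curve sought. *)
Lemma jet_realize k a (x : 'M[R]_(k.+1, m)) : (crd a @` dom a) (row ord0 x) ->
  ((0 < k)%N -> row_at x 1 != 0) -> exists2 j : jet E k, jet_dom a j & jet_crd a j = x.
Proof.
move=> [z az Ez] nd.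
pose g := polynomial_curve k.+1 (row_at x); pose c t := inv_crd a (g t).
have i0 : inord 0 = ord0 :> 'I_k.+1 by apply/val_inj; rewrite /= inordK.
have g0 : g 0 = row ord0 x.
  by have := @polynomial_curve_jet R m k.+1 (row_at x) 0 isT; rewrite derive1n0 /row_at i0.
have c0 : c 0 = z by rewrite /c g0 -Ez crdK.
have sc : smooth_curve c.
  move=> b; rewrite c0 => bz.
  have cg : {for (0 : R), continuous g}.
    by have [cc _] := polynomial_curve_smooth k.+1 (row_at x) (openT : open [set: R]) 0%N; apply: cc.
  have O0 : overlap a b (g 0) by rewrite g0 -Ez; exists z.
  have /nbhs_ballP[e /= e0 eO] := cg _ (near_in (@open_overlap a b) O0).
  exists e => //; split=> [t /eO/overlapP[]//|].
  exact: (smooth_comp_mx (@ball_open _ _ _ _) (@open_overlap a b) (F := change a b) (G := g) eO (change_smooth a b) (polynomial_curve_smooth _ _ (@ball_open _ _ _ _))).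
have dc p : (p <= k)%N -> crd_der a c p = row_at x p.
  move=> pk; rewrite /crd_der -(polynomial_curve_jet (n := k.+1) (row_at x) pk).
  have cg : {for (0 : R), continuous g}.
    by have [cc _] := polynomial_curve_smooth k.+1 (row_at x) (openT : open [set: R]) 0%N; apply: cc.
  have A0 : (crd a @` dom a) (g 0) by rewrite g0 -Ez; exists z.
  have /nbhs_ballP[e /= e0 eO] := cg _ (near_in (@crd_open _ _ E a) A0).
  suff H q t : ball (0 : R) e t -> derive1n q (crd a \o c) t = derive1n q g t by apply: H; exact: ballxx.
  elim: q t => [|q IH] t Ut.
    by rewrite !derive1n0 /= /c; have [w aw <-] := eO t Ut; rewrite crdK.
  rewrite !derive1nS !derive1E; apply: near_eq_derive.
  by apply: filterS (near_in (@ball_open _ _ _ _) Ut) => s Us; rewrite IH.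
have jc : jet_curve k c.
  split=> // k0 b bc; apply/negP => /eqP d0.
  (* If the velocity vanished in another chart b, the chain rule would make it vanish
     in a. *)
  have := nd k0; rewrite -dc // (@crd_der_change 1 b a) //; last by rewrite c0.
  suff -> : prolong (change b a) 1 (crd_jet 1 b c) = 0 by rewrite eqxx.
  rewrite [LHS](_ : _ = 'D_(shift_field (crd_jet 1 b c)) (prolong (change b a) 0) (crd_jet 1 b c)) //.
  rewrite -(derive0 (prolong (change b a) 0) (crd_jet 1 b c)); apply: prolong_derive_dep => q s.
  by rewrite leqn0 => /eqP q0; rewrite !mxE q0 /= inordK // d0 mxE.
have ex : exists2 c', jet_curve k c' & jet_class k c = jet_class k c' by exists c.
pose j : jet E k := exist _ (jet_class k c) ex.
have [jc' r0 rd] : jet_class k c (jet_rep j) by exact: (jet_rep_in j).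
exists j; first by rewrite /jet_dom /= /jet_base r0 c0.
have ac : dom a (c 0) by rewrite c0.
apply/matrixP => p i; have pk : (p <= k)%N by rewrite -ltnS.
by rewrite mxE (rd a ac p pk) (dc p pk) mxE inord_val.
Qed.

Lemma proj_crd k l a (i : jet E k) (j : jet E l) : (k <= l)%N -> sval j `<=` sval i ->
  jet_base i = jet_base j /\ (jet_dom a i -> jet_crd a i = crd_proj k (jet_crd a j)).
Proof.
move=> kl ji; have [_ Ei] := jet_repP i.
have := ji _ (jet_rep_in j); rewrite Ei => -[_ b0 ders].
split=> [//|ai]; apply/matrixP => p q; have pk : (p <= k)%N by rewrite -ltnS.
by rewrite mxE [RHS]mxE [RHS]mxE inordK ?(ders a ai p pk) // ltnS (leq_trans pk).
Qed.

(** Agreement of the derivatives in one chart implies it in all the others, by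
    [crd_der_change]. *)
Lemma jet_sub_of_crd k l a (i : jet E k) (j : jet E l) : (k <= l)%N -> jet_dom a i -> jet_dom a j ->
  jet_crd a i = crd_proj k (jet_crd a j) -> sval j `<=` sval i.
Proof.
move=> kl ai aj ij c.
have [_ Ej] := jet_repP j; have [[si _] Ei] := jet_repP i.
rewrite Ej Ei => -[[sc nd] c0 dc].
have i0 : inord 0 = ord0 :> 'I_l.+1 by apply/val_inj; rewrite /= inordK.
have b0 : jet_base i = jet_base j.
  rewrite -(crdK (a := a) ai) -[RHS](crdK (a := a) aj); congr inv_crd.
  rewrite -(jet_row0 a i) -(jet_row0 a j) ij.
  by apply/rowP => q; rewrite !mxE /= i0.
have dij p : (p <= k)%N -> crd_der a (jet_rep j) p = crd_der a (jet_rep i) p.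
  move=> pk; apply/rowP => q.
  have := congr1 (fun M : 'M[R]_(k.+1, m) => M (inord p) q) ij.
  by rewrite !mxE !inordK // ltnS (leq_trans pk).
split; first by split=> // k0; apply: nd; exact: leq_trans kl.
  by rewrite c0; exact: esym b0.
move=> d di p pk.
have dj : dom d (jet_rep j 0) by rewrite -[jet_rep j 0]b0.
rewrite dc // ?(leq_trans pk) //.
have [[sj _] _] := jet_repP j.
rewrite (@crd_der_change k a d (jet_rep j)) // (@crd_der_change k a d (jet_rep i)) //.
congr prolong; apply/matrixP => q s; have qk : (q <= k)%N by rewrite -ltnS.
by rewrite mxE [RHS]mxE dij.
Qed.

(** The domain of the transition map, described in coordinates so that it is visibly
    open; [jet_overlapP] describes it by jets. *)
Definition jet_overlap k a b : set 'M[R]_(k.+1, m) :=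
  [set x | overlap a b (row ord0 x) /\ ((0 < k)%N -> row_at x 1 != 0)].

Lemma jet_overlapP k a b x : jet_overlap a b x <->
  exists j : jet E k, [/\ jet_dom a j, jet_dom b j & jet_crd a j = x].
Proof.
split=> [[/overlapP[ax bx] nd]|[j [aj bj <-]]].
  have [j aj jx] := jet_realize ax nd; exists j; split=> //.
  by rewrite /jet_dom /= -(crdK (a := a) aj) -(jet_row0 a j) jx.
split; last by move=> k0; apply: jet_nondeg.
by rewrite jet_row0; exists (jet_base j).
Qed.

Lemma open_jet_overlap k a b : open (@jet_overlap k a b).
Proof.
apply: openI; first by apply: open_prolong_dom; exact: open_overlap.
have [->|k0] := eqVneq k 0%N.
  by rewrite [X in open X](_ : _ = setT); [exact: openT|apply/seteqP; split].
rewrite [X in open X](_ : _ = [set x | row_at x 1 != 0]); last first.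
  by apply/seteqP; split=> x /= H; [apply: H; rewrite lt0n|].
apply: (@open_comp _ _ (fun x : 'M[R]_(k.+1, m) => row_at x 1) [set y | y != 0]).
  move=> x _; have [cc _] := smooth_linear setT (@row_linear R m k (inord 1)) 0%N.
  exact: cc.
rewrite openE => y /= y0; apply/nbhs_ballP; exists `|y|; first by rewrite /= normr_gt0.
by move=> z; rewrite -ball_normE /ball_ /=; apply: contraTN => /eqP ->; rewrite subr0 ltxx.
Qed.

Lemma prolonged_transition k a b : prolonged (@jet_overlap k a b) (@jet_transition R m E k a b).
Proof.
have oJ := @open_jet_overlap k a b.
have pT := prolonged_prolongation (@open_overlap a b) (change_smooth a b) (N := k).
have TE x : jet_overlap a b x -> prolongation (change a b) x = @jet_transition R m E k a b x.
  by move=> /jet_overlapP[j [aj bj <-]]; rewrite jet_transitionE // -jet_crd_change.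
have [sT HS HX] := pT.
have sub : @jet_overlap k a b `<=` prolong_dom (overlap a b) by move=> x [].
split=> [p|x v Jx|x p j Jx pk].
- by apply: class_C_eq oJ TE _; apply: class_C_sub sub _; exact: sT.
- have DE u : 'D_u (@jet_transition R m E k a b) x = 'D_u (prolongation (change a b)) x.
    by apply: near_eq_derive; apply: filterS (near_in oJ Jx) => y Jy; rewrite TE.
  by rewrite !DE HS //; apply: sub.
- rewrite -(TE _ Jx) (HX _ _ _ (sub _ Jx) pk).
  by apply: near_eq_derive; apply: filterS (near_in oJ Jx) => y Jy; rewrite TE.
Qed.

End Jets.

(** * Passage to the other charts *)

Section Extension.
#[local] Opaque derive.
Context {R : realType} {m : nat} {E : manifold R m}.
Implicit Types (a b d : chart E).
Local Notation jt k := (@jet_transition R m E k).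

Lemma open_preim_in (V W : normedModType R) (J : set V) (T : V -> W) (A : set W) :
  open J -> smooth_on J T -> open A -> open [set x | J x /\ A (T x)].
Proof.
move=> oJ sT oA; rewrite openE => x [Jx Ax].
have [cT _] := sT 0%N.
have H : nbhs x (J `&` T @^-1` A).
  exact: (filterI (near_in oJ Jx) (cT x Jx _ (near_in oA Ax))).
by apply: filterS H => y [].
Qed.

Lemma jet_overlap_proj k L a b x : (k <= L)%N -> @jet_overlap R m E L b a x -> jet_overlap b a (crd_proj k x).
Proof.
move=> kL [ov nd]; have i0 : inord 0 = ord0 :> 'I_L.+1 by apply/val_inj; rewrite /= inordK.
split.
  suff -> : row ord0 (crd_proj k x) = row ord0 x by [].
  by apply/rowP => j; rewrite !mxE /= i0.
move=> k0; suff -> : row_at (crd_proj k x) 1 = row_at x 1 by apply: nd; exact: leq_trans kL.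
by apply/rowP => j; rewrite !mxE inordK.
Qed.

Lemma transition_proj k L a b x : (k <= L)%N -> jet_overlap b a x ->
  jt k b a (crd_proj k x) = crd_proj k (jt L b a x).
Proof.
move=> kL Jx; have /jet_overlapP[j [bj aj jx]] := Jx.
have /jet_overlapP[i [bi ai ix]] := jet_overlap_proj kL Jx.
rewrite -ix -jx !jet_transitionE //.
have sub : sval j `<=` sval i by apply: (jet_sub_of_crd (a := b)) => //; rewrite ix jx.
exact: (proj_crd a kL sub).2.
Qed.

Lemma transition_proj_derive k L a b x v : (k <= L)%N -> jet_overlap b a x ->
  'D_(crd_proj k v) (jt k b a) (crd_proj k x) = crd_proj k ('D_v (jt L b a) x).
Proof.
move=> kL Jx; have [sT _ _] := @prolonged_transition R m E L b a.
rewrite -(derive_comp_linear (jt k b a) x v (@crd_proj_linear R m L k)).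
have -> : 'D_v (fun y => jt k b a (crd_proj k y)) x = 'D_v (fun y => crd_proj k (jt L b a y)) x.
  by apply: near_eq_derive; apply: filterS (near_in (@open_jet_overlap R m E L b a) Jx) => y Jy; rewrite transition_proj.
have sp := smooth_linear setT (@crd_proj_linear R m L k).
have [_ ->] := is_derive_comp_mx (v := v) openT (I : [set: 'M[R]_(L.+1, m)] (jt L b a x)) sp (smooth_derivable sT Jx).
exact/derive_linear/crd_proj_linear.
Qed.

Lemma lpull_fpull k L r a b (t : lform R m k r) : (k <= L)%N ->
  eqon (@jet_overlap R m E L b a) (lpull (fpull (jt k b a) t)) (fpull (jt L b a) (lpull t)).
Proof.
move=> kL x Jx v; rewrite /lpull /fpull transition_proj //; congr (t _ _).
by apply/funext => i; rewrite transition_proj_derive.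
Qed.

Lemma same_base k b (i j : jet E k) : jet_dom b i -> jet_dom b j -> jet_crd b i = jet_crd b j ->
  jet_base i = jet_base j.
Proof.
move=> bi bj ij; rewrite -(crdK (a := b) bi) -[RHS](crdK (a := b) bj); congr inv_crd.
by rewrite -!jet_row0 ij.
Qed.

Variables (k : nat) (W : set (jet E k)) (a : chart E) (A : set 'M[R]_(k.+1, m)).
Hypotheses (oW : jet_open W) (oA : open A) (AW : A `<=` in_crd a W).

(** The neighbourhood is cut down to the domain of one chart, so that the pull-back from
    this chart defines the solution in all charts. *)
Definition chart_part : set (jet E k) := [set i | [/\ W i, jet_dom a i & A (jet_crd a i)]].
Local Notation U := chart_part.

Lemma chart_part_open : jet_open U.
Proof.
move=> b; have [sT _ _] := @prolonged_transition R m E k b a.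
have -> : in_crd b U = in_crd b W `&` [set x | jet_overlap b a x /\ A (jt k b a x)].
  apply/seteqP; split=> x.
    move=> [i [[Wi ai Ai] bi] <-]; split; first by exists i.
    by split; [apply/jet_overlapP; exists i|rewrite jet_transitionE].
  move=> [[i [Wi bi] <-] [/jet_overlapP[j [bj aj ji]] Ai]].
  have ai : jet_dom a i by rewrite /jet_dom /= -(same_base bj bi ji).
  by exists i => //; split=> //; split=> //; rewrite jet_transitionE in Ai.
apply: openI; first exact: oW.
exact: open_preim_in (@open_jet_overlap R m E k b a) sT oA.
Qed.

Lemma preim_dom l (j : jet E l) : (k <= l)%N -> jet_preim l U j -> jet_dom a j.
Proof.
by move=> kl [i [_ ai _] ji]; rewrite /jet_dom /= -(proj_crd a kl ji).1.
Qed.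

Lemma in_crd_preim l b x : (k <= l)%N ->
  in_crd b (jet_preim l U) x <-> jet_overlap b a x /\ cylinder A (jt l b a x).
Proof.
move=> kl; split.
  move=> [j [Uj bj] <-]; have aj := preim_dom kl Uj.
  split; first by apply/jet_overlapP; exists j.
  have [i [_ ai Ai] ji] := Uj.
  by rewrite jet_transitionE // /cylinder /= -(proj_crd a kl ji).2.
move=> [/jet_overlapP[j [bj aj <-]]]; rewrite jet_transitionE // => Aj; have [i [Wi ai] Ei] := AW Aj.
exists j => //; split=> //; exists i; last exact: (jet_sub_of_crd (a := a)).
by split=> //; rewrite Ei.
Qed.

Lemma open_in_crd_preim l b : (k <= l)%N -> open (in_crd b (jet_preim l U)).
Proof.
move=> kl; have [sT _ _] := @prolonged_transition R m E l b a.
have -> : in_crd b (jet_preim l U) = [set x | jet_overlap b a x /\ cylinder A (jt l b a x)].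
  by apply/seteqP; split=> x /in_crd_preim; apply.
have oC : open (cylinder (N := l) A) by exact: open_cylinder.
exact: (open_preim_in (@open_jet_overlap R m E l b a) sT oC).
Qed.

(** On the chart b the solution is the pull-back of [psi] by the transition map from b
    to a. Naturality of delta gives the pull-back of the representative of [theta] in a,
    and that is the representative in b. *)
Lemma extend_solution r (theta : jet_form E k r.+1) l (psi : lform R m l r) :
  is_jet_form W theta -> solution A (theta a) psi ->
  exists psi' : jet_form E l r,
   [/\ (k <= l)%N, is_jet_form (jet_preim l U) psi',
      (0 < r)%N -> vanishes_on (jet_preim l U) (form_S psi') &
      eq_pullback U (form_delta psi') theta].
Proof.
move=> [_ _ ctheta] [kl fpsi Spsi dpsi].
have oC N : open (cylinder (N := N) A) by exact: open_cylinder.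
pose D L b := in_crd b (jet_preim L U).
have oD L b : (k <= L)%N -> open (D L b) by move=> kL; exact: open_in_crd_preim.
have subD L b : (k <= L)%N -> D L b `<=` jet_overlap b a by move=> kL x /(in_crd_preim _ _ kL)[].
have DA L b : (k <= L)%N -> forall x, D L b x -> cylinder A (jt L b a x) by move=> kL x /(in_crd_preim _ _ kL)[].
have pT L b : (k <= L)%N -> prolonged (D L b) (jt L b a).
  move=> kL; have [sT HS HX] := @prolonged_transition R m E L b a; have sb := subD L b kL.
  split=> [p|x v /sb|x p j /sb]; [exact: class_C_sub sb (sT p)|exact: HS|exact: HX].
pose psi' : jet_form E l r := fun b => fpull (jt l b a) psi.
have fpsi' b : is_form (D l b) (psi' b).
  exact: (is_form_fpull (oD l b kl) (@oC _) (DA l b kl) (pT l b kl) fpsi).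
exists psi'; split=> //.
- split.
  + by move=> b x Dx; split; [exact: (fpsi' b).1.1|exact: (fpsi' b).2].
  + by move=> b v; exact: (fpsi' b).1.2.
  + move=> b b' j Uj bj b'j v.
    have aj := preim_dom kl Uj.
    have Jbb' : jet_overlap b b' (jet_crd b j) by apply/jet_overlapP; exists j.
    have Jb'a : jet_overlap b' a (jet_crd b' j) by apply/jet_overlapP; exists j.
    have Db : D l b (jet_crd b j) by exists j.
    rewrite /psi' /fpull !jet_transitionE //; congr (psi _ _); apply/funext => i.
    have [s1 _ _] := @prolonged_transition R m E l b b'.
    have [s2 _ _] := @prolonged_transition R m E l b' a.
    have B2 : jet_overlap b' a (jt l b b' (jet_crd b j)) by rewrite jet_transitionE.
    have [_] := is_derive_comp_mx (v := v i) (@open_jet_overlap R m E l b' a) B2 s2 (smooth_derivable s1 Jbb').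
    rewrite jet_transitionE // => <-.
    apply: near_eq_derive.
    have H : nbhs (jet_crd b j) (D l b `&` jet_overlap b b').
      exact: (filterI (near_in (oD l b kl) Db) (near_in (@open_jet_overlap R m E l b b') Jbb')).
    apply: filterS H => y [[j' [Uj' bj'] <-] /jet_overlapP[j2 [bj2 b'j2 E2]]].
    have b'j' : jet_dom b' j' by rewrite /jet_dom /= -(same_base bj2 bj' E2).
    have aj' := preim_dom kl Uj'.
    by rewrite !jet_transitionE.
- move=> r0 b x Dx v; rewrite /form_S /psi'.
  rewrite (fpull_lS (pT l b kl) psi Dx) /fpull (Spsi r0) //.
  exact: (DA l b kl).
pose L := delta_order l r.
have lL : (l < L)%N by rewrite /L /delta_order ltnS leq_addl.
have kL : (k <= L)%N by apply: leq_trans kl _; exact: ltnW.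
exists L; split=> // b x Dx v.
rewrite /form_delta (lpull_ldelta _ (leqnn L)).
pose M := (r.+1 * l)%N.
have oDL := oD L b kL.
have E1 : eqon (D L b) (lpull (psi' b)) (fpull (jt L b a) (lpull psi)).
  by move=> y Dy; apply: lpull_fpull; [exact: ltnW|exact: (subD L b kL)].
have fL : is_form (cylinder (N := L) A) (lpull psi).
  have -> : cylinder (N := L) A = cylinder (cylinder (N := l) A).
    by apply/funext => y; rewrite [RHS]cylinder_proj.
  by apply: is_form_lpull => //; exact: open_cylinder.
have E2 : eqon (D L b) (ldelta_trunc M (lpull (psi' b))) (ldelta_trunc M (fpull (jt L b a) (lpull psi))).
  have e1 := eqon_ld oDL E1.
  by apply: eqon_sub => //; apply: eqon_lie => //; apply: eqon_lP_trunc.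
have E3 : eqon (D L b) (ldelta_trunc M (fpull (jt L b a) (lpull psi))) (fpull (jt L b a) (ldelta_trunc M (lpull psi))).
  apply: (fpull_ldelta_trunc oDL (@oC _) (DA L b kL) (pT L b kL) (e := l)) => //.
  by exists psi.
have E4 : eqon (cylinder (N := L) A) (ldelta_trunc M (lpull psi)) (lpull (theta a)).
  move=> y Ay w; rewrite -(dpsi L (leqnn L) y Ay w) (lpull_ldelta _ (leqnn L)).
  by rewrite /ldelta_trunc fsubE.
rewrite -[LHS](fsubE (ld (lpull (psi' b))) _ x v) -/(ldelta_trunc M _) E2 // E3 //.
rewrite {1}/fpull E4; last exact: (DA L b kL).
rewrite -[LHS]/(fpull (jt L b a) (lpull (theta a)) x v) -lpull_fpull //; last exact: (subD L b kL).
have [j [Uj bj] <-] := Dx; have [i [Wi ai Ai] ji] := Uj.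
have bi : jet_dom b i by rewrite /jet_dom /= (proj_crd b kL ji).1.
rewrite /lpull -(proj_crd b kL ji).2 // /fpull jet_transitionE //.
exact: ctheta.
Qed.

End Extension.

Section CoordinateBalls.
#[local] Opaque derive.
Context {R : realType} {n : nat} {E : manifold R n.+1}.

Lemma ball_star p q (x0 : 'M[R]_(p, q)) (e : R) (s : R) x : 0 <= s <= 1 -> ball x0 e x ->
  ball x0 e (x0 + s *: (x - x0)).
Proof.
move=> /andP[s0 s1]; rewrite -ball_normE /ball_ /= distrC => xe.
rewrite opprD addrA subrr sub0r normrN normrZ (le_lt_trans _ xe) // ler_piMl // ger0_norm //.
Qed.

Lemma in_crd_lift k l a (W : set (jet E k)) (x : 'M[R]_(l.+1, n.+1)) : (k <= l)%N ->
  in_crd a W (crd_proj k x) -> ((0 < l)%N -> row_at x 1 != 0) -> in_crd a (jet_preim l W) x.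
Proof.
move=> kl [i [Wi ai] ix] nd.
have i0 : inord 0 = ord0 :> 'I_l.+1 by apply/val_inj; rewrite /= inordK.
have r0 : row ord0 x = crd a (jet_base i).
  by rewrite -jet_row0 ix; apply/rowP => j; rewrite !mxE /= i0.
have [|j aj jx] := @jet_realize R n.+1 E l a x _ nd.
  by rewrite r0; exists (jet_base i).
exists j => //; split=> //; exists i => //.
by apply: (jet_sub_of_crd (a := a)) => //; rewrite ix jx.
Qed.

(** In order 0 the form delta theta is the pull-back of d theta, and every point of [A]
    lifts to a non-degenerate jet of higher order. *)
Lemma ld_eq0_order0 k a r (W : set (jet E k)) (A : set 'M[R]_(k.+1, n.+1)) (theta : jet_form E k r) :
  k = 0%N -> A `<=` in_crd a W ->
  vanishes_on (jet_preim (delta_order k r) W) (form_delta theta) ->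
  eqon A (ld (theta a)) (fun _ _ => 0).
Proof.
move=> k0 AW dtheta x Ax v.
set N := delta_order k r in dtheta *.
have kN : (k <= N)%N by rewrite /N /delta_order ltnW // ltnS leq_addl.
(* Any lift with non-zero velocity would do. *)
pose y : 'M[R]_(N.+1, n.+1) := \matrix_(p < N.+1, i < n.+1) (if nat_of_ord p == 0%N then x ord0 i else 1).
have yx : crd_proj k y = x.
  apply/matrixP => p i; rewrite !mxE; have p0 : p = ord0.
    by apply/val_inj => /=; have := ltn_ord p; rewrite [X in (_ < X.+1)%N]k0; case: (nat_of_ord p).
  by rewrite p0 inordK.
have Wy : in_crd a (jet_preim N W) y.
  apply: in_crd_lift => //; first by rewrite yx; apply: AW.
  move=> _; apply/eqP => /rowP/(_ ord0) /eqP; rewrite !mxE inordK // oner_eq0 //.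
have := dtheta a y Wy (fun i => crd_proj N (v i)).
have := lpull_ldelta (theta a) (leqnn N); rewrite lpull_id /form_delta => ->.
have -> : lP_trunc (r.+1 * k) (ld (lpull (l := N) (theta a))) = fun _ _ => 0.
  have -> : (r.+1 * k = 0)%N by rewrite k0 muln0.
  by apply/funext => z; apply/funext => w; rewrite /lP_trunc big_ord0.
rewrite lie_zero subr0 -lpull_ld /lpull yx => <-; congr (ld _ _ _); apply/funext => i.
by rewrite crd_proj_proj // crd_proj_id.
Qed.

End CoordinateBalls.

Theorem theorem5 (R : realType) (n : nat) (E : manifold R n.+1) (r k : nat)
    (W : set (jet E k)) (theta : jet_form E k r.+1) :
  jet_open W ->
  is_jet_form W theta ->
  vanishes_on W (form_S theta) ->
  vanishes_on (jet_preim (delta_order k r.+1) W) (form_delta theta) ->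
  forall j, W j ->
    exists U : set (jet E k), [/\ jet_open U, U j, U `<=` W &
      exists (l : nat) (psi : jet_form E l r),
        [/\ (k <= l)%N,
            is_jet_form (jet_preim l U) psi,
            (0 < r)%N -> vanishes_on (jet_preim l U) (form_S psi)
          & eq_pullback U (form_delta psi) theta]].
Proof.
move=> oW ftheta Stheta dtheta j Wj.
have [a aj] := dom_cover (jet_base j).
pose x0 := jet_crd a j.
have Wx0 : in_crd a W x0 by exists j.
have /nbhs_ballP[e /= e0 AW] := near_in (oW a) Wx0.
pose A := ball x0 e.
have oA : open A by exact: ball_open.
have star (s : R) x : 0 <= s <= 1 -> A x -> A (x0 + s *: (x - x0)) by exact: ball_star.
have [tm ts _] := ftheta.
have fa : is_form A (theta a).
  split; first split.
  - by move=> x Ax; have [] := tm a x (AW x Ax).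
  - by move=> v p; apply: class_C_sub AW _; apply: ts.
  - by move=> x Ax; have [] := tm a x (AW x Ax).
have Sa : eqon A (lS (theta a)) (fun _ _ => 0) by move=> x Ax v; apply: Stheta; apply: AW.
have [l [psi sol]] : exists l (psi : lform R n.+1 l r), solution A (theta a) psi.
  have [k0|k0] := posnP k.
    exact: (local_solution_order0 oA star fa k0 (ld_eq0_order0 k0 AW dtheta)).
  apply: (local_solution oA star fa Sa) => x Ax v; apply: dtheta.
  apply: in_crd_lift; [by rewrite /delta_order ltnW // ltnS leq_addl|exact: AW|].
  move=> _; have [i [_ ai] ix] := AW _ Ax.
  have := jet_nondeg k0 ai; rewrite ix.
  suff -> : row_at (crd_proj k x) 1 = row_at x 1 by [].
  by apply/rowP => q; rewrite !mxE inordK.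
have [psi' psiP] := extend_solution oA AW ftheta sol.
exists (chart_part W a A); split.
- exact: chart_part_open.
- by split=> //; exact: ballxx.
- by move=> i [].
- by exists l, psi'.
Qed.
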